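(* Let $C \ge \tfrac12$, let $q = dd'e$ for some $d, d', e \in \mathbb{Z}_+$ with $d' \mid d$ and $(d,e)=1$, and let $f$ be the largest integer such that $f^2 \mid qd$. Let $\mathcal{I}, \mathcal{J} \subset \mathbb{Z}_+$ be intervals of lengths $|\mathcal{I}|, |\mathcal{J}| \ll C^{1/2+o(1)}$ with $\max(\mathcal{I} \cup \mathcal{J}) \ll C^{O(1)}$. Then for any complex sequences $(\alpha_m)_{m \in \mathcal{I}}$, $(\beta_n)_{n \in \mathcal{J}}$, one has $$\sum_{\substack{C < c \le 2C \\ q \mid c}} \left| \sum_{\substack{m \in \mathcal{I},\ n \in \mathcal{J} \\ (m,n,q)=1}} \alpha_m \beta_n S(m,n;c) \right| \ll \|\alpha\|\,\|\beta\|\, \frac{C^{2+o(1)}}{q} \left( \frac{f}{\min(C,d^2) + \min\left(q, d^2\frac{C}{q}\right)} \right)^{\frac16}.$$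
   Context: $\mathbb{Z}_+$ is the set of positive integers; $c$ ranges over integers; $e(t) := \exp(2\pi i t)$ when $e(\cdot)$ is applied to a real argument. The Kloosterman sum is $S(m,n;c) := \sum_{x \in (\mathbb{Z}/c\mathbb{Z})^\times} e\left(\frac{mx+n\bar{x}}{c}\right)$, where $x\bar{x} \equiv 1 \pmod c$. $(\cdot,\cdot)$ and $(\cdot,\cdot,\cdot)$ denote greatest common divisors. An interval is a finite set of consecutive integers, and $|\mathcal{I}|$ is its cardinality. $\|\alpha\| := (\sum_m |\alpha_m|^2)^{1/2}$ and similarly for $\beta$. Asymptotic conventions: $X \ll Y$ means $|X| \le K Y$ for an absolute constant $K$. A factor $C^{o(1)}$ stands for $C^{\eta(C)}$ with $\eta$ bounded and $\eta(C) \to 0$ as $C \to \infty$; a conclusion $X \ll C^{o(1)} Y$ is equivalent to: for every $\varepsilon > 0$ there is $K_\varepsilon$ with $|X| \le K_\varepsilon C^{\varepsilon} Y$, uniformly in all parameters and sequences. The hypotheses mean that constants $A, B$ and a bounded function $\eta_0$ with $\eta_0(C) \to 0$ as $C\to\infty$ are fixed, with $|\mathcal{I}|,|\mathcal{J}| \le A C^{1/2+\eta_0(C)}$ and $\max(\mathcal{I}\cup\mathcal{J}) \le B C^{B}$; constants in the conclusion may then also depend on $A, B, \eta_0$. *)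

(* Defs.v *)
From HB Require Import structures.
From mathcomp Require Import all_boot all_order all_algebra.
From mathcomp Require Import finmap.
From mathcomp Require Import all_classical all_reals all_analysis.
From mathcomp Require Import complex.

Set Implicit Arguments.
Unset Strict Implicit.
Unset Printing Implicit Defensive.

Import Order.TTheory GRing.Theory Num.Theory.
Import numFieldNormedType.Exports.

Local Open Scope ring_scope.

Definition cmod (R : realType) (z : R[i]) : R := ComplexField.Normc.normc z.

Definition e2pi (R : realType) (t : R) : R[i] :=
  Complex (cos (2 * pi * t)) (sin (2 * pi * t)).

Definition modinv (c x : nat) : nat := (egcdn x c).1.

Lemma modinvP (c x : nat) : coprime x c -> (x * modinv c x = 1 %[mod c])%N.
Proof.
rewrite /modinv; case: (posnP x) => [->|x_gt0].
  by rewrite /coprime gcd0n => /eqP ->; rewrite !modn1.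
by case: egcdnP => //= u v Euv _ /eqP g1; rewrite mulnC Euv g1 modnMDl.
Qed.

(* (Z/cZ)^* is indexed by the residues 0 <= x < c coprime to c. The ring 'Z_c
   is avoided because 'Z_1 has two elements; here c = 1 gives the single
   residue 0, hence S(m, n; 1) = 1. *)
Definition Kloosterman (R : realType) (m n : int) (c : nat) : R[i] :=
  \sum_(x < c | coprime x c)
    e2pi ((m * (x : nat)%:Z + n * (modinv c x)%:Z)%:~R / c%:R : R).

Definition is_nat_interval (I : {fset nat}) : Prop :=
  exists a b : nat, forall m : nat, (m \in I) = (a <= m < b)%N.

Definition l2norm (R : realType) (I : {fset nat}) (u : nat -> R[i]) : R :=
  Num.sqrt (\sum_(m <- I) cmod (u m) ^+ 2).

(* The exponents o(1), as functions of C >= 1/2. *)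
Definition o1_exponent (R : realType) (eta : R -> R) : Prop :=
  [bounded eta C | C in [set C : R | 2^-1 <= C]%classic] /\
  (eta C @[C --> +oo] --> (0 : R))%classic.

Definition is_largest_square_root_divisor (N f : nat) : Prop :=
  (f ^ 2 %| N)%N /\ forall g : nat, (g ^ 2 %| N)%N -> (g <= f)%N.

(* Main.v *)
Require Import Defs.
From HB Require Import structures.
From mathcomp Require Import all_boot all_order all_algebra.
From mathcomp Require Import cyclic.
From mathcomp Require Import zify ring lra.

Set Implicit Arguments.
Unset Strict Implicit.
Unset Printing Implicit Defensive.

Import Order.TTheory GRing.Theory Num.Theory.

(** Fix c = r q and put, on pairs of residues modulo c,
    Phi_alpha(x, y) = sum_m alpha_m e(m x / (c y)) for y a unit, and similarly
    Phi_beta with x and y exchanged; then phi(c) sum alpha_m beta_n S(m, n; c)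
    is the pairing of Phi_alpha with Phi_beta.  When m and n run over intervals
    of length about sqrt(c) / 8, the pairing is unchanged, up to harmless
    factors, by the unipotent maps x -> x + h y and y -> y - k x with
    h, k < H = sqrt(c), so that Phi_alpha may be replaced by T Phi_alpha for an
    average T of such maps in SL_2(Z/c).  On SL_2 one has
    |T f|^6 <= |T T* T f|^2 |f|^4.  The right translates of Phi_alpha by
    lower unipotents congruent to 1 modulo q are pairwise orthogonal (after
    removing frequencies that Phi_beta does not see), and T T* T treats them
    all alike; Bessel's inequality then gains their number over the
    Hilbert-Schmidt norm of T T* T, which counts pairs of words in unipotents
    whose quotient is scalar modulo multiples of r.  An elementary count gives
    |sum|^6 << c^(6 + o(1)) g s(q) (1/r + 1/q) |alpha|^6 |beta|^6, where s(q)^2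
    is the largest square dividing q and g is a common divisor of r and of all
    m, n involved.

    The theorem follows by summing over c = q x with two choices of the
    factorization, c = d (d' e x) and c = (d x) (d' e), using d s(d' e) <= f. *)

Local Open Scope nat_scope.

(** * Divisors and square divisors *)

(** The sixth power comes from the size of the group: a letter of T has H^2, about c, choices, so
    the words of T T* T number about c^3, the order of magnitude of SL_2(Z/c). This is the first
    product whose kernel can be nearly flat, and reaching it from T costs two applications of
    Cauchy-Schwarz.

    Two obstacles shape the rest. Translates of Phi_alpha fail to be orthogonal when a frequency m
    satisfies m q (t - t') = 0 modulo c; for t, t' < r / g no such difference can affect both alpha
    and beta, and this is where g enters. Moreover, on SL_2 the second column depends on the first,
    which spoils orthogonality; Bessel's inequality is therefore proved on all 2 by 2 matrices,
    where the second column is free, and brought back by scaling, at the price of the number of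
    square roots of a residue.

    The choice of r balances the number r / g of translates against the number of words that are
    scalar modulo r. With r = d the condition (m, n, q) = 1 forces g = 1; with r = d x it forces g |
    x, and the loss of g is recovered in the sum over x. *)

Definition ndiv (n : nat) : nat := size (divisors n).

Definition sqrtdiv (n : nat) : nat := (\max_(k < n.+1 | k ^ 2 %| n) k)%N.

Lemma ndiv_gt0 (n : nat) : (0 < n)%N -> (0 < ndiv n)%N.
Proof.
move=> n0; rewrite /ndiv; case E : (divisors n) => //.
by have := dvdn_divisors n n0; rewrite E dvdnn.
Qed.

Lemma sum_dvd (F : nat -> nat) (n : nat) : (0 < n)%N ->
  (\sum_(g < n.+1 | g %| n) F g = \sum_(g <- divisors n) F g)%N.
Proof.
move=> n0; rewrite -(big_mkord (fun g => g %| n) F) -big_filter.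
apply: perm_big; apply: uniq_perm.
- by rewrite filter_uniq // iota_uniq.
- exact: divisors_uniq.
- move=> x; rewrite mem_filter mem_index_iota -dvdn_divisors //=.
  by case: (boolP (x %| n)%N) => //= /(dvdn_leq n0); rewrite ltnS.
Qed.

Lemma leq_sum_dvd_const (F : nat -> nat) (n B : nat) : (0 < n)%N ->
  (forall g, (g %| n)%N -> (F g <= B)%N) -> (\sum_(g <- divisors n) F g <= ndiv n * B)%N.
Proof.
move=> n0 h; rewrite big_seq.
apply: (@leq_trans (\sum_(g <- divisors n) B)%N).
  rewrite [leqRHS]big_seq; apply: leq_sum => g; rewrite -dvdn_divisors //; exact: h.
by rewrite big_const_seq count_predT iter_addn_0 mulnC.
Qed.

Lemma leq_totient_mul_prime (p m : nat) : prime p -> 0 < m -> totient m <= totient (p * m).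
Proof.
move=> pp m0.
have [e [m' pm' ->]] : {e : nat & {m' | coprime p m' & m = m' * p ^ e}}.
  by case: (pfactor_coprime pp m0) => m' h1 h2; exists (logn p m), m'.
have -> : p * (m' * p ^ e) = m' * p ^ e.+1 by rewrite expnS; ring.
rewrite !totient_coprime ?coprimeXr // 1?coprime_sym // leq_mul2l; apply/orP; right.
case: e => [|e]; first by rewrite expn0 (_ : totient 1 = 1) ?expn1 ?totient_gt0 ?prime_gt0 //.
by rewrite !totient_pfactor // leq_mul2l leq_exp2l ?prime_gt1 //= leqnSn orbT.
Qed.

Lemma leq_totient_dvd (g n : nat) : 0 < n -> g %| n -> totient g <= totient n.
Proof.
move=> n0 /dvdnP[k En]; move: n0; rewrite {}En {n}.
elim/ltn_ind: k => k IH; rewrite muln_gt0 => /andP[k0 g0].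
case: (ltnP 1 k) => [k1|]; last first.
  move=> k1; have k1' : k = 1 by apply/eqP; rewrite eqn_leq k1 k0.
  by rewrite k1' mul1n.
have pp := pdiv_prime k1; have /dvdnP[k' Ek] := pdiv_dvd k.
move: Ek; set p := pdiv k => Ek.
have p1 : 1 < p := prime_gt1 pp.
have k'0 : 0 < k' by case: (k') Ek k0 => // ->.
have lt : k' < k by rewrite Ek -[ltnLHS]muln1 ltn_pmul2l.
apply: (leq_trans (IH k' lt _)); first by rewrite muln_gt0 k'0.
have -> : k * g = p * (k' * g) by rewrite Ek; ring.
by apply: leq_totient_mul_prime; rewrite // muln_gt0 k'0.
Qed.

(** Gauss's identity writes n as the sum of phi(g) over g | n, and no term exceeds phi(n). *)
Lemma leq_totient_ndiv (n : nat) : 0 < n -> n <= totient n * ndiv n.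
Proof.
move=> n0; rewrite -{1}[n]sum_totient_dvd sum_dvd // mulnC.
by apply: leq_sum_dvd_const => // g gn; apply: leq_totient_dvd.
Qed.

Lemma dvdn_sqrtdiv (n : nat) : 0 < n -> (sqrtdiv n) ^ 2 %| n.
Proof.
move=> n0; rewrite /sqrtdiv.
have h0 : (1 < n.+1) by [].
have card0 : 0 < #|[pred k : 'I_n.+1 | k ^ 2 %| n]|.
  by apply/card_gt0P; exists (Ordinal (h0 : 1 < n.+1)); rewrite inE /= exp1n dvd1n.
by have [k kP ->] := eq_bigmax_cond (fun k : 'I_n.+1 => nat_of_ord k) card0.
Qed.

Lemma leq_sqrtdiv (n k : nat) : 0 < n -> k ^ 2 %| n -> k <= sqrtdiv n.
Proof.
move=> n0 kn; have kn1 : k < n.+1.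
  by rewrite ltnS (leq_trans _ (dvdn_leq n0 kn)) // expnS expn1; case: (k) => // k'; rewrite leq_pmulr.
exact: (@leq_bigmax_cond _ (fun k : 'I_n.+1 => k ^ 2 %| n) (fun k => nat_of_ord k) (Ordinal kn1)).
Qed.

Lemma sqrtdiv_gt0 (n : nat) : 0 < n -> 0 < sqrtdiv n.
Proof. by move=> n0; apply: leq_sqrtdiv. Qed.

Lemma sqrtdiv_dvd (m n : nat) : 0 < n -> m %| n -> sqrtdiv m <= sqrtdiv n.
Proof.
move=> n0 mn; have m0 : 0 < m by apply: (dvdn_gt0 n0).
by apply: leq_sqrtdiv => //; apply: dvdn_trans mn; apply: dvdn_sqrtdiv.
Qed.

(** Cancelling gcd(k, g) leaves k' coprime to g' with k'^2 | g'^2 n, so k'^2 divides n. *)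
Lemma sqrtdiv_sqr_mul (g n : nat) : 0 < g -> 0 < n -> sqrtdiv (g ^ 2 * n) <= g * sqrtdiv n.
Proof.
move=> g0 n0; set k := sqrtdiv _.
have N0 : 0 < g ^ 2 * n by rewrite muln_gt0 expn_gt0 g0.
have kN : k ^ 2 %| g ^ 2 * n by apply: dvdn_sqrtdiv.
have k0 : 0 < k by apply: sqrtdiv_gt0.
pose e := gcdn k g; have e0 : 0 < e by rewrite gcdn_gt0 k0.
have /dvdnP[k' Ek] := dvdn_gcdl k g; have /dvdnP[g' Eg] := dvdn_gcdr k g.
have cop : coprime k' g'.
  rewrite /coprime -(eqn_pmul2r e0) muln_gcdl /e -Ek -Eg mul1n //.
have : k' ^ 2 %| g' ^ 2 * n.
  rewrite -(@dvdn_pmul2r (e ^ 2)) ?expn_gt0 ?e0 //.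
  by rewrite mulnAC -!expnMn -Ek -Eg.
rewrite Gauss_dvdr ?coprimeXl ?coprimeXr // => /(leq_sqrtdiv n0) k's.
rewrite Ek mulnC; apply: leq_mul => //.
exact: dvdn_leq (dvdn_gcdr _ _).
Qed.

Lemma sqrtdiv_coprime_mul (u m : nat) : 0 < u -> 0 < m -> coprime u m ->
  sqrtdiv (u * m) <= sqrtdiv u * sqrtdiv m.
Proof.
move=> u0 m0 um; set k := sqrtdiv (u * m).
have N0 : 0 < u * m by rewrite muln_gt0 u0.
have kN : k ^ 2 %| u * m by apply: dvdn_sqrtdiv.
have k0 : 0 < k by apply: sqrtdiv_gt0.
(* The part of k inside u is a; the cofactor b is coprime to u / a, hence divides m, and the square
   of k splits accordingly. *)
pose a := gcdn k u; have a0 : 0 < a by rewrite gcdn_gt0 k0.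
have /dvdnP[b Ek] := dvdn_gcdl k u; have /dvdnP[u' Eu] := dvdn_gcdr k u.
have cop : coprime b u'.
  by rewrite /coprime -(eqn_pmul2r a0) muln_gcdl /a -Ek -Eu mul1n.
have kN' : b * k %| u' * m.
  rewrite -(@dvdn_pmul2r a) //.
  have -> : b * k * a = k ^ 2 by rewrite mulnAC -/a -Ek mulnn.
  by rewrite mulnAC /a -Eu.
have bm : b %| m.
  by rewrite -(@Gauss_dvdr b u') //; apply: dvdn_trans kN'; apply: dvdn_mulr.
have am : coprime (a ^ 2) m.
  by rewrite coprimeXl // (coprime_dvdl (dvdn_gcdr k u)).
have bu : coprime (b ^ 2) u by rewrite coprimeXl // coprime_sym (coprime_dvdr bm).
have k2 : k ^ 2 = b ^ 2 * a ^ 2 by rewrite Ek expnMn.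
rewrite Ek mulnC; apply: leq_mul; apply: leq_sqrtdiv => //.
  by rewrite -(@Gauss_dvdl _ _ m) //; apply: dvdn_trans kN; rewrite k2 dvdn_mull.
by rewrite -(@Gauss_dvdr (b ^ 2) u) //; apply: dvdn_trans kN; rewrite k2 dvdn_mulr.
Qed.

(** Pulling out the square of gcd(u, m) reduces to coprime factors. The extra gcd is affordable
    because it is later averaged over one of the two factors ([sum_gcd_leq]). *)
Lemma sqrtdiv_mul (u m : nat) : 0 < u -> 0 < m ->
  sqrtdiv (u * m) <= sqrtdiv u * (sqrtdiv m * gcdn u m).
Proof.
move=> u0 m0; pose g := gcdn u m; have g0 : 0 < g by rewrite gcdn_gt0 u0.
have /dvdnP[u' Eu] := dvdn_gcdl u m; have /dvdnP[m' Em] := dvdn_gcdr u m.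
have cop : coprime u' m' by rewrite /coprime -(eqn_pmul2r g0) muln_gcdl /g -Eu -Em mul1n.
have u'0 : 0 < u' by case: (u') Eu u0 => // ->.
have m'0 : 0 < m' by case: (m') Em m0 => // ->.
have -> : u * m = g ^ 2 * (u' * m') by rewrite {1}Eu {2}Em -/g; ring.
apply: (leq_trans (sqrtdiv_sqr_mul g0 _)); first by rewrite muln_gt0 u'0.
rewrite mulnA mulnC -/g leq_mul2r; apply/orP; right.
apply: (leq_trans (sqrtdiv_coprime_mul u'0 m'0 cop)).
by apply: leq_mul; apply: sqrtdiv_dvd => //; apply/dvdnP; exists g; rewrite mulnC.
Qed.

Lemma ndiv_pfactor_mul (p e m : nat) : prime p -> 0 < m -> coprime p m ->
  ndiv (m * p ^ e) <= e.+1 * ndiv m.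
Proof.
move=> pp m0 pm; have pe0 : 0 < p ^ e by rewrite expn_gt0 prime_gt0.
have -> : e.+1 * ndiv m = size [seq p ^ i * d | i <- iota 0 e.+1, d <- divisors m].
  by rewrite size_allpairs size_iota.
apply: uniq_leq_size; first exact: divisors_uniq.
move=> d; rewrite -dvdn_divisors ?muln_gt0 ?m0 // => dn.
have [i ie Ei] : exists2 i, i <= e & gcdn d (p ^ e) = p ^ i.
  by apply/dvdn_pfactor => //; exact: dvdn_gcdr.
have Ed : d = p ^ i * gcdn d m.
  have cop : coprime (p ^ i) (gcdn d m).
    by rewrite coprimeXl // (coprime_dvdr (dvdn_gcdr _ _)).
  apply/eqP; rewrite eqn_dvd; apply/andP; split.
    rewrite -Ei muln_gcdl dvdn_gcd dvdn_mulr //= muln_gcdr dvdn_gcd dvdn_mull //.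
    by rewrite mulnC.
  by rewrite Gauss_dvd // -Ei !dvdn_gcdl.
rewrite Ed; apply: allpairs_f; first by rewrite mem_iota.
by rewrite -dvdn_divisors ?dvdn_gcdr.
Qed.

(** With x the integer part of e / k, e + 1 <= k (x + 1) <= k 2^x; then take k-th powers. *)
Lemma leq_expS_exp2 (k e : nat) : 0 < k -> e.+1 ^ k <= k ^ k * 2 ^ e.
Proof.
move=> k0; pose x := e %/ k.
have h : e.+1 <= k * 2 ^ x.
  apply: (@leq_trans (k * x.+1)); last by rewrite leq_mul2l (ltn_expl x (ltnSn 1)) orbT.
  by rewrite mulnC; apply: ltn_ceil.
apply: (@leq_trans ((k * 2 ^ x) ^ k)); first by rewrite leq_exp2r.
by rewrite expnMn leq_mul2l -expnM leq_exp2l // leq_divM orbT.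
Qed.

(* A prime p >= 2^k contributes (e + 1)^k <= p^e to ndiv n ^ k; each smaller
   prime costs at most a factor k^k. *)
Lemma ndiv_bound (k : nat) : 0 < k ->
  exists K : nat, forall n, 0 < n -> ndiv n ^ k <= K * n.
Proof.
move=> k0; pose A := k ^ k; have A0 : 0 < A by rewrite expn_gt0 k0.
pose P n := \prod_(p < 2 ^ k | p %| n) A.
suff main n : 0 < n -> ndiv n ^ k <= P n * n.
  exists (\prod_(p < 2 ^ k) A) => n n0; apply: (leq_trans (main n n0)).
  rewrite leq_mul2r /P big_mkcond /=; apply/orP; right; apply: leq_prod => p _.
  by case: ifP.
elim/ltn_ind: n => n IH n0; case: (ltnP 1 n) => [n1|n1]; last first.
  have -> : n = 1 by apply/eqP; rewrite eqn_leq n1 n0.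
  by rewrite /ndiv /= exp1n muln1 /P prodn_gt0.
have pp := pdiv_prime n1; have pn := pdiv_dvd n.
move: pp pn; set p := pdiv n => pp pn.
have p1 := prime_gt1 pp.
have [m pm En] := pfactor_coprime pp n0; set e := logn p n in En.
have e0 : 0 < e by rewrite logn_gt0 mem_primes pp n0.
have m0 : 0 < m by case: (m) En n0 => // ->.
have mn : m < n by rewrite [ltnRHS]En -[ltnLHS]muln1 ltn_pmul2l // -(expn0 p) ltn_exp2l.
apply: (@leq_trans ((e.+1 * ndiv m) ^ k)).
  by rewrite leq_exp2r // {1}En ndiv_pfactor_mul.
rewrite expnMn; have := IH m mn m0 => {}IH.
have mdn : m %| n by rewrite En dvdn_mulr.
case: (ltnP p (2 ^ k)) => [ps|pl].
  have PA : A * P m <= P n.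
    rewrite [leqRHS]/P (bigD1 (Ordinal ps)) //= leq_mul2l /P; apply/orP; right.
    rewrite [leqLHS]big_mkcond [leqRHS]big_mkcond /=; apply: leq_prod => i _.
    case: ifP => im; first rewrite (dvdn_trans im mdn) /=.
      case: eqP => //= Ei; move: im; rewrite Ei /= => im.
      by move: pm; rewrite /coprime (gcdn_idPl im) => /eqP p1'; rewrite p1' in p1.
    by case: ifP.
  apply: (leq_trans (leq_mul (leq_expS_exp2 e k0) IH)).
  have -> : P n * n = (P n * p ^ e) * m by rewrite {2}En; ring.
  have -> : k ^ k * 2 ^ e * (P m * m) = (A * P m * 2 ^ e) * m by rewrite -/A; ring.
  by rewrite leq_mul2r leq_mul ?orbT // leq_exp2r.
have PP : P m <= P n.
  rewrite /P [leqLHS]big_mkcond [leqRHS]big_mkcond /=; apply: leq_prod => i _.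
  by case: ifP => im; [rewrite (dvdn_trans im mdn) | case: ifP].
have h : e.+1 ^ k <= p ^ e.
  apply: (@leq_trans ((2 ^ k) ^ e)); last by rewrite leq_exp2r.
  by rewrite -expnM mulnC expnM leq_exp2r // ltn_expl.
apply: (leq_trans (leq_mul h IH)).
have -> : P n * n = p ^ e * (P n * m) by rewrite {2}En; ring.
by rewrite leq_mul2l leq_mul2r PP !orbT.
Qed.

(** * Counting solutions of congruences *)

Lemma leq_card_fibers (T : finType) (I : eqType) (f : T -> I) (s : seq I) (A : {set T}) (B : nat) :
  (forall x, x \in A -> f x \in s) ->
  (forall i, i \in s -> #|[set x in A | f x == i]| <= B) ->
  #|A| <= size s * B.
Proof.
elim: s A => [|i s IH] A h1 h2.
  by rewrite mul0n leqn0 cards_eq0; apply/eqP/setP => x; rewrite inE; apply/negP => /h1.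
rewrite -(cardsID [set x | f x == i] A) /= mulSn leq_add //.
  by apply: (leq_trans _ (h2 i (mem_head _ _))); apply/subset_leq_card/subsetP => x; rewrite !inE.
apply: IH => [x|j js].
  by rewrite !inE => /andP[/negPf n xA]; have := h1 x xA; rewrite inE n.
apply: (leq_trans _ (h2 j _)); last by rewrite inE js orbT.
by apply/subset_leq_card/subsetP => x; rewrite !inE => /andP[/andP[_ ->] ->].
Qed.

Lemma card_mod_leq (X m : nat) (A : {set 'I_X}) : 0 < m ->
  (forall x y, x \in A -> y \in A -> x = y %[mod m]) -> m * #|A| <= X + m.
Proof.
move=> m0 h.
have inj : {in A &, injective (fun x : 'I_X => inord (x %/ m) : 'I_(X %/ m).+1)}.
  move=> x y xA yA /(congr1 val) /=; rewrite !inordK ?ltnS ?leq_div2r ?(ltnW (ltn_ord _)) // => e.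
  by apply: val_inj; rewrite /= (divn_eq x m) (divn_eq y m) e (h x y xA yA).
rewrite -(card_in_imset inj); apply: (@leq_trans (m * (X %/ m).+1)).
  by rewrite leq_mul2l (leq_trans (max_card _)) ?card_ord ?orbT.
by rewrite mulnS mulnC addnC leq_add2r leq_divM.
Qed.

Lemma card_dvd_mod_leq (X m : nat) (A : {set 'I_X}) : 0 < m -> m %| X ->
  (forall x y, x \in A -> y \in A -> x = y %[mod m]) -> m * #|A| <= X.
Proof.
move=> m0 mX h; have [k Ek] := dvdnP mX.
have lt (x : 'I_X) : x %/ m < k by rewrite ltn_divLR // -Ek.
case: k lt Ek => [|k] lt Ek.
  suff -> : A = set0 by rewrite cards0 muln0.
  by apply/setP => x; have := lt x.
have inj : {in A &, injective (fun x : 'I_X => Ordinal (lt x))}.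
  move=> x y xA yA /(congr1 val) /= e.
  by apply: val_inj; rewrite /= (divn_eq x m) (divn_eq y m) e (h x y xA yA).
by rewrite -(card_in_imset inj) [leqRHS]Ek mulnC leq_mul2r (leq_trans (max_card _)) ?card_ord ?orbT.
Qed.

Lemma mem_divisors_gcdr (x c : nat) : 0 < c -> gcdn x c \in divisors c.
Proof. by move=> c0; rewrite -dvdn_divisors // dvdn_gcdr. Qed.

Lemma eqn_mod_dvdz (m x y : nat) : (x = y %[mod m]) <-> (m%:Z %| (x%:Z - y%:Z)%R)%Z.
Proof.
rewrite -eqz_mod_dvd !modz_nat; split => [->//|/eqP[]//].
Qed.

Lemma dvdn_mul_gcd (c a b : nat) : c %| a * b -> c %| gcdn a c * gcdn b c.
Proof.
by move=> h; rewrite muln_gcdl !muln_gcdr !dvdn_gcd h dvdn_mull //= dvdn_mulr // dvdn_mulr.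
Qed.

(* The condition is s^2 = 1 modulo c, with s - 1 written as s + (c - 1) because
   subtraction on nat is truncated. *)
Lemma card_sqrt1 (c : nat) : 0 < c ->
  #|[set s : 'I_c | c %| (s + (c - 1)) * (s + 1)]| <= ndiv c ^ 2 * 2.
Proof.
move=> c0; set A := [set s | _].
have -> : ndiv c ^ 2 = size [seq (g1, g2) | g1 <- divisors c, g2 <- divisors c].
  by rewrite size_allpairs mulnn.
apply: (@leq_card_fibers _ _ (fun s : 'I_c => (gcdn (s + (c - 1)) c, gcdn (s + 1) c))).
  by move=> s _; apply: allpairs_f; apply: mem_divisors_gcdr.
move=> [g1 g2] _; set F := [set x in A | _].
case: (set_0Vmem F) => [->|[s0 s0F]]; first by rewrite cards0.
have mem s : s \in F -> [/\ c %| (s + (c - 1)) * (s + 1), gcdn (s + (c - 1)) c = g1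
    & gcdn (s + 1) c = g2].
  by rewrite !inE => /andP[? /eqP[]].
have [d0 E1 E2] := mem s0 s0F.
have g1c : g1 %| c by rewrite -E1 dvdn_gcdr.
have g2c : g2 %| c by rewrite -E2 dvdn_gcdr.
have g10 : 0 < g1 by apply: dvdn_gt0 g1c.
have g20 : 0 < g2 by apply: dvdn_gt0 g2c.
pose L := lcmn g1 g2; have L0 : 0 < L by rewrite lcmn_gt0 g10.
have Lc : L %| c by rewrite dvdn_lcm g1c.
(* The two factors differ by 2 modulo c. Hence lcm(g1, g2) >= c / 2, and s is fixed modulo this lcm,
   which leaves at most two values of s. *)
have gg2 : gcdn g1 g2 %| 2.
  have h1 : gcdn g1 g2 %| s0 + 1 by rewrite (dvdn_trans (dvdn_gcdr _ _)) // -E2 dvdn_gcdl.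
  have h2 : gcdn g1 g2 %| s0 + (c - 1) by rewrite (dvdn_trans (dvdn_gcdl _ _)) // -E1 dvdn_gcdl.
  have h3 : gcdn g1 g2 %| c by rewrite (dvdn_trans (dvdn_gcdl _ _)).
  have : gcdn g1 g2 %| (s0 + 1) + c by rewrite dvdn_add.
  have -> : s0 + 1 + c = (s0 + (c - 1)) + 2 by clear -c0; lia.
  by rewrite (dvdn_addr _ h2).
have cg : c %| g1 * g2 by rewrite -E1 -E2 dvdn_mul_gcd.
have c2L : c <= 2 * L.
  apply: (@leq_trans (g1 * g2)); first by rewrite dvdn_leq // muln_gt0 g10.
  by rewrite -muln_lcm_gcd mulnC leq_mul2r (dvdn_leq _ gg2) ?orbT.
have : L * #|F| <= c.
  apply: card_dvd_mod_leq => // x y /mem[_ X1 X2] /mem[_ Y1 Y2].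
  apply/eqn_mod_dvdz.
  have d1 : g1 %| x + (c - 1) by rewrite -X1 dvdn_gcdl.
  have d2 : g1 %| y + (c - 1) by rewrite -Y1 dvdn_gcdl.
  have d3 : g2 %| x + 1 by rewrite -X2 dvdn_gcdl.
  have d4 : g2 %| y + 1 by rewrite -Y2 dvdn_gcdl.
  rewrite dvdzE /= dvdn_lcm.
  have sub (g a : nat) : g %| x + a -> g %| y + a -> g %| `|(x%:Z - y%:Z)%R|.
    move=> gx gy; have : (g%:Z %| ((x + a)%N%:Z - (y + a)%N%:Z)%R)%Z.
      by apply: rpredB; rewrite dvdzE.
    by have -> : ((x + a)%N%:Z - (y + a)%N%:Z = x%:Z - y%:Z)%R by clear; lia.
  by rewrite (sub _ (c - 1)) // (sub _ 1).
by move=> h; rewrite -(leq_pmul2l L0) (leq_trans h) // mulnC.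
Qed.

(** The parameters of a quotient of two words are differences of elements of [0, H); freezing one
    element of each difference as [o] leaves a translated box of length H. *)
Definition boxval (H : nat) (o : nat) (x : 'I_H) : int := ((x : nat)%:Z - o%:Z)%R.

Lemma boxval_lt (H o : nat) (x : 'I_H) : o < H -> `|boxval o x| < H.
Proof. by rewrite /boxval => oH; have := ltn_ord x; lia. Qed.

Lemma boxval_inj (H o : nat) : injective (@boxval H o).
Proof. by move=> x y; rewrite /boxval => e; apply: val_inj => /=; lia. Qed.

Lemma card_box_mod (H o m : nat) (A : {set 'I_H}) : 0 < m ->
  (forall x y, x \in A -> y \in A -> (m%:Z %| (boxval o x - boxval o y)%R)%Z) ->
  m * #|A| <= H + m.
Proof.
move=> m0 h; apply: card_mod_leq => // x y xA yA; apply/eqn_mod_dvdz.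
by have := h x y xA yA; rewrite /boxval (_ : (_ - _ = x%:Z - y%:Z)%R) //; lia.
Qed.

Lemma card_box_prod (H a b : nat) (V : int) : V <> 0 ->
  #|[set p : 'I_H * 'I_H | (boxval a p.1 * boxval b p.2 == V)%R]| <= ndiv `|V| * 2.
Proof.
move=> V0; have V0' : 0 < `|V| by lia.
have -> : ndiv `|V| * 2 = size [seq (s, d) | s <- [:: true; false], d <- divisors `|V|].
  by rewrite size_allpairs mulnC.
rewrite -[leqRHS]muln1.
apply: (@leq_card_fibers _ _ (fun p : 'I_H * 'I_H => ((0 <= boxval a p.1)%R, `|boxval a p.1|%N))).
  move=> p; rewrite inE => /eqP e; apply: allpairs_f; first by case: (_ <= _)%R.
  by rewrite -dvdn_divisors // -e abszM dvdn_mulr.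
move=> [s d] _; apply/card_le1_eqP => -[x1 x2] [y1 y2].
rewrite !inE /= => /andP[/eqP e1 /eqP[s1 d1]] /andP[/eqP e2 /eqP[s2 d2]].
have E : boxval a x1 = boxval a y1 by lia.
rewrite (boxval_inj E); congr pair; apply: (@boxval_inj _ b).
have n0 : boxval a y1 <> 0%R by move=> h; apply: V0; rewrite -e2 h mul0r.
by apply: (mulfI (introN eqP n0)); rewrite e2 -E.
Qed.

Lemma card_box_prod0 (H a b : nat) :
  #|[set p : 'I_H * 'I_H | (boxval a p.1 * boxval b p.2 == 0)%R]| <= H * 2.
Proof.
have sub : [set p : 'I_H * 'I_H | (boxval a p.1 * boxval b p.2 == 0)%R] \subset
  [set p : 'I_H * 'I_H | boxval a p.1 == 0%R] :|: [set p : 'I_H * 'I_H | boxval b p.2 == 0%R].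
  by apply/subsetP => p; rewrite !inE mulf_eq0.
apply: (leq_trans (subset_leq_card sub)); apply: (leq_trans (leq_card_setU _ _)).
rewrite muln2 -addnn; apply: leq_add.
  apply: (@leq_trans (size (enum 'I_H) * 1)); last by rewrite size_enum_ord muln1.
  apply: (@leq_card_fibers _ _ snd) => [p _|i _]; first by rewrite mem_enum.
  apply/card_le1_eqP => -[x1 x2] [y1 y2]; rewrite !inE /=.
  by move=> /andP[/eqP e1 /eqP->] /andP[/eqP e2 /eqP->]; congr pair; apply: (@boxval_inj _ a); rewrite e1.
apply: (@leq_trans (size (enum 'I_H) * 1)); last by rewrite size_enum_ord muln1.
apply: (@leq_card_fibers _ _ fst) => [p _|i _]; first by rewrite mem_enum.
apply/card_le1_eqP => -[x1 x2] [y1 y2]; rewrite !inE /=.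
by move=> /andP[/eqP e1 /eqP->] /andP[/eqP e2 /eqP->]; congr pair; apply: (@boxval_inj _ b); rewrite e1.
Qed.

(** The residue class meets the range of products in at most (2 H^2 + m) / m values, each with at
    most 2 D factorizations. The product 0 is excluded since it can have of order H
    factorizations. *)
Lemma card_box_prod_mod (H a b m D : nat) (v0 : int) : 0 < m -> a < H -> b < H ->
  (forall v, 0 < v <= H ^ 2 -> ndiv v <= D) ->
  m * #|[set p : 'I_H * 'I_H | (boxval a p.1 * boxval b p.2 != 0)%R
         && (m%:Z %| (boxval a p.1 * boxval b p.2 - v0)%R)%Z]| <= (H ^ 2 * 2 + m) * (D * 2).
Proof.
move=> m0 aH bH hD; set A := [set p | _].
pose X := (H ^ 2 * 2)%N.
have lt (p : 'I_H * 'I_H) : `|(boxval a p.1 * boxval b p.2)%R| < H ^ 2.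
  by rewrite abszM -mulnn ltn_mul // boxval_lt.
have lt2 (p : 'I_H * 'I_H) : absz (boxval a p.1 * boxval b p.2 + (H ^ 2)%N%:Z)%R < X.
  by have := lt p; rewrite /X; set u := (_ * _)%R; set w := H ^ 2; lia.
pose g (p : 'I_H * 'I_H) := Ordinal (lt2 p).
have gE p : ((g p : nat)%:Z = boxval a p.1 * boxval b p.2 + (H ^ 2)%N%:Z)%R.
  by rewrite /=; have := lt p; set u := (_ * _)%R; set w := H ^ 2; lia.
pose B := g @: A.
have cB : m * #|B| <= X + m.
  apply: card_mod_leq => // _ _ /imsetP[p pA ->] /imsetP[p' pA' ->].
  apply/eqn_mod_dvdz; rewrite !gE; move: pA pA'; rewrite !inE => /andP[_ h1] /andP[_ h2].
  have := rpredB h1 h2; rewrite (_ : _ - _ - _ = boxval a p.1 * boxval b p.2 + (H ^ 2)%N%:Z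
     - (boxval a p'.1 * boxval b p'.2 + (H ^ 2)%N%:Z))%R //; ring.
have cA : #|A| <= #|B| * (D * 2).
  rewrite cardE; rewrite -cardE [#|B|]cardE.
  apply: (@leq_card_fibers _ _ g) => [p pA|i _]; first by rewrite mem_enum imset_f.
  set F := [set x in A | _].
  case: (set_0Vmem F) => [->|[p0]]; first by rewrite cards0.
  rewrite !inE => /andP[/andP[n0 _] /eqP E0].
  apply: (@leq_trans (ndiv `|(boxval a p0.1 * boxval b p0.2)%R| * 2)).
    apply: (leq_trans _ (@card_box_prod H a b _ _)); last by apply/eqP.
    apply/subset_leq_card/subsetP => p; rewrite !inE => /andP[_ /eqP E].
    have := gE p; rewrite E -E0 gE => h; apply/eqP.
    by apply: (addIr (Posz (H ^ 2))); rewrite h.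
  rewrite leq_mul2r hD //= (ltnW (lt _)) andbT; move: n0; set u := (_ * _)%R; lia.
apply: (leq_trans (leq_mul (leqnn m) cA)); rewrite mulnA.
by rewrite leq_mul2r cB orbT.
Qed.

Lemma leq_ndiv_dvd (m n : nat) : 0 < n -> m %| n -> ndiv m <= ndiv n.
Proof.
move=> n0 mn; apply: uniq_leq_size; first exact: divisors_uniq.
move=> d; rewrite -!dvdn_divisors ?(dvdn_gt0 n0 mn) // => dm; exact: dvdn_trans dm mn.
Qed.

(** Write n = t L with L the lcm. As g1 g2 divides L^2, so does n; hence t | L and t^2 | n. *)
Lemma leq_lcm_sqrtdiv (n g1 g2 : nat) : 0 < n -> g1 %| n -> g2 %| n -> n %| g1 * g2 ->
  n <= lcmn g1 g2 * sqrtdiv n.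
Proof.
move=> n0 g1n g2n ng.
have Ln : lcmn g1 g2 %| n by rewrite dvdn_lcm g1n.
have L0 : 0 < lcmn g1 g2 by apply: dvdn_gt0 Ln.
have [t Et] := dvdnP Ln; have t0 : 0 < t by case: (t) Et n0 => // ->.
have nL : n %| lcmn g1 g2 * lcmn g1 g2.
  by apply: dvdn_trans ng _; rewrite -muln_lcm_gcd dvdn_mul // (dvdn_trans (dvdn_gcdl _ _)) ?dvdn_lcml.
rewrite {1}Et mulnC leq_mul2l leq_sqrtdiv ?orbT //.
by rewrite {1}Et -mulnn dvdn_mul // -(@dvdn_pmul2r (lcmn g1 g2)) // -Et.
Qed.

(** After division by the common factor k, the solutions are sorted by the gcds g1 and g2 of the two
    factors with n = c / k, where n | g1 g2. The second variable is a multiple of g1, and it then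
    fixes the first one modulo e = g2 / gcd(B', g2). Since g1 e is at least lcm(g1, g2),
    [leq_lcm_sqrtdiv] concludes. *)
Lemma card_quadratic (c B C : nat) : 0 < c ->
  #|[set p : 'I_c * 'I_c | c %| p.2 * (p.1 * B + p.2 * C)]|
   <= ndiv c ^ 2 * (c * (gcdn (gcdn B C) c * sqrtdiv (c %/ gcdn (gcdn B C) c))).
Proof.
move=> c0; set k := gcdn (gcdn B C) c; set n := c %/ k.
have k0 : 0 < k by rewrite gcdn_gt0 c0 orbT.
have kc : k %| c by apply: dvdn_gcdr.
have Ec : c = n * k by rewrite divnK.
have n0 : 0 < n by case: (n) Ec c0 => // ->.
have [B' EB] : exists B', B = B' * k.
  by apply/dvdnP; apply: dvdn_trans (dvdn_gcdl _ _) (dvdn_gcdl _ _).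
have [C' EC] : exists C', C = C' * k.
  by apply/dvdnP; apply: dvdn_trans (dvdn_gcdl _ _) (dvdn_gcdr _ _).
have cop : gcdn (gcdn B' C') n = 1.
  by apply/eqP; rewrite -(eqn_pmul2r k0) !muln_gcdl -EB -EC -Ec mul1n.
set A := [set p | _].
have memA p : p \in A -> n %| p.2 * (p.1 * B' + p.2 * C').
  rewrite inE -(@dvdn_pmul2r k n) // -Ec {1}EB {1}EC.
  by have -> : p.2 * (p.1 * (B' * k) + p.2 * (C' * k)) = p.2 * (p.1 * B' + p.2 * C') * k by ring.
apply: (@leq_trans (ndiv n ^ 2 * (c * (k * sqrtdiv n)))); last first.
  by rewrite leq_mul2r leq_exp2r // leq_ndiv_dvd ?orbT // Ec dvdn_mulr.
have -> : ndiv n ^ 2 = size [seq (g1, g2) | g1 <- divisors n, g2 <- divisors n].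
  by rewrite size_allpairs mulnn.
apply: (@leq_card_fibers _ _ (fun p : 'I_c * 'I_c => (gcdn p.2 n, gcdn (p.1 * B' + p.2 * C') n))).
  by move=> p _; apply: allpairs_f; apply: mem_divisors_gcdr.
move=> [g1 g2] _; set F := [set x in A | _].
case: (set_0Vmem F) => [->|[p0 p0F]]; first by rewrite cards0.
have mem p : p \in F -> [/\ n %| p.2 * (p.1 * B' + p.2 * C'), gcdn p.2 n = g1
    & gcdn (p.1 * B' + p.2 * C') n = g2].
  by rewrite inE => /andP[/memA ? /eqP[]].
have [d0 E1 E2] := mem p0 p0F.
have g1n : g1 %| n by rewrite -E1 dvdn_gcdr.
have g2n : g2 %| n by rewrite -E2 dvdn_gcdr.
have g10 : 0 < g1 by apply: dvdn_gt0 g1n.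
have g20 : 0 < g2 by apply: dvdn_gt0 g2n.
have ng : n %| g1 * g2 by rewrite -E1 -E2 dvdn_mul_gcd.
pose b := gcdn B' g2; have b0 : 0 < b by rewrite gcdn_gt0 g20 orbT.
have [e Ee] := dvdnP (dvdn_gcdr B' g2); have [B'' EB''] := dvdnP (dvdn_gcdl B' g2).
have e0 : 0 < e by case: (e) Ee g20 => // ->.
have ceB : coprime e B''.
  by rewrite coprime_sym /coprime -(eqn_pmul2r b0) muln_gcdl /b -Ee -EB'' mul1n.
(* Here b divides both B' and the second factor, hence p0.2 C'; it is coprime to C' because B', C'
   and n have no common factor. So b | gcd(g1, g2), which gives lcm(g1, g2) <= g1 e. *)
have bg1 : b %| g1.
  have bn : b %| n by apply: dvdn_trans (dvdn_gcdr _ _) g2n.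
  have bB : b %| B' := dvdn_gcdl _ _.
  have bt : b %| p0.2 * C'.
    rewrite -(@dvdn_addr (p0.1 * B')) ?dvdn_mull //.
    by apply: dvdn_trans (dvdn_gcdr _ _) _; rewrite -E2 dvdn_gcdl.
  have bC : coprime b C'.
    by rewrite /coprime -dvdn1 -cop !dvdn_gcd dvdn_gcdr (dvdn_trans (dvdn_gcdl _ _) bB) (dvdn_trans (dvdn_gcdl _ _) bn).
  by rewrite -E1 dvdn_gcd bn andbT -(Gauss_dvdl _ bC).
have cL : lcmn g1 g2 * #|F| <= c * c.
  have Lg : lcmn g1 g2 <= g1 * e.
    rewrite -(leq_pmul2r b0) -mulnA -[e * b]Ee -(muln_lcm_gcd g1 g2) leq_mul2l dvdn_leq ?orbT //.
      by rewrite gcdn_gt0 g10.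
    by rewrite dvdn_gcd dvdn_gcdr bg1.
  apply: (leq_trans (leq_mul Lg (leqnn _))).
  pose T := [set t : 'I_c | g1 %| t].
  have cT : g1 * #|T| <= c.
    apply: card_dvd_mod_leq => //; first by rewrite Ec dvdn_mulr.
    by move=> x y; rewrite !inE /dvdn => /eqP-> /eqP->.
  have ec : e %| c by rewrite Ec dvdn_mulr // (dvdn_trans _ g2n) // Ee dvdn_mulr.
  have cF : #|F| <= #|T| * (c %/ e).
    rewrite [#|T|]cardE; apply: (@leq_card_fibers _ _ snd) => [p /mem[_ Ep _]|t _].
      by rewrite mem_enum inE -Ep dvdn_gcdl.
    set G := [set x in F | _].
    have -> : #|G| = #|fst @: G|.
      rewrite card_in_imset // => -[x1 x2] [y1 y2].
      by rewrite ![_ \in G]inE /= => /andP[_ /eqP->] /andP[_ /eqP->] ->.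
    rewrite leq_divRL // mulnC; apply: card_dvd_mod_leq => // _ _ /imsetP[x xG ->] /imsetP[y yG ->].
    move: xG yG; rewrite ![_ \in G]inE => /andP[/mem[_ _ X] /eqP Xt] /andP[/mem[_ _ Y] /eqP Yt].
    apply/eqn_mod_dvdz.
    have dX : (g2%:Z %| (x.1 * B' + x.2 * C')%N%:Z)%Z by rewrite dvdzE /= -X dvdn_gcdl.
    have dY : (g2%:Z %| (y.1 * B' + y.2 * C')%N%:Z)%Z by rewrite dvdzE /= -Y dvdn_gcdl.
    have := rpredB dX dY; rewrite Xt Yt.
    have -> : ((x.1 * B' + t * C')%N%:Z - (y.1 * B' + t * C')%N%:Z =
      (((x.1 : nat)%:Z - (y.1 : nat)%:Z) * B''%:Z) * b%:Z)%R.
      by rewrite {1 2}EB'' -/b !PoszD !PoszM; ring.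
    rewrite {1}Ee -/b PoszM dvdz_mul2r; last by rewrite eqz_nat -lt0n.
    by rewrite Gauss_dvdzl.
  apply: (leq_trans (leq_mul (leqnn _) cF)).
  have -> : g1 * e * (#|T| * (c %/ e)) = (g1 * #|T|) * (c %/ e * e) by ring.
  by rewrite divnK // leq_mul2r cT orbT.
have nL := leq_lcm_sqrtdiv n0 g1n g2n ng.
rewrite -(leq_pmul2l n0); apply: (leq_trans (leq_mul nL (leqnn _))).
have -> : lcmn g1 g2 * sqrtdiv n * #|F| = (lcmn g1 g2 * #|F|) * sqrtdiv n by ring.
have -> : n * (c * (k * sqrtdiv n)) = c * (n * k) * sqrtdiv n by ring.
by rewrite -Ec leq_mul2r cL orbT.
Qed.

(** Fibre bounds of the form (H + r) / r are kept multiplied by their denominator [w], so that the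
    counts chain in nat without rounding. *)
Lemma card_fibers_weighted (T I : finType) (f : T -> I) (A : {set T}) (B : {set I}) (w N : nat) :
  (forall x, x \in A -> f x \in B) ->
  (forall i, i \in B -> w * #|[set x in A | f x == i]| <= N) -> w * #|A| <= #|B| * N.
Proof.
case: w => [|w]; first by rewrite !mul0n.
move=> h1 h2; rewrite mulnC -leq_divRL //.
apply: (@leq_trans (#|B| * (N %/ w.+1))).
  rewrite [#|B|]cardE; apply: (@leq_card_fibers _ _ f) => x; rewrite mem_enum; first exact: h1.
  by move=> xB; rewrite leq_divRL // mulnC h2.
by rewrite leq_divRL // -mulnA leq_mul2l leq_divM orbT.
Qed.

Lemma dvdz_cancel_coprime (m a b x : int) : coprimez a b ->
  (m %| (x * a)%R)%Z -> (m %| (x * b)%R)%Z -> (m %| x)%Z.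
Proof.
move=> cop ha hb; rewrite -(mulr1 x).
have [[u v] /= <-] := coprimezP _ _ cop.
by rewrite mulrDr mulrCA [(x * (v * b))%R]mulrCA; apply: rpredD; apply: dvdz_mull.
Qed.

(* Entry by entry, the congruence modulo r
     lower b1 * upper a2 * lower b2 = l * upper (- a1) * lower (- b3) * upper (- a3)
   where each unknown is a difference x - o with x < H and o fixed.  The pair
   (a1, b3) is chosen first; entry (1,1) then determines a2 b2 modulo r, entry
   (2,1) determines a3 up to the gcd of 1 + a1 b3 and r, and the remaining
   entries determine b1. *)
Section WordCount.
Variables (H r D : nat) (l : int) (oa1 ob1 oa2 ob2 oa3 ob3 : nat).
Hypotheses (H0 : 0 < H) (r0 : 0 < r) (lr : coprimez l r%:Z).
Hypotheses (ha1 : oa1 < H) (hb3 : ob3 < H) (ha2 : oa2 < H) (hb2 : ob2 < H).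
Hypothesis (hD : forall v, 0 < v <= H ^ 2 -> ndiv v <= D).
Hypothesis (hDr : ndiv r <= D).

Let box := ('I_H * 'I_H)%type.
Let v1 (p : box) := (boxval oa1 p.1 * boxval ob3 p.2)%R.
Let v2 (p : box) := (boxval oa2 p.1 * boxval ob2 p.2)%R.

Definition word_eq11 (p p' : box) := (r%:Z %| (1 + v2 p' - l * (1 + v1 p))%R)%Z.

Definition word_eq21 (p p' : box) (x : 'I_H) :=
  (r%:Z %| (boxval oa2 p'.1 + l * (boxval oa1 p.1 + boxval oa3 x * (1 + v1 p)))%R)%Z.

Definition word_eq12 (p p' : box) (y : 'I_H) :=
  (r%:Z %| (boxval ob2 p'.2 + boxval ob1 y * (1 + v2 p') + l * boxval ob3 p.2)%R)%Z.

Definition word_eq22 (p p' : box) (x y : 'I_H) :=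
  (r%:Z %| (1 + boxval ob1 y * boxval oa2 p'.1 - l * (1 + boxval oa3 x * boxval ob3 p.2))%R)%Z.

Definition word_sol := [set t : (box * box) * ('I_H * 'I_H) |
  [&& word_eq11 t.1.1 t.1.2, word_eq21 t.1.1 t.1.2 t.2.1, word_eq12 t.1.1 t.1.2 t.2.2
    & word_eq22 t.1.1 t.1.2 t.2.1 t.2.2]].

Let S' := [set t : (box * box) * 'I_H | word_eq11 t.1.1 t.1.2 && word_eq21 t.1.1 t.1.2 t.2].
Let P (p : box) : nat := gcdn `|(1 + v1 p)%R| r.
Let Q g := [set t : box * box | word_eq11 t.1 t.2 && (P t.1 == g)].

(** Two admissible b1 differ by a residue that kills both 1 + a2 b2 and a2 modulo r; these are
    coprime, so the difference vanishes modulo r. *)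
Let step_b1 : r * #|word_sol| <= #|S'| * (H + r).
Proof.
apply: (@card_fibers_weighted _ _ (fun t : (box * box) * ('I_H * 'I_H) => (t.1, t.2.1))).
  by move=> t; rewrite !inE /= => /and4P[-> ->].
move=> [[p p'] x] _; set F := [set t in _ | _].
have -> : #|F| = #|(fun t : (box * box) * ('I_H * 'I_H) => t.2.2) @: F|.
  rewrite card_in_imset // => -[[p1 q1] [x1 y1]] [[p2 q2] [x2 y2]] /=.
  by rewrite ![_ \in F]inE /= => /andP[_ /eqP[-> -> ->]] /andP[_ /eqP[-> -> ->]] ->.
apply: (@card_box_mod H ob1) => // _ _ /imsetP[[[p1 q1] [x1 y1]] t1F ->] /imsetP[[[p2 q2] [x2 y2]] t2F ->] /=.
move: t1F t2F; rewrite !inE /=.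
move=> /andP[/and4P[_ _ c3 c4] /eqP[E1 E2 E3]].
move=> /andP[/and4P[_ _ c3' c4'] /eqP[E1' E2' E3']].
rewrite {}E1 {}E2 {}E3 {p1 q1 x1} in c3 c4; rewrite {}E1' {}E2' {}E3' {p2 q2 x2} in c3' c4'.
apply: (@dvdz_cancel_coprime _ (1 + v2 p')%R (boxval oa2 p'.1)).
- apply/coprimezP; exists (1, - boxval ob2 p'.2)%R => /=; rewrite /v2; ring.
- by have := rpredB c3 c3'; congr (_ %| _)%Z; ring.
- by have := rpredB c4 c4'; congr (_ %| _)%Z; ring.
Qed.

(** Entry (2,1) fixes a3 (1 + a1 b3) modulo r, hence a3 modulo r / g when gcd(1 + a1 b3, r) = g. *)
Let step_a3 g : g %| r -> r * #|[set t in S' | P t.1.1 == g]| <= #|Q g| * (g * H + r).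
Proof.
move=> gr; apply: (@card_fibers_weighted _ _ fst).
  by move=> t; rewrite !inE => /andP[/andP[-> _] ->].
move=> [p p']; rewrite inE /= => /andP[_ /eqP Pg]; set F := [set t in _ | _].
have g0 : 0 < g by apply: dvdn_gt0 gr.
have [k Ek] := dvdnP gr; have k0 : 0 < k by case: (k) Ek r0 => // ->.
have -> : #|F| = #|snd @: F|.
  rewrite card_in_imset // => -[[p1 q1] x1] [[p2 q2] x2].
  by rewrite ![_ \in F]inE /= => /andP[_ /eqP[-> ->]] /andP[_ /eqP[-> ->]] ->.
have : k * #|snd @: F| <= H + k.
  apply: (@card_box_mod H oa3) => // _ _ /imsetP[[[p1 q1] x1] t1F ->] /imsetP[[[p2 q2] x2] t2F ->] /=.
  move: t1F t2F; rewrite !inE /=.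
  move=> /andP[/andP[/andP[_ c2] _] /eqP[E1 E2]] /andP[/andP[/andP[_ c2'] _] /eqP[E1' E2']].
  rewrite {}E1 {}E2 {p1 q1} in c2; rewrite {}E1' {}E2' {p2 q2} in c2'.
  have : (r%:Z %| (((boxval oa3 x1 - boxval oa3 x2) * (1 + v1 p)) * l)%R)%Z.
    by have := rpredB c2 c2'; congr (_ %| _)%Z; ring.
  rewrite Gauss_dvdzl 1?coprimez_sym //.
  have [w Ew] : exists w : int, (1 + v1 p = w * g%:Z)%R.
    by apply/dvdzP; rewrite dvdzE /= -Pg dvdn_gcdl.
  rewrite Ew mulrA {1}Ek PoszM dvdz_mul2r ?eqz_nat -?lt0n // Gauss_dvdzl //.
  rewrite coprimezE coprime_sym /coprime -(eqn_pmul2r g0) muln_gcdl mul1n -Ek.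
  by rewrite -[X in gcdn (_ * X)]/(absz (Posz g)) -abszM -Ew; apply/eqP.
move=> h; rewrite Ek; have -> : k * g * #|snd @: F| = g * (k * #|snd @: F|) by ring.
have -> : g * H + k * g = g * (H + k) by ring.
by rewrite leq_mul2l h orbT.
Qed.

Let gcd_word_eq11 p p' : word_eq11 p p' -> gcdn `|(1 + v2 p')%R| r = P p.
Proof.
move=> c1; apply/eqP.
have cop g : g %| r -> (g%:Z %| (1 + v2 p')%R)%Z = (g%:Z %| (1 + v1 p)%R)%Z.
  move=> gr; have gl : coprimez g%:Z l.
    by rewrite coprimez_sym; apply: coprimez_dvdr lr; rewrite ?dvdzE.
  have h : (g%:Z %| (1 + v2 p' - l * (1 + v1 p))%R)%Z by apply: dvdz_trans c1; rewrite dvdzE.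
  rewrite -[RHS](Gauss_dvdzr _ gl); apply/idP/idP => hx.
    by have := rpredB hx h; congr (_ %| _)%Z; ring.
  by have := rpredD hx h; congr (_ %| _)%Z; ring.
rewrite eqn_dvd !dvdn_gcd !dvdn_gcdr !andbT.
have := cop _ (dvdn_gcdr `|(1 + v2 p')%R| r); have := cop _ (dvdn_gcdr `|(1 + v1 p)%R| r).
by rewrite !dvdzE /= !dvdn_gcdl => -> ; move=> <-.
Qed.

Let card_p' p : r * #|[set p' | word_eq11 p p' && (v2 p' != 0)%R]| <= (H ^ 2 * 2 + r) * (D * 2).
Proof.
apply: (leq_trans _ (@card_box_prod_mod H oa2 ob2 r D (l * (1 + v1 p) - 1)%R r0 ha2 hb2 hD)).
rewrite leq_mul2l; apply/orP; right; apply/subset_leq_card/subsetP => p'.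
rewrite !inE => /andP[c1 ->] /=; move: c1; rewrite /word_eq11.
by congr (_ %| _)%Z; rewrite /v2; ring.
Qed.

(** The factor g lost in [step_a3] is regained here: 1 + v1 = 0 modulo g puts v1 in one residue
    class modulo g. For g > 1 it also excludes v1 = 0, and likewise v2 = 0, so the divisor bound
    applies to both products. *)
Let card_Q g : g %| r -> 1 < g ->
  g * r * #|Q g| <= (H ^ 2 * 2 + g) * (H ^ 2 * 2 + r) * (D ^ 2 * 4).
Proof.
move=> gr g1; have g0 : 0 < g by apply: ltnW.
have nz (v : int) : (g%:Z %| (1 + v)%R)%Z -> (v != 0)%R.
  move=> h; apply/eqP => v0; move: h; rewrite v0 addr0 dvdzE /= dvdn1 => /eqP h.
  by rewrite h in g1.
pose B := [set p : box | (v1 p != 0)%R && (g%:Z %| (v1 p - (-1))%R)%Z].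
have cB : g * #|B| <= (H ^ 2 * 2 + g) * (D * 2) by apply: card_box_prod_mod.
have cQ : r * #|Q g| <= #|B| * ((H ^ 2 * 2 + r) * (D * 2)).
  apply: (@card_fibers_weighted _ _ fst) => [[p p']|p _].
    rewrite !inE /= => /andP[_ /eqP Pg].
    have gp : (g%:Z %| (1 + v1 p)%R)%Z by rewrite dvdzE /= -Pg dvdn_gcdl.
    by rewrite (nz _ gp) opprK addrC.
  apply: (leq_trans _ (card_p' p)); rewrite leq_mul2l; apply/orP; right.
  set F := [set t in _ | _].
  have -> : #|F| = #|snd @: F|.
    rewrite card_in_imset // => -[p1 q1] [p2 q2].
    by rewrite ![_ \in F]inE /= => /andP[_ /eqP->] /andP[_ /eqP->] ->.
  apply/subset_leq_card/subsetP => _ /imsetP[[p1 q1] tF ->].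
  move: tF; rewrite !inE /= => /andP[/andP[c1 /eqP Pg] /eqP E]; rewrite {}E {p1} in c1 Pg.
  by rewrite c1 nz // dvdzE /= -Pg -(gcd_word_eq11 c1) dvdn_gcdl.
rewrite -mulnA; apply: (leq_trans (leq_mul (leqnn g) cQ)).
rewrite mulnA; apply: (leq_trans (leq_mul cB (leqnn _))).
by apply: eq_leq; ring.
Qed.

(** For g = 1 the products may vanish. If v2 = 0 there are at most 2 H choices of p', but then l (1
    + v1) = 1 modulo r restricts p as well. *)
Let card_Q1 : r * #|Q 1| <= (H ^ 2 * 2 + r) * (10 * D * H ^ 2).
Proof.
have D0 : 0 < D by apply: leq_trans hDr; apply: ndiv_gt0.
pose Qn := [set t : box * box | word_eq11 t.1 t.2 && (v2 t.2 != 0)%R].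
pose Qz := [set t : box * box | word_eq11 t.1 t.2 && (v2 t.2 == 0)%R].
have sub : #|Q 1| <= #|Qn| + #|Qz|.
  apply: (leq_trans _ (leq_card_setU _ _)); apply/subset_leq_card/subsetP => t.
  by rewrite !inE => /andP[-> _] /=; rewrite orNb.
have cn : r * #|Qn| <= H ^ 2 * ((H ^ 2 * 2 + r) * (D * 2)).
  have EH : #|[set: box]| = H ^ 2 by rewrite cardsT card_prod card_ord mulnn.
  rewrite -{1}EH.
  apply: (@card_fibers_weighted _ _ fst) => [t|p _]; first by rewrite inE.
  apply: (leq_trans _ (card_p' p)); rewrite leq_mul2l; apply/orP; right.
  set F := [set t in _ | _].
  have -> : #|F| = #|snd @: F|.
    rewrite card_in_imset // => -[p1 q1] [p2 q2].
    by rewrite ![_ \in F]inE /= => /andP[_ /eqP->] /andP[_ /eqP->] ->.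
  apply/subset_leq_card/subsetP => _ /imsetP[[p1 q1] tF ->].
  by move: tF; rewrite !inE /= => /andP[/andP[c1 n2] /eqP <-]; rewrite c1.
pose Bz := [set p : box | (r%:Z %| (1 - l * (1 + v1 p))%R)%Z].
pose Bn := [set p : box | (v1 p != 0)%R && (r%:Z %| (1 - l * (1 + v1 p))%R)%Z].
have cBn : r * #|Bn| <= (H ^ 2 * 2 + r) * (D * 2).
  (* A base point names the residue class: l is a unit modulo r, so the congruence fixes v1 modulo
     r. *)
  case: (set_0Vmem Bn) => [->|[p0]]; first by rewrite cards0 muln0.
  rewrite inE => /andP[_ h0].
  apply: (leq_trans _ (@card_box_prod_mod H oa1 ob3 r D (v1 p0) r0 ha1 hb3 hD)).
  rewrite leq_mul2l; apply/orP; right; apply/subset_leq_card/subsetP => p.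
  rewrite !inE => /andP[-> h] /=; rewrite -(Gauss_dvdzr _ (n := l)); last by rewrite coprimez_sym.
  by have := rpredB h0 h; congr (_ %| _)%Z; rewrite /v1; ring.
have cBz : r * #|Bz| <= (H ^ 2 * 2 + r) * (D * 2) + r * (H * 2).
  apply: (@leq_trans (r * (#|Bn| + H * 2))); last by rewrite mulnDr leq_add2r.
  rewrite leq_mul2l; apply/orP; right.
  apply: (leq_trans _ (leq_add (leqnn _) (@card_box_prod0 H oa1 ob3))).
  apply: (leq_trans _ (leq_card_setU _ _)); apply/subset_leq_card/subsetP => p.
  by rewrite !inE => ->; rewrite andbT orNb.
have cz : #|Qz| <= #|Bz| * (H * 2).
  rewrite -[#|Qz|]mul1n; apply: (@card_fibers_weighted _ _ fst) => [[p p']|p _].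
    by rewrite !inE /word_eq11 /= => /andP[c1 /eqP E]; move: c1; rewrite E addr0.
  rewrite mul1n; apply: (leq_trans _ (@card_box_prod0 H oa2 ob2)).
  set F := [set t in _ | _].
  have -> : #|F| = #|snd @: F|.
    rewrite card_in_imset // => -[p1 q1] [p2 q2].
    by rewrite ![_ \in F]inE /= => /andP[_ /eqP->] /andP[_ /eqP->] ->.
  apply/subset_leq_card/subsetP => _ /imsetP[[p1 q1] tF ->].
  by move: tF; rewrite !inE /= => /andP[/andP[_ n2] _].
apply: (leq_trans (leq_mul (leqnn r) sub)); rewrite mulnDr.
apply: (leq_trans (leq_add cn (leq_mul (leqnn r) cz))).
rewrite [r * (_ * _)]mulnA; apply: (leq_trans (leq_add (leqnn _) (leq_mul cBz (leqnn _)))).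
clear -D0 H0 r0; nia.
Qed.

Lemma word_count : r ^ 3 * #|word_sol| <= 16 * D ^ 3 * H ^ 2 * (H + r) ^ 2 * (H ^ 2 * 2 + r).
Proof.
have D0 : 0 < D by apply: leq_trans hDr; apply: ndiv_gt0.
have step g : g %| r -> r ^ 2 * #|[set t in S' | P t.1.1 == g]|
    <= 16 * D ^ 2 * H ^ 2 * (H + r) * (H ^ 2 * 2 + r).
  move=> gr; have g0 : 0 < g by apply: dvdn_gt0 gr.
  have gler : g <= r by apply: dvdn_leq.
  have h := step_a3 gr.
  have [g1|g1] := leqP g 1.
    have E1 : g = 1 by apply/eqP; rewrite eqn_leq g1 g0.
    rewrite E1 in h *; rewrite mul1n in h.
    rewrite -mulnn -mulnA; apply: (leq_trans (leq_mul (leqnn r) h)).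
    rewrite mulnA; apply: (leq_trans (leq_mul card_Q1 (leqnn _))).
    have : 10 * D <= 16 * D ^ 2 by clear -D0; nia.
    move=> hD2; have -> : (H ^ 2 * 2 + r) * (10 * D * H ^ 2) * (H + r)
      = 10 * D * (H ^ 2 * (H + r) * (H ^ 2 * 2 + r)) by ring.
    have -> : 16 * D ^ 2 * H ^ 2 * (H + r) * (H ^ 2 * 2 + r)
      = 16 * D ^ 2 * (H ^ 2 * (H + r) * (H ^ 2 * 2 + r)) by ring.
    by rewrite leq_mul.
  rewrite -(leq_pmul2l g0); have hQ := card_Q gr g1.
  have -> : g * (r ^ 2 * #|[set t in S' | P t.1.1 == g]|)
    = g * r * (r * #|[set t in S' | P t.1.1 == g]|) by ring.
  apply: (leq_trans (leq_mul (leqnn _) h)).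
  rewrite mulnA; apply: (leq_trans (leq_mul hQ (leqnn _))).
  (* The g on the right is what [card_Q] gained, so every g | r gives the same bound as g = 1, up to
     constants. *)
  have hg : (H ^ 2 * 2 + g) * (g * H + r) <= g * (4 * H ^ 2 * (H + r)).
    have a1 : H <= H ^ 2 by rewrite -mulnn leq_pmulr.
    have a2 : 1 <= H ^ 2 by rewrite expn_gt0 H0.
    have b1 : g * g * H <= g * r * H ^ 2 by rewrite leq_mul // leq_mul2l gler orbT.
    have b2 : 1 * (r * H ^ 2) <= g * (r * H ^ 2) by rewrite leq_mul2r g0 orbT.
    have b3 : g * r * 1 <= g * r * H ^ 2 by rewrite leq_mul2l a2 orbT.
    move: b1 b2 b3; rewrite -!mulnn; clear; lia.
  have -> : (H ^ 2 * 2 + g) * (H ^ 2 * 2 + r) * (D ^ 2 * 4) * (g * H + r)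
     = (H ^ 2 * 2 + g) * (g * H + r) * ((H ^ 2 * 2 + r) * (D ^ 2 * 4)) by ring.
  by apply: (leq_trans (leq_mul hg (leqnn _))); apply: eq_leq; ring.
have cS' : r ^ 2 * #|S'| <= D * (16 * D ^ 2 * H ^ 2 * (H + r) * (H ^ 2 * 2 + r)).
  set N := 16 * D ^ 2 * H ^ 2 * (H + r) * (H ^ 2 * 2 + r) in step *.
  have r20 : 0 < r ^ 2 by rewrite expn_gt0 r0.
  have : #|S'| <= ndiv r * (N %/ r ^ 2).
    apply: (@leq_card_fibers _ _ (fun t : (box * box) * 'I_H => P t.1.1)).
      by move=> t _; apply: mem_divisors_gcdr.
    by move=> g; rewrite -dvdn_divisors // => /step h; rewrite leq_divRL // mulnC.
  move=> /(leq_mul (leqnn (r ^ 2))) h; apply: (leq_trans h).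
  by rewrite mulnCA leq_mul // mulnC leq_divM.
rewrite expnSr -mulnA; apply: (leq_trans (leq_mul (leqnn _) step_b1)).
rewrite mulnA; apply: (leq_trans (leq_mul cS' (leqnn _))).
by apply: eq_leq; ring.
Qed.

End WordCount.

Local Open Scope ring_scope.

(** * Amplification on SL_2(Z/c) *)

Lemma big_pair (T : Type) (idx : T) (op : Monoid.com_law idx) (I J : finType) (F : I * J -> T) :
  \big[op/idx]_p F p = \big[op/idx]_i \big[op/idx]_j F (i, j).
Proof. by rewrite pair_bigA; apply: eq_bigr => -[]. Qed.

(** Lagrange's identity. The generality serves sums with values in the closed field as well as real
    ones. *)
Lemma sqr_sum_leq (C : numDomainType) (I : Type) (s : seq I) (P : pred I) (x y : I -> C) :
  (forall i, 0 <= x i) -> (forall i, 0 <= y i) ->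
  (\sum_(i <- s | P i) x i * y i) ^+ 2 <= (\sum_(i <- s | P i) x i ^+ 2) * (\sum_(i <- s | P i) y i ^+ 2).
Proof.
move=> x0 y0; rewrite -subr_ge0 -(pmulrn_lge0 _ (n := 2)) //.
have -> : ((\sum_(i <- s | P i) x i ^+ 2) * (\sum_(i <- s | P i) y i ^+ 2)
   - (\sum_(i <- s | P i) x i * y i) ^+ 2) *+ 2
   = \sum_(i <- s | P i) \sum_(j <- s | P j) (x i * y j - x j * y i) ^+ 2.
  have -> : \sum_(i <- s | P i) \sum_(j <- s | P j) (x i * y j - x j * y i) ^+ 2
    = \sum_(i <- s | P i) \sum_(j <- s | P j) x i ^+ 2 * y j ^+ 2
    + \sum_(i <- s | P i) \sum_(j <- s | P j) y i ^+ 2 * x j ^+ 2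
    - (\sum_(i <- s | P i) \sum_(j <- s | P j) (x i * y i) * (x j * y j)) *+ 2.
    rewrite -sumrMnl -big_split -sumrB /=; apply: eq_bigr => i _.
    rewrite -sumrMnl -big_split -sumrB /=; apply: eq_bigr => j _; ring.
  rewrite -!big_distrlr /=; ring.
apply: sumr_ge0 => i _; apply: sumr_ge0 => j _; apply: real_exprn_even_ge0 => //.
by rewrite rpredB // rpredM // ger0_real.
Qed.

Section FiniteSums.
Variable C : numClosedFieldType.

Lemma cauchy_schwarz (I : finType) (P : pred I) (a b : I -> C) :
  `|\sum_(i | P i) a i * b i| ^+ 2
  <= (\sum_(i | P i) `|a i| ^+ 2) * (\sum_(i | P i) `|b i| ^+ 2).
Proof.
apply: (@le_trans _ _ ((\sum_(i | P i) `|a i| * `|b i|) ^+ 2)).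
  rewrite ler_pXn2r ?nnegrE ?sumr_ge0 // => [|i _]; last by rewrite mulr_ge0.
  by apply: (le_trans (ler_norm_sum _ _ _)); under eq_bigr do rewrite normrM.
exact: sqr_sum_leq.
Qed.

(** This turns the Hilbert-Schmidt norm of an operator with bounded coefficients into a count of
    coincidences. *)
Lemma collision_bound (Y K : finType) (f : K -> Y) (a : K -> C) (B : C) : 0 <= B ->
  (forall k, `|a k| <= B) ->
  \sum_y `|\sum_(k | f k == y) a k| ^+ 2
   <= B ^+ 2 * (\sum_k \sum_k' (f k == f k'))%:R.
Proof.
move=> B0 aB; have h y : `|\sum_(k | f k == y) a k| <= B * #|[pred k | f k == y]|%:R.
  apply: (le_trans (ler_norm_sum _ _ _)); apply: (le_trans (ler_sum _ (fun k _ => aB k))).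
  by rewrite sumr_const mulr_natr.
apply: (@le_trans _ _ (\sum_y B ^+ 2 * (#|[pred k | f k == y]| ^ 2)%:R)).
  apply: ler_sum => y _; rewrite natrX -exprMn.
  by rewrite ler_pXn2r ?nnegrE // mulr_ge0.
rewrite -big_distrr /= -natr_sum; apply: ler_wpM2l; first by rewrite exprn_ge0.
rewrite ler_nat; apply: eq_leq.
rewrite [RHS](partition_big f xpredT) //=; apply: eq_bigr => y _.
rewrite -mulnn -sum_nat_const /= big_mkcond [RHS]big_mkcond /=; apply: eq_bigr => k _.
rewrite inE; case: ifP => [/eqP <-|] //.
by rewrite -sum1_card big_mkcond /=; apply: eq_bigr => k' _; rewrite inE eq_sym; case: eqP.
Qed.

End FiniteSums.

(** * Two by two matrices over Z/c and averages over SL_2 *)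

Section Matrices.
Variable n : nat.
Let c := n.+2.
Let Z := 'I_n.+2.

(* A matrix is the pair of its columns. *)
Definition mat2 := ((Z * Z) * (Z * Z))%type.

Definition act2 (M : mat2) (x : Z * Z) : Z * Z :=
  (M.1.1 * x.1 + M.2.1 * x.2, M.1.2 * x.1 + M.2.2 * x.2).

Definition mul2 (M N : mat2) : mat2 := (act2 M N.1, act2 M N.2).

Definition wedge (v w : Z * Z) : Z := v.1 * w.2 - v.2 * w.1.

Definition det2 (M : mat2) : Z := wedge M.1 M.2.

Definition adj2 (M : mat2) : mat2 := ((M.2.2, - M.1.2), (- M.2.1, M.1.1)).

(** Right multiplication by the lower triangular unipotent with entry s; it commutes with all left
    multiplications ([shear_act]). *)
Definition shear (s : Z) (M : mat2) : mat2 := ((M.1.1 + s * M.2.1, M.1.2 + s * M.2.2), M.2).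

Lemma act2_mul M N x : act2 (mul2 M N) x = act2 M (act2 N x).
Proof. by rewrite /act2 /mul2 /=; congr pair; ring. Qed.

Lemma mul2A M N P : mul2 (mul2 M N) P = mul2 M (mul2 N P).
Proof. by rewrite /mul2 !act2_mul. Qed.

Lemma wedge_act2 M v w : wedge (act2 M v) (act2 M w) = det2 M * wedge v w.
Proof. rewrite /wedge /act2 /det2 /wedge /=; ring. Qed.

Lemma det2_mul M N : det2 (mul2 M N) = det2 M * det2 N.
Proof. by rewrite {1}/det2 wedge_act2. Qed.

Lemma det2_adj M : det2 (adj2 M) = det2 M.
Proof. rewrite /det2 /adj2 /wedge /=; ring. Qed.

Lemma act2_adjK M x : det2 M = 1 -> act2 (adj2 M) (act2 M x) = x.
Proof.
move=> d; rewrite -[RHS](_ : (det2 M * x.1, det2 M * x.2) = x).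
  by rewrite /act2 /adj2 /det2 /wedge /=; congr pair; ring.
by rewrite d !mul1r; case: x.
Qed.

Lemma adj2K M : adj2 (adj2 M) = M.
Proof. by case: M => [[a b] [d e]]; rewrite /adj2 /= !opprK. Qed.

Lemma act2_Kadj M x : det2 M = 1 -> act2 M (act2 (adj2 M) x) = x.
Proof. by move=> d; rewrite -{1}(adj2K M) act2_adjK ?det2_adj. Qed.

Lemma mul2_adjK M N : det2 M = 1 -> mul2 (adj2 M) (mul2 M N) = N.
Proof. by move=> d; rewrite /mul2 !act2_adjK //; case: N. Qed.

Lemma mul2_Kadj M N : det2 M = 1 -> mul2 M (mul2 (adj2 M) N) = N.
Proof. by move=> d; rewrite /mul2 !act2_Kadj //; case: N. Qed.

Lemma det2_shear s M : det2 (shear s M) = det2 M.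
Proof. rewrite /det2 /shear /wedge /=; ring. Qed.

Lemma shear_act s M y : shear s (mul2 M y) = mul2 M (shear s y).
Proof. by rewrite /shear /mul2 /act2 /=; congr (pair (pair _ _) _); ring. Qed.

End Matrices.

Section Reindexing.
Variables (C : numClosedFieldType) (n : nat).
Let Z := 'I_n.+2.

Lemma sum_SL2_mul (F : mat2 n -> C) (M : mat2 n) : det2 M = 1 ->
  \sum_(y | det2 y == 1) F y = \sum_(y | det2 y == 1) F (mul2 M y).
Proof.
move=> d; rewrite (reindex (mul2 M)) /=; last first.
  by exists (mul2 (adj2 M)) => y _; rewrite ?mul2_adjK ?mul2_Kadj.
by apply: eq_bigl => y; rewrite det2_mul d mul1r.
Qed.

Lemma sum_SL2_shear (F : mat2 n -> C) (s : Z) :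
  \sum_(y | det2 y == 1) F (shear s y) = \sum_(y | det2 y == 1) F y.
Proof.
rewrite [RHS](reindex (shear s)) /=; last first.
  exists (shear (- s)) => -[[a b] [d e]] _; rewrite /shear /=; congr (pair (pair _ _) _); ring.
by apply: eq_bigl => y; rewrite det2_shear.
Qed.

End Reindexing.

Section Amplification.
Variables (C : numClosedFieldType) (n : nat).
Let c := n.+2.
Let Z := 'I_n.+2.
Let V := (Z * Z)%type.
Variables (I : finType) (g : I -> mat2 n) (q : I -> C) (om : C).
Hypotheses (hg : forall i, det2 (g i) = 1) (om0 : 0 <= om) (hq : forall i, `|q i| <= om).

Definition avg_op (phi : V -> C) (x : V) : C := \sum_i q i * phi (act2 (g i) x).

Definition avg_op_adj (phi : V -> C) (x : V) : C :=
  \sum_i (q i)^* * phi (act2 (adj2 (g i)) x).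

(* A function of vectors is viewed on SL_2 through the first column. *)
Definition sl2_norm (phi : V -> C) : C := \sum_(y : mat2 n | det2 y == 1) `|phi y.1| ^+ 2.

Definition vec_norm (phi : V -> C) : C := \sum_x `|phi x| ^+ 2.

Definition word_mat (j : I * I * I) : mat2 n :=
  mul2 (g j.2) (mul2 (adj2 (g j.1.2)) (g j.1.1)).

Definition word_coef (j : I * I * I) : C := q j.1.1 * (q j.1.2)^* * q j.2.

Lemma sl2_norm_ge0 phi : 0 <= sl2_norm phi.
Proof. by apply: sumr_ge0 => y _; rewrite exprn_ge0. Qed.

Lemma vec_norm_ge0 phi : 0 <= vec_norm phi.
Proof. by apply: sumr_ge0 => y _; rewrite exprn_ge0. Qed.

Lemma avg_op_adjoint (phi psi : V -> C) :
  \sum_(y : mat2 n | det2 y == 1) avg_op phi y.1 * (psi y.1)^*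
  = \sum_(y : mat2 n | det2 y == 1) phi y.1 * (avg_op_adj psi y.1)^*.
Proof.
under eq_bigr do rewrite /avg_op big_distrl /=.
under [RHS]eq_bigr do rewrite /avg_op_adj rmorph_sum big_distrr /=.
rewrite exchange_big [RHS]exchange_big /=; apply: eq_bigr => i _.
rewrite (@sum_SL2_mul C n _ (adj2 (g i))) ?det2_adj //; apply: eq_bigr => y _.
rewrite /mul2 /= act2_Kadj // rmorphM /= conjCK; ring.
Qed.

(** With m_i the squared norms after i factors of T T* T, Cauchy-Schwarz and adjointness give m1^2
    <= N0 m2 and m2^2 <= m3 m1; eliminate m2. *)
Lemma sl2_norm_chain (phi : V -> C) :
  sl2_norm (avg_op phi) ^+ 3
  <= sl2_norm (avg_op (avg_op_adj (avg_op phi))) * sl2_norm phi ^+ 2.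
Proof.
set m1 := sl2_norm (avg_op phi); set m3 := sl2_norm (avg_op (avg_op_adj _)).
set N0 := sl2_norm phi; pose m2 := sl2_norm (avg_op_adj (avg_op phi)).
have m10 : 0 <= m1 by apply: sl2_norm_ge0.
have nE (f : V -> C) : sl2_norm f = \sum_(y : mat2 n | det2 y == 1) f y.1 * (f y.1)^*.
  by apply: eq_bigr => y _; rewrite normCK.
have nC (f : V -> C) : \sum_(y : mat2 n | det2 y == 1) `|(f y.1)^*| ^+ 2 = sl2_norm f.
  by apply: eq_bigr => y _; rewrite norm_conjC.
have h1 : m1 ^+ 2 <= N0 * m2.
  have -> : m1 ^+ 2 = `|m1| ^+ 2 by rewrite ger0_norm.
  rewrite {1}/m1 nE avg_op_adjoint; apply: (le_trans (cauchy_schwarz _ _ _)).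
  by rewrite nC.
have h2 : m2 ^+ 2 <= m3 * m1.
  have -> : m2 ^+ 2 = `|m2| ^+ 2 by rewrite ger0_norm ?sl2_norm_ge0.
  rewrite /m2 nE -avg_op_adjoint; apply: (le_trans (cauchy_schwarz _ _ _)).
  by rewrite nC.
case: (eqVneq m1 0) => [->|n0].
  by rewrite expr0n /= mulr_ge0 ?exprn_ge0 // sl2_norm_ge0.
have m1p : 0 < m1 by rewrite lt0r n0.
rewrite -(ler_pM2r m1p) -exprSr.
apply: (@le_trans _ _ ((N0 * m2) ^+ 2)).
  have -> : m1 ^+ 4 = (m1 ^+ 2) ^+ 2 by rewrite -exprM.
  by rewrite ler_pXn2r ?nnegrE ?exprn_ge0 // mulr_ge0 ?sl2_norm_ge0.
have -> : m3 * N0 ^+ 2 * m1 = N0 ^+ 2 * (m3 * m1) by ring.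
by rewrite exprMn ler_wpM2l // exprn_ge0 // sl2_norm_ge0.
Qed.

Lemma avg_op_word (phi : V -> C) x :
  avg_op (avg_op_adj (avg_op phi)) x = \sum_j word_coef j * phi (act2 (word_mat j) x).
Proof.
rewrite [RHS]big_pair big_pair /=.
apply: eq_bigr => i1 _; rewrite big_distrr /=; apply: eq_bigr => i2 _.
rewrite mulrA big_distrr /=; apply: eq_bigr => i3 _.
by rewrite /word_coef /word_mat /= mulrA !act2_mul.
Qed.

Lemma word_coef_le j : `|word_coef j| <= om ^+ 3.
Proof.
rewrite /word_coef !normrM norm_conjC (_ : om ^+ 3 = om * om * om); last by ring.
by rewrite !ler_pM // mulr_ge0.
Qed.

Lemma det2_word j : det2 (word_mat j) = 1.
Proof. by rewrite /word_mat !det2_mul det2_adj !hg !mul1r. Qed.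

Variables (phi : V -> C) (qz : Z) (L : nat) (tau : 'I_L -> Z) (ks : nat).
Hypothesis hphi : forall a x, a \is a GRing.unit -> phi (a * x.1, a * x.2) = phi x.
Hypothesis orth : forall t t', t != t' ->
  forall v : V, \sum_(w : V) phi (v.1 + qz * (tau t - tau t') * w.1,
                                  v.2 + qz * (tau t - tau t') * w.2) = 0.
Hypothesis hks : forall d : Z, (#|[set s : Z | (s \is a GRing.unit) && (s * s == d)%R]| <= ks)%N.

Let Uc := #|[set s : Z | s \is a GRing.unit]|.
Let e (t : 'I_L) (y : mat2 n) : C := phi (shear (qz * tau t) y).1.

Let scale (s : Z) (y : mat2 n) : mat2 n := ((s * y.1.1, s * y.1.2), (s * y.2.1, s * y.2.2)).

(** Scaling by a unit s carries SL_2 onto the matrices of determinant s^2 and leaves F unchanged. As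
    s varies, a matrix is reached at most as often as its determinant has square roots. *)
Lemma sum_scaled (F : mat2 n -> C) : (forall y, 0 <= F y) ->
  (forall s y, s \is a GRing.unit -> F (scale s y) = F y) ->
  Uc%:R * (\sum_(y | det2 y == 1) F y) <= ks%:R * \sum_y F y.
Proof.
move=> F0 Fs; rewrite mulr_natl -sumr_const.
rewrite (eq_bigr (fun s => \sum_(y | det2 y == 1) F (scale s y))); last first.
  by move=> s; rewrite inE => us; apply: eq_bigr => y _; rewrite Fs.
have step s : s \in [set s : Z | s \is a GRing.unit] ->
  \sum_(y | det2 y == 1) F (scale s y) = \sum_(y | s * s == det2 y) F y.
  rewrite inE => us; rewrite [RHS](reindex (scale s)) /=; last first.
    exists (scale s^-1) => -[[y1 y2] [y3 y4]] _; rewrite /scale /=; congr (pair (pair _ _) (pair _ _));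
    by rewrite mulrA ?mulVr ?mulrV // mul1r.
  apply: eq_bigl => y; have -> : det2 (scale s y) = s * s * det2 y.
    by rewrite /det2 /wedge /scale /=; ring.
  by rewrite -{1}(mulr1 (s * s)) (inj_eq (mulrI _)) 1?eq_sym // unitrM us.
rewrite (eq_bigr _ step) (exchange_big_dep xpredT) //= big_distrr /=.
apply: ler_sum => y _; rewrite sumr_const -[leLHS]mulr_natl; apply: ler_wpM2r => //; rewrite ler_nat.
apply: (leq_trans _ (hks (det2 y))); apply: eq_leq; apply: eq_card => s.
by rewrite !inE [LHS]unfold_in /= inE.
Qed.

(** Over all matrices the second column is independent of the first, so the inner product of two
    translates contains a full sum of phi over a coset of qz (tau t' - tau t) V, which vanishes by
    [orth]. *)
Lemma bessel_all (x : 'I_L -> C) :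
  \sum_(y : mat2 n) `|\sum_t x t * e t y| ^+ 2
  = (c ^ 2)%:R * vec_norm phi * \sum_t `|x t| ^+ 2.
Proof.
have -> : \sum_(y : mat2 n) `|\sum_t x t * e t y| ^+ 2
  = \sum_t \sum_t' x t * (x t')^* * \sum_(y : mat2 n) e t y * (e t' y)^*.
  under eq_bigr => y _.
    rewrite normCK rmorph_sum big_distrlr /=.
    over.
  rewrite exchange_big /=; apply: eq_bigr => t _.
  rewrite exchange_big /=; apply: eq_bigr => t' _.
  rewrite big_distrr /=; apply: eq_bigr => y _.
  rewrite rmorphM /=; ring.
have gram t t' : \sum_(y : mat2 n) e t y * (e t' y)^* = (t == t')%:R * ((c ^ 2)%:R * vec_norm phi).
  (* Undoing the first translation leaves phi at the first column v alone, while the second column w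
     enters only the other factor. *)
  rewrite (reindex (shear (- (qz * tau t)))) /=; last first.
    by exists (shear (qz * tau t)) => -[[y1 y2] [y3 y4]] _; rewrite /shear /=; congr (pair (pair _ _) _); ring.
  have -> : \sum_(y : mat2 n) e t (shear (- (qz * tau t)) y) * (e t' (shear (- (qz * tau t)) y))^*
   = \sum_v phi v * (\sum_w phi (v.1 + qz * (tau t' - tau t) * w.1, v.2 + qz * (tau t' - tau t) * w.2))^*.
    rewrite big_pair /=.
    apply: eq_bigr => v _; rewrite rmorph_sum big_distrr /=; apply: eq_bigr => w _.
    rewrite /e /shear /=; congr (phi _ * (phi _)^*).
      by rewrite [RHS]surjective_pairing; congr pair; ring.
    by congr pair; ring.
  case: (eqVneq t t') => [<-|ne]; last first.
    by rewrite mul0r big1 // => v _; rewrite orth 1?eq_sym // conjC0 mulr0.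
  rewrite mul1r /vec_norm big_distrr /=; apply: eq_bigr => v _.
  rewrite (eq_bigr (fun _ => phi v)); last first.
    by move=> w _; congr phi; rewrite [RHS]surjective_pairing; congr pair; ring.
  by rewrite sumr_const card_prod card_ord mulnn rmorphMn /= mulrnAr -normCK mulr_natl.
rewrite [RHS]big_distrr /=; apply: eq_bigr => t _; rewrite (bigD1 t) //= gram eqxx mul1r big1 ?addr0.
  by rewrite normCK; ring.
by move=> t' /negPf tt'; rewrite gram eq_sym tt' mul0r mulr0.
Qed.

Lemma bessel_SL2 (x : 'I_L -> C) :
  Uc%:R * (\sum_(y : mat2 n | det2 y == 1) `|\sum_t x t * e t y| ^+ 2)
  <= ks%:R * ((c ^ 2)%:R * vec_norm phi * \sum_t `|x t| ^+ 2).
Proof.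
rewrite -bessel_all; apply: sum_scaled => [y|s y us]; first by rewrite exprn_ge0.
congr (`|_| ^+ 2); apply: eq_bigr => t _; rewrite /e -(hphi (shear _ y).1 us).
by congr (_ * phi _); rewrite /shear /scale /=; congr pair; ring.
Qed.

(** Duality: the left-hand sum S is the pairing of k with the combination of the [e t] whose
    coefficients are the conjugates of [z t]. Cauchy-Schwarz and [bessel_SL2] bound S^2 by a
    multiple of S, and S is cancelled. *)
Lemma bessel_dual (k : mat2 n -> C) :
  Uc%:R * (\sum_t `|\sum_(y : mat2 n | det2 y == 1) k y * e t y| ^+ 2)
  <= ks%:R * ((c ^ 2)%:R * vec_norm phi) * \sum_(y : mat2 n | det2 y == 1) `|k y| ^+ 2.
Proof.
pose z t := \sum_(y : mat2 n | det2 y == 1) k y * e t y.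
pose S := \sum_t `|z t| ^+ 2; rewrite -/S.
have S0 : 0 <= S by apply: sumr_ge0 => t _; rewrite exprn_ge0.
have SE : S = \sum_(y : mat2 n | det2 y == 1) k y * \sum_t (z t)^* * e t y.
  under [RHS]eq_bigr do rewrite big_distrr /=.
  rewrite exchange_big /=; apply: eq_bigr => t _.
  rewrite normCK {1}/z big_distrl /=; apply: eq_bigr => y _; ring.
have h1 : S ^+ 2 <= (\sum_(y : mat2 n | det2 y == 1) `|k y| ^+ 2) *
   \sum_(y : mat2 n | det2 y == 1) `|\sum_t (z t)^* * e t y| ^+ 2.
  have -> : S ^+ 2 = `|S| ^+ 2 by rewrite ger0_norm.
  by rewrite {1}SE; apply: cauchy_schwarz.
have h2 := bessel_SL2 (fun t => (z t)^*).
have zz : \sum_t `|(z t)^*| ^+ 2 = S by apply: eq_bigr => t _; rewrite norm_conjC.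
rewrite zz in h2.
set K2 := \sum_(y | _) `|k y| ^+ 2 in h1 *.
have K20 : 0 <= K2 by apply: sumr_ge0 => t _; rewrite exprn_ge0.
have U0 : (0 : C) <= Uc%:R by rewrite ler0n.
case: (eqVneq S 0) => [->|n0].
  by rewrite mulr0 !mulr_ge0 // ?ler0n // vec_norm_ge0.
have Sp : 0 < S by rewrite lt0r n0.
rewrite -(ler_pM2r Sp).
have -> : Uc%:R * S * S = Uc%:R * S ^+ 2 by ring.
apply: (le_trans (ler_wpM2l U0 h1)); rewrite mulrCA.
apply: (le_trans (ler_wpM2l K20 h2)).
set X := (X in _ <= X); rewrite (_ : _ * _ = X) // /X; ring.
Qed.

Variable Hs : {set Z * Z}.
Hypothesis hHs : forall h, h \in Hs -> [/\ h.1 \is a GRing.unit, qz * h.1 = qz & qz * h.2 = 0].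

(* Right multiplication of y by the upper triangular matrix [[h.1, h.2], [0, 1 / h.1]]. *)
Let rm (y : mat2 n) (h : Z * Z) : mat2 n :=
  ((h.1 * y.1.1, h.1 * y.1.2), (h.2 * y.1.1 + h.1^-1 * y.2.1, h.2 * y.1.2 + h.1^-1 * y.2.2)).

(* Holds when M y = y t with t congruent to 1 modulo the annihilator of qz and
   upper triangular, v being the first column of y. *)
Definition near_unipotent (M : mat2 n) (v : Z * Z) : bool :=
  [&& qz * M.1.1 == qz, qz * M.1.2 == 0, qz * M.2.1 == 0, qz * M.2.2 == qz & wedge v (act2 M v) == 0].

(** Elements of Hs are congruent to 1 modulo the annihilator of qz, so they pass through the shear
    by qz tau up to scaling the first column by h.1, to which phi is insensitive. *)
Let e_rm t y h : h \in Hs -> e t (rm y h) = e t y.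
Proof.
move=> /hHs[u1 q1 q2]; rewrite /e -[RHS](hphi _ u1); congr phi.
have q3 : qz * h.1^-1 = qz by rewrite -{1}q1 -mulrA mulrV // mulr1.
rewrite /shear /rm /=; congr pair.
  have -> : h.1 * y.1.1 + qz * tau t * (h.2 * y.1.1 + h.1^-1 * y.2.1)
    = h.1 * y.1.1 + (qz * h.2) * (tau t * y.1.1) + (qz * h.1^-1) * (tau t * y.2.1) by ring.
  by rewrite q2 q3 -{1}q1; ring.
have -> : h.1 * y.1.2 + qz * tau t * (h.2 * y.1.2 + h.1^-1 * y.2.2)
    = h.1 * y.1.2 + (qz * h.2) * (tau t * y.1.2) + (qz * h.1^-1) * (tau t * y.2.2) by ring.
by rewrite q2 q3 -{1}q1; ring.
Qed.

Let rm_mul M y h : rm (mul2 M y) h = mul2 M (rm y h).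
Proof. by rewrite /rm /mul2 /act2 /=; congr (pair (pair _ _) (pair _ _)); ring. Qed.

Let det2_rm y h : h \in Hs -> det2 (rm y h) = det2 y.
Proof.
move=> /hHs[u1 _ _]; rewrite /det2 /wedge /rm /=.
have -> : h.1 * y.1.1 * (h.2 * y.1.2 + h.1^-1 * y.2.2) - h.1 * y.1.2 * (h.2 * y.1.1 + h.1^-1 * y.2.1)
  = (h.1 * h.1^-1) * (y.1.1 * y.2.2 - y.1.2 * y.2.1) by ring.
by rewrite mulrV // mul1r.
Qed.

Let rm_inj y h h' : h \in Hs -> h' \in Hs -> det2 y = 1 -> rm y h = rm y h' -> h = h'.
Proof.
move=> /hHs[u1 _ _] /hHs[u1' _ _] d E0.
have e1 : h.1 * y.1.1 = h'.1 * y.1.1 := congr1 (fun y : mat2 n => y.1.1) E0.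
have e2 : h.1 * y.1.2 = h'.1 * y.1.2 := congr1 (fun y : mat2 n => y.1.2) E0.
have e3 : h.2 * y.1.1 + h.1^-1 * y.2.1 = h'.2 * y.1.1 + h'.1^-1 * y.2.1 :=
  congr1 (fun y : mat2 n => y.2.1) E0.
have e4 : h.2 * y.1.2 + h.1^-1 * y.2.2 = h'.2 * y.1.2 + h'.1^-1 * y.2.2 :=
  congr1 (fun y : mat2 n => y.2.2) E0.
have E : h.1 = h'.1.
  have : h.1 * det2 y = h'.1 * det2 y.
    rewrite /det2 /wedge.
    have -> : h.1 * (y.1.1 * y.2.2 - y.1.2 * y.2.1) = (h.1 * y.1.1) * y.2.2 - (h.1 * y.1.2) * y.2.1 by ring.
    by rewrite e1 e2; ring.
  by rewrite d !mulr1.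
have E2 : h.2 = h'.2.
  have : h.2 * det2 y = h'.2 * det2 y.
    rewrite /det2 /wedge.
    have -> : h.2 * (y.1.1 * y.2.2 - y.1.2 * y.2.1) = (h.2 * y.1.1 + h.1^-1 * y.2.1) * y.2.2
       - (h.2 * y.1.2 + h.1^-1 * y.2.2) * y.2.1 by ring.
    by rewrite e3 e4; ring.
  by rewrite d !mulr1.
by rewrite [h]surjective_pairing [h']surjective_pairing E E2.
Qed.

Let rm_near M y h h' : h \in Hs -> h' \in Hs -> det2 y = 1 -> det2 M = 1 ->
  mul2 M (rm y h) = rm y h' -> near_unipotent M y.1.
Proof.
move=> hH hH' d dM E.
have [u1 q1 q2] := hHs hH; have [u1' q1' q2'] := hHs hH'.
(* Multiplied by qz, [rm y k] and y agree entry by entry; the two booleans select one of the four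
   entries. *)
have modq k : k \in Hs -> forall i : bool * bool,
    let pick (y : mat2 n) := if i.1 then (if i.2 then y.1.1 else y.1.2) else (if i.2 then y.2.1 else y.2.2) in
    qz * pick (rm y k) = qz * pick y.
  move=> /hHs[v1 p1 p2]; have p3 : qz * k.1^-1 = qz by rewrite -{1}p1 -mulrA mulrV // mulr1.
  by move=> [[] []] /=; rewrite ?mulrDr ?mulrA ?p1 ?p2 ?p3 ?mul0r ?add0r.
have E11 := congr1 (fun y : mat2 n => qz * y.1.1) E; have E12 := congr1 (fun y : mat2 n => qz * y.1.2) E.
have E21 := congr1 (fun y : mat2 n => qz * y.2.1) E; have E22 := congr1 (fun y : mat2 n => qz * y.2.2) E.
have r11 := modq _ hH (true, true); have r12 := modq _ hH (true, false).
have r21 := modq _ hH (false, true); have r22 := modq _ hH (false, false).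
have s11 := modq _ hH' (true, true); have s12 := modq _ hH' (true, false).
have s21 := modq _ hH' (false, true); have s22 := modq _ hH' (false, false).
have F (a b x y' z : Z) : qz * (a * x + b * y') = qz * z -> a * (qz * x) + b * (qz * y') = qz * z.
  by move=> <-; ring.
move: r11 r12 r21 r22 s11 s12 s21 s22 => /= r11 r12 r21 r22 s11 s12 s21 s22.
move: E11 E12 E21 E22; rewrite /mul2 /act2 /= => E11 E12 E21 E22.
rewrite s11 in E11; rewrite s12 in E12; rewrite s21 in E21; rewrite s22 in E22.
move: E11 E12 E21 E22 => /F E11 /F E12 /F E21 /F E22.
rewrite r11 r12 in E11 E12; rewrite r21 r22 in E21 E22.
have dd : y.1.1 * y.2.2 - y.1.2 * y.2.1 = 1 by exact: d.
rewrite /near_unipotent; apply/and5P; split; apply/eqP.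
- rewrite -[LHS]mulr1 -{1}dd.
  have -> : qz * M.1.1 * (y.1.1 * y.2.2 - y.1.2 * y.2.1)
    = (M.1.1 * (qz * y.1.1) + M.2.1 * (qz * y.1.2)) * y.2.2
     - (M.1.1 * (qz * y.2.1) + M.2.1 * (qz * y.2.2)) * y.1.2 by ring.
  rewrite E11 E21 -[RHS]mulr1 -dd; ring.
- rewrite -[LHS]mulr1 -{1}dd.
  have -> : qz * M.1.2 * (y.1.1 * y.2.2 - y.1.2 * y.2.1)
    = (M.1.2 * (qz * y.1.1) + M.2.2 * (qz * y.1.2)) * y.2.2
     - (M.1.2 * (qz * y.2.1) + M.2.2 * (qz * y.2.2)) * y.1.2 by ring.
  rewrite E12 E22; ring.
- rewrite -[LHS]mulr1 -{1}dd.
  have -> : qz * M.2.1 * (y.1.1 * y.2.2 - y.1.2 * y.2.1)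
    = (M.1.1 * (qz * y.2.1) + M.2.1 * (qz * y.2.2)) * y.1.1
     - (M.1.1 * (qz * y.1.1) + M.2.1 * (qz * y.1.2)) * y.2.1 by ring.
  rewrite E11 E21; ring.
- rewrite -[LHS]mulr1 -{1}dd.
  have -> : qz * M.2.2 * (y.1.1 * y.2.2 - y.1.2 * y.2.1)
    = (M.1.2 * (qz * y.2.1) + M.2.2 * (qz * y.2.2)) * y.1.1
     - (M.1.2 * (qz * y.1.1) + M.2.2 * (qz * y.1.2)) * y.2.1 by ring.
  rewrite E12 E22 -[RHS]mulr1 -dd; ring.
(* M sends h.1 times the first column of y to h'.1 times the same column, so that column is an
   eigenvector and its wedge with its image vanishes. *)
- have [e1 e2] := (congr1 (fun y : mat2 n => y.1.1) E, congr1 (fun y : mat2 n => y.1.2) E).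
  move: e1 e2; rewrite /mul2 /act2 /= => e1 e2.
  apply: (mulrI u1); rewrite mulr0 /wedge /act2 /=.
  have -> : h.1 * (y.1.1 * (M.1.2 * y.1.1 + M.2.2 * y.1.2) - y.1.2 * (M.1.1 * y.1.1 + M.2.1 * y.1.2))
    = y.1.1 * (M.1.2 * (h.1 * y.1.1) + M.2.2 * (h.1 * y.1.2)) - y.1.2 * (M.1.1 * (h.1 * y.1.1) + M.2.1 * (h.1 * y.1.2)) by ring.
  rewrite e1 e2; ring.
Qed.

Definition near_pairs : nat := \sum_j \sum_j'
  #|[set y : mat2 n | (det2 y == 1)%R && near_unipotent (mul2 (adj2 (word_mat j')) (word_mat j)) y.1]|.

(* The translates [e t] are invariant under [rm], so the kernel of T T* T may be
   averaged over Hs before its Hilbert-Schmidt norm is taken. *)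
Lemma amplification_HS :
  L%:R * #|Hs|%:R * Uc%:R * sl2_norm (avg_op (avg_op_adj (avg_op phi)))
  <= ks%:R * ((c ^ 2)%:R * vec_norm phi) * om ^+ 6 * near_pairs%:R.
Proof.
set m3 := sl2_norm _.
case: (set_0Vmem Hs) => [->|[h0 h0H]].
  by rewrite cards0 mulr0 !mul0r !mulr_ge0 ?ler0n ?exprn_ge0 ?vec_norm_ge0.
have Hs0 : (0 : C) < #|Hs|%:R by rewrite ltr0n; apply/card_gt0P; exists h0.
pose K := ((Z * Z) * (I * I * I))%type.
pose f y (k : K) := rm (mul2 (word_mat k.2) y) k.1.
(* Extended by 0 outside Hs, so that K is a full product and the sums factor. *)
pose a (k : K) := if k.1 \in Hs then word_coef k.2 else 0.
pose kap y y' := \sum_(k | f y k == y') a k.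
have expand t y : det2 y == 1 -> #|Hs|%:R * avg_op (avg_op_adj (avg_op phi)) (shear (qz * tau t) y).1
    = \sum_(y' | det2 y' == 1) kap y y' * e t y'.
  move=> dy; rewrite avg_op_word.
  transitivity (\sum_(k : K | det2 (f y k) == 1) a k * e t (f y k)); last first.
    rewrite (partition_big (f y) (fun y' => det2 y' == 1)) //=; apply: eq_bigr => y' dy'.
    rewrite /kap big_distrl /=; apply: eq_big => [k|k /andP[_ /eqP <-] //].
    by case: (eqVneq (f y k) y') => [->|]; rewrite ?dy' ?andbF.
  transitivity (\sum_(k : K) a k * e t (f y k)); last first.
    rewrite [RHS]big_mkcond; apply: eq_bigr => k _; rewrite /a.
    case: ifP => kH; last by rewrite mul0r if_same.
    by rewrite det2_rm // det2_mul det2_word mul1r dy.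
  rewrite [RHS]big_pair /=.
  rewrite mulr_natl -sumr_const big_mkcond /=; apply: eq_bigr => h _; rewrite /a /=.
  case: ifP => kH; last by rewrite big1 // => j _; rewrite mul0r.
  apply: eq_bigr => j _; rewrite /f /= e_rm // /e shear_act //.
(* The shear permutes SL_2 and commutes with the averaging operators, so all L translates have
   images of the same norm. This is what Bessel's inequality multiplies by L. *)
have m3E t : m3 = \sum_(y : mat2 n | det2 y == 1)
    `|avg_op (avg_op_adj (avg_op phi)) (shear (qz * tau t) y).1| ^+ 2.
  by rewrite (sum_SL2_shear (fun y => `|avg_op (avg_op_adj (avg_op phi)) y.1| ^+ 2)).
have LE : L%:R * #|Hs|%:R ^+ 2 * m3 = \sum_(y : mat2 n | det2 y == 1) \sum_t
    `|\sum_(y' | det2 y' == 1) kap y y' * e t y'| ^+ 2.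
  rewrite exchange_big /= -mulrA mulr_natl -{1}(card_ord L) -sumr_const; apply: eq_bigr => t _.
  rewrite (m3E t) big_distrr /=; apply: eq_bigr => y dy.
  by rewrite -expand // normrM normr_nat exprMn.
have kapB y : det2 y == 1 -> \sum_(y' | det2 y' == 1) `|kap y y'| ^+ 2 <= (om ^+ 3) ^+ 2 *
   (\sum_j \sum_j' (#|Hs| * near_unipotent (mul2 (adj2 (word_mat j')) (word_mat j)) y.1))%N%:R.
  move=> dy.
  pose KH := {h : Z * Z | h \in Hs}.
  pose f' (k : KH * (I * I * I)) := f y (val k.1, k.2).
  have kE y' : kap y y' = \sum_(k | f' k == y') word_coef k.2.
    rewrite /kap /a -big_mkcondr /=.
    rewrite (reindex_onto (fun k : KH * (I * I * I) => (val k.1, k.2))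
       (fun k : K => (insubd (exist _ h0 h0H : KH) k.1, k.2))) /=; last first.
      by move=> [h j] /andP[_ /= hH]; rewrite insubdK.
    apply: eq_bigl => -[k j] /=; rewrite (valP k) andbT.
    rewrite (_ : insubd _ _ = k) ?eqxx ?andbT //; apply: val_inj; rewrite insubdK //; exact: valP.
  apply: (@le_trans _ _ (\sum_y' `|kap y y'| ^+ 2)).
    by rewrite [leLHS]big_mkcond; apply: ler_sum => y' _; case: ifP => // _; rewrite exprn_ge0.
  rewrite (eq_bigr (fun y' => `|\sum_(k | f' k == y') word_coef k.2| ^+ 2)); last first.
    by move=> y' _; rewrite kE.
  apply: (le_trans (collision_bound f' (B := om ^+ 3) _ _)).
  - by rewrite exprn_ge0.
  - by move=> k; apply: word_coef_le.
  apply: ler_wpM2l; first by rewrite -exprM exprn_ge0.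
  rewrite ler_nat.
  rewrite big_pair exchange_big /=.
  apply: leq_sum => j _.
  under eq_bigr => h _.
    rewrite big_pair exchange_big /=.
    over.
  rewrite exchange_big /=; apply: leq_sum => j' _.
  have cardKH : #|Hs| = #|{: KH}| by rewrite card_sig; apply: eq_card => h; rewrite inE.
  rewrite cardKH -sum_nat_const; apply: leq_sum => h _.
  (* For fixed h, j and j' at most one h' collides, by [rm_inj], and a collision makes the quotient
     of the two words near unipotent at y.1, by [rm_near]. *)
  case: (boolP [exists h' : KH, f' (h, j) == f' (h', j')]) => [/existsP[h1 /eqP E1]|]; last first.
    move=> /existsPn ne; rewrite big1 // => h' _; by rewrite (negPf (ne h')).
  have nu : near_unipotent (mul2 (adj2 (word_mat j')) (word_mat j)) y.1.
    apply: (rm_near (valP h) (valP h1) (eqP dy)).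
      by rewrite det2_mul det2_adj !det2_word mul1r.
    move: E1; rewrite /f' /f /= !rm_mul => /(congr1 (mul2 (adj2 (word_mat j')))).
    by rewrite mul2_adjK ?det2_word // => <-; rewrite mul2A.
  rewrite nu (bigD1 h1) //= E1 eqxx big1 // => h' ne.
  case: eqP => // E2; case/negP: ne; apply/eqP; apply: val_inj.
  have dd : det2 (mul2 (word_mat j') y) = 1 by rewrite det2_mul det2_word mul1r; apply/eqP.
  by apply: (rm_inj (valP h') (valP h1) dd); rewrite -/(f' _).
rewrite -(ler_pM2r Hs0).
have -> : L%:R * #|Hs|%:R * Uc%:R * m3 * #|Hs|%:R = Uc%:R * (L%:R * #|Hs|%:R ^+ 2 * m3) :> C by ring.
rewrite LE big_distrr /=.
apply: (@le_trans _ _ (\sum_(y : mat2 n | det2 y == 1) ks%:R * ((c ^ 2)%:R * vec_norm phi) *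
   ((om ^+ 3) ^+ 2 * (\sum_j \sum_j' (#|Hs| * near_unipotent (mul2 (adj2 (word_mat j')) (word_mat j)) y.1))%N%:R))).
  apply: ler_sum => y dy; apply: (le_trans (bessel_dual (kap y))).
  by apply: ler_wpM2l; [rewrite !mulr_ge0 ?ler0n ?vec_norm_ge0 | exact: kapB].
rewrite -big_distrr -big_distrr /= -exprM -natr_sum -!mulrA.
apply: ler_wpM2l; first by rewrite ler0n.
do 2! (apply: ler_wpM2l; first by rewrite ?ler0n ?vec_norm_ge0).
do 6! apply: ler_wpM2l => //.
rewrite -natrM ler_nat; apply: eq_leq.
rewrite exchange_big /= /near_pairs big_distrl /=; apply: eq_bigr => j _.
rewrite exchange_big /= big_distrl /=; apply: eq_bigr => j' _.
rewrite -big_distrr /= mulnC; congr (_ * _)%N.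
rewrite -sum1_card big_mkcond [RHS]big_mkcond /=; apply: eq_bigr => y _; rewrite inE.
by case: (det2 y == 1) => //=; case: (near_unipotent _ _).
Qed.

End Amplification.

(** * Counting words that are scalar modulo a divisor of c *)

Section ResidueRing.
Variable n : nat.
Let c := n.+2.
Let Z := 'I_n.+2.

Lemma Zval_nat (k : nat) : (k%:R : Z) = (k %% c)%N :> nat.
Proof. by rewrite Zp_nat. Qed.

Lemma Znat_eq0 (k : nat) : ((k%:R : Z) == 0) = (c %| k)%N.
Proof. by rewrite -val_eqE /= Zval_nat. Qed.

Lemma Zunit_coprime (x : Z) : (x \is a GRing.unit) = coprime c x.
Proof. by rewrite -[x in LHS]natr_Zp (@unitZpE n.+2). Qed.

Lemma card_Zunits : #|[set s : Z | s \is a GRing.unit]| = totient c.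
Proof.
rewrite totient_count_coprime big_mkord -sum1_card [RHS](eq_bigr (fun d : 'I_c => if coprime c d then 1%N else 0%N)).
  by rewrite -big_mkcond; apply: eq_bigl => s; rewrite inE Zunit_coprime.
by move=> d _; case: coprime.
Qed.

(** Division by one square root maps the others to square roots of 1, counted by [card_sqrt1]. *)
Lemma card_Zsqrt (d : Z) :
  (#|[set s : Z | (s \is a GRing.unit) && (s * s == d)%R]| <= ndiv c ^ 2 * 2)%N.
Proof.
set A := [set s | _]; case: (set_0Vmem A) => [->|[s0]]; first by rewrite cards0.
rewrite inE => /andP[u0 /eqP e0].
apply: (leq_trans _ (card_sqrt1 (ltn0Sn n.+1))).
have inj : injective (fun s : Z => s * s0^-1) by apply: mulIr; rewrite unitrV.
rewrite -(card_imset _ inj); apply/subset_leq_card/subsetP => _ /imsetP[s sA ->].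
move: sA; rewrite !inE => /andP[us /eqP es]; rewrite -Znat_eq0.
rewrite natrM !natrD !natr_Zp natrB // (_ : c%:R = 0); last by apply/eqP; rewrite Znat_eq0.
have e1 : (s * s0^-1) * (s * s0^-1) = 1.
  by rewrite mulrACA es -e0 -mulrACA mulrV // mul1r.
apply/eqP; transitivity ((s * s0^-1) * (s * s0^-1) - 1 : Z); first ring.
by rewrite e1 subrr.
Qed.

Section Annihilator.
Variables (r q : nat).
Hypothesis cE : c = (r * q)%N.

(** Congruences modulo the divisor r of c are expressed throughout as equations in Z/c multiplied by
    the cofactor q, which avoids reduction maps between residue rings. *)
Lemma ann_nat (x : nat) : ((q%:R * x%:R : Z) == 0) = (r %| x)%N.
Proof.
have q0 : (0 < q)%N by case: (q) cE => //; rewrite muln0.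
by rewrite -natrM Znat_eq0 cE mulnC dvdn_pmul2l.
Qed.

Lemma ann_val (x : Z) : (q%:R * x == 0) = (r %| x)%N.
Proof. by rewrite -{1}(natr_Zp x) ann_nat. Qed.

Lemma ann_int (x : int) : ((q%:R * x%:~R : Z) == 0) = (r%:Z %| x)%Z.
Proof.
case: x => k; first by rewrite -pmulrn ann_nat dvdzE.
by rewrite NegzE mulrNz mulrN oppr_eq0 -pmulrn ann_nat dvdzE abszN.
Qed.

Definition congr_units : {set Z * Z} :=
  [set h | [&& h.1 \is a GRing.unit, q%:R * h.1 == q%:R & q%:R * h.2 == 0]].

(** At most r residue classes modulo r contain units, and dividing the units of one class by one of
    them lands in the units congruent to 1. The second components are the q multiples of r. *)
Lemma card_congr_units : (totient c * q <= r * #|congr_units|)%N.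
Proof.
have q0 : (0 < q)%N by case: (q) cE => //; rewrite muln0.
have r0 : (0 < r)%N by case: (r) cE => //.
pose U := [set a : Z | (a \is a GRing.unit) && (q%:R * a == q%:R)].
pose B := [set b : Z | q%:R * b == 0].
have -> : congr_units = setX U B by apply/setP => h; rewrite !inE andbA.
rewrite cardsX mulnA; apply: leq_mul.
  rewrite -card_Zunits; set W := [set s | _].
  have lt (a : Z) : (a %% r < r)%N by rewrite ltn_pmod.
  pose f (a : Z) : 'I_r := Ordinal (lt a).
  rewrite -[#|W|]mul1n -{1}(card_ord r) -cardsT.
  apply: (@card_fibers_weighted _ _ f) => [a _|i _]; first by rewrite inE.
  rewrite mul1n; set F := [set x in W | _].
  case: (set_0Vmem F) => [->|[a0]]; first by rewrite cards0.
  rewrite !inE => /andP[u0 /eqP f0].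
  have inj : injective (fun s : Z => s * a0^-1) by apply: mulIr; rewrite unitrV.
  rewrite -(card_imset _ inj); apply/subset_leq_card/subsetP => _ /imsetP[a aF ->].
  move: aF; rewrite !inE => /andP[ua /eqP fa]; rewrite unitrM unitrV ua u0 /=.
  have -> : q%:R * (a * a0^-1) = q%:R + q%:R * (a - a0) * a0^-1.
    by rewrite mulrBr mulrBl -[X in _ - X]mulrA mulrV // mulr1 addrC subrK mulrA.
  suff /eqP -> : q%:R * (a - a0) == 0 by rewrite mul0r addr0.
  have -> : a - a0 = ((a : nat)%:Z - (a0 : nat)%:Z)%:~R :> Z.
    by rewrite intrB -!pmulrn !natr_Zp.
  rewrite ann_int.
  rewrite -eqz_mod_dvd !modz_nat eqz_nat.
  by have := congr1 val (etrans fa (esym f0)) => /= ->.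
have lt (j : 'I_q) : (r * j < c)%N by rewrite cE ltn_pmul2l.
pose f (j : 'I_q) : Z := Ordinal (lt j).
have inj : injective f.
  by move=> i j /(congr1 val) /= /eqP; rewrite eqn_pmul2l // => /eqP /val_inj.
rewrite -[leqLHS](card_ord q) -(card_imset _ inj); apply/subset_leq_card/subsetP => _ /imsetP[j _ ->].
by rewrite inE ann_val /= dvdn_mulr.
Qed.

End Annihilator.
End ResidueRing.

Section SlopeCount.
Variable n : nat.
Let c := n.+2.
Let Z := 'I_n.+2.

(** For c = p k, this says that M is scalar modulo p. *)
Definition scalar_mod (k : nat) (M : mat2 n) : bool :=
  [&& k%:R * M.1.2 == 0, k%:R * M.2.1 == 0 & k%:R * M.1.1 == k%:R * M.2.2].

(** Any two solutions differ by a multiple of v, by the identity among the three wedges. *)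
Lemma card_SL2_fst (v : Z * Z) : (#|[set w : Z * Z | (wedge v w == 1)%R]| <= c)%N.
Proof.
set A := [set w | _]; case: (set_0Vmem A) => [->|[w0]]; first by rewrite cards0.
rewrite inE => /eqP w0E.
have sub : A \subset [set (w0.1 + a * v.1, w0.2 + a * v.2) | a in [set: Z]].
  apply/subsetP => w; rewrite inE => /eqP wE; apply/imsetP; exists (wedge w w0) => //.
  rewrite [LHS]surjective_pairing; congr pair.
    transitivity (w.1 * wedge v w0); first by rewrite w0E mulr1.
    transitivity (w0.1 * wedge v w + wedge w w0 * v.1); first by rewrite /wedge; ring.
    by rewrite wE mulr1.
  transitivity (w.2 * wedge v w0); first by rewrite w0E mulr1.
  transitivity (w0.2 * wedge v w + wedge w w0 * v.2); first by rewrite /wedge; ring.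
  by rewrite wE mulr1.
apply: (leq_trans (subset_leq_card sub)); apply: (leq_trans (leq_imset_card _ _)).
by rewrite cardsT card_ord.
Qed.

(* In the basis given by one solution (v1, w1), v = s v1 + t w1 and the wedge of v
   and M v is t (s B + t C): the count reduces to [card_quadratic]. *)
Lemma card_near_unipotent (r q : nat) (M : mat2 n) : c = (r * q)%N ->
  (#|[set y : mat2 n | (det2 y == 1)%R && near_unipotent q%:R M y.1]|
   <= c ^ 2 * (ndiv c ^ 2 * sqrtdiv q)
      * \sum_(p <- divisors c | (r %| p)%N && scalar_mod (c %/ p) M) p)%N.
Proof.
move=> cE; set A := [set y | _].
have r0 : (0 < r)%N by case: (r) cE => //.
have q0 : (0 < q)%N by case: (q) cE => //; rewrite muln0.
case: (set_0Vmem A) => [->|[[v1 w1]]]; first by rewrite cards0.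
rewrite inE /= => /andP[/eqP d0 /and5P[/eqP q11 /eqP q12 /eqP q21 /eqP q22 /eqP A0]].
pose B : Z := wedge v1 (act2 M w1) + wedge w1 (act2 M v1).
pose C : Z := wedge w1 (act2 M w1).
have dd : v1.1 * w1.2 - v1.2 * w1.1 = 1 by exact: d0.
pose k := gcdn (gcdn B C) c.
have kc : (k %| c)%N by apply: dvdn_gcdr.
have k0 : (0 < k)%N by rewrite gcdn_gt0 orbT.
have cEk : c = (k * (c %/ k))%N by rewrite mulnC divnK.
have kB : (c %/ k)%:R * B = 0.
  by apply/eqP; rewrite (ann_val cEk) (dvdn_trans (dvdn_gcdl _ _)) // dvdn_gcdl.
have kC : (c %/ k)%:R * C = 0.
  by apply/eqP; rewrite (ann_val cEk) (dvdn_trans (dvdn_gcdl _ _)) // dvdn_gcdr.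
(* The quadratic form sending v to the wedge of v and M v determines M up to a scalar matrix.
   Rewriting its coefficients in the basis (v1, w1), where the first one vanishes, shows that M is
   scalar modulo the gcd k of B, C and c. *)
have Q12 : M.1.2 = C * v1.2 ^+ 2 - B * w1.2 * v1.2 + wedge v1 (act2 M v1) * w1.2 ^+ 2.
  by rewrite -[LHS]mulr1 -[LHS]mulr1 -{1}dd -{1}dd /B /C /wedge /act2 /=; ring.
have Q21 : M.2.1 = - (C * v1.1 ^+ 2 - B * w1.1 * v1.1 + wedge v1 (act2 M v1) * w1.1 ^+ 2).
  by rewrite -[LHS]mulr1 -[LHS]mulr1 -{1}dd -{1}dd /B /C /wedge /act2 /=; ring.
have Q11 : M.2.2 - M.1.1 = B * (v1.1 * w1.2 + v1.2 * w1.1) - C * v1.1 * v1.2 *+ 2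
    - (wedge v1 (act2 M v1) * w1.1 * w1.2) *+ 2.
  by rewrite -[LHS]mulr1 -[LHS]mulr1 -{1}dd -{1}dd /B /C /wedge /act2 /=; ring.
rewrite A0 !mul0r addr0 in Q12 Q21; rewrite A0 !mul0r mul0rn subr0 in Q11.
have kscal : scalar_mod (c %/ k) M.
  apply/and3P; split; apply/eqP.
  - rewrite Q12; set K := _%:R in kB kC *.
    transitivity ((K * C) * v1.2 ^+ 2 - (K * B) * (w1.2 * v1.2)); first ring.
    by rewrite kB kC !mul0r subr0.
  - rewrite Q21; set K := _%:R in kB kC *.
    transitivity (- ((K * C) * v1.1 ^+ 2 - (K * B) * (w1.1 * v1.1))); first ring.
    by rewrite kB kC !mul0r subr0 oppr0.
  - apply/eqP; rewrite eq_sym -subr_eq0 -mulrBr Q11; apply/eqP; set K := _%:R in kB kC *.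
    transitivity ((K * B) * (v1.1 * w1.2 + v1.2 * w1.1) - (K * C) * (v1.1 * v1.2) *+ 2); first ring.
    by rewrite kB kC !mul0r mul0rn subr0.
have qwedge (v w : Z * Z) : q%:R * wedge v (act2 M w) = q%:R * wedge v w.
  rewrite /wedge /act2 /=.
  transitivity (v.1 * (q%:R * M.1.2 * w.1 + q%:R * M.2.2 * w.2)
     - v.2 * (q%:R * M.1.1 * w.1 + q%:R * M.2.1 * w.2)); first ring.
  by rewrite q11 q12 q21 q22; ring.
(* M is congruent to 1 modulo r, so B and C reduce to those of the identity, which are 0. *)
have rk : (r %| k)%N.
  rewrite !dvdn_gcd {1}cE dvdn_mulr // andbT -!(ann_val cE) /B /C mulrDr !qwedge /wedge.
  by apply/andP; split; apply/eqP; ring.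
have kq : (c %/ k %| q)%N.
  by rewrite -(@dvdn_pmul2l k) // -cEk {1}cE dvdn_mul // dvdnn.
pose S := [set p : 'I_c * 'I_c | (c %| p.2 * (p.1 * (B : nat) + p.2 * (C : nat)))%N].
have cA : (#|A| <= #|S| * c)%N.
  rewrite -[#|A|]mul1n.
  apply: (@card_fibers_weighted _ _ (fun y : mat2 n => (wedge y.1 w1, wedge v1 y.1))).
    move=> y; rewrite !inE => /andP[_ /and5P[_ _ _ _ /eqP nv]].
    set s := wedge y.1 w1; set t := wedge v1 y.1.
    rewrite -[(s, t).1]/s -[(s, t).2]/t.
    rewrite -Znat_eq0 natrM natrD !natrM !natr_Zp; apply/eqP.
    transitivity (wedge v1 w1 * wedge v1 w1 * wedge y.1 (act2 M y.1) - wedge y.1 w1 ^+ 2 * wedge v1 (act2 M v1)).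
      rewrite /s /t /B /C /wedge /act2 /=; ring.
    by rewrite nv A0 !mulr0 subr0.
  move=> [s t] _; rewrite mul1n; set F := [set x in A | _].
  pose v : Z * Z := (s * v1.1 + t * w1.1, s * v1.2 + t * w1.2).
  have fv y : y \in F -> y.1 = v.
    rewrite !inE => /andP[_ /eqP[es et]]; rewrite /v [LHS]surjective_pairing.
    have e1 : wedge y.1 w1 = s by []. have e2 : wedge v1 y.1 = t by [].
    rewrite -e1 -e2; congr pair; rewrite -[LHS]mulr1 -dd /wedge; ring.
  apply: (leq_trans _ (card_SL2_fst v)).
  have -> : #|F| = #|snd @: F|.
    by rewrite card_in_imset // => -[y1 y2] [x1 x2] /fv /= -> /fv /= -> ->.
  apply/subset_leq_card/subsetP => _ /imsetP[y yF ->].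
  by have := fv y yF; move: yF; rewrite !inE => /andP[/andP[dy _] _] <-.
have cS := card_quadratic (B : nat) (C : nat) (ltn0Sn n.+1); rewrite -/c -/S -/k in cS.
apply: (leq_trans cA); apply: (leq_trans (leq_mul cS (leqnn _))).
have hs : (sqrtdiv (c %/ k) <= sqrtdiv q)%N by apply: sqrtdiv_dvd.
(* k depends on M. Replacing it by the sum over all admissible p allows the sum over pairs of words
   to be taken inside, for each p. *)
have hk : (k <= \sum_(p <- divisors c | (r %| p)%N && scalar_mod (c %/ p) M) p)%N.
  rewrite -big_filter (big_rem k) ?leq_addr //=.
  by rewrite mem_filter rk kscal -dvdn_divisors.
have -> : (ndiv c ^ 2 * (c * (k * sqrtdiv (c %/ k))) * c = c ^ 2 * (ndiv c ^ 2 * sqrtdiv (c %/ k)) * k)%N by ring.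
by apply: leq_mul => //; rewrite !leq_mul.
Qed.

End SlopeCount.

Section UnipotentWords.
Variable n : nat.
Let c := n.+2.
Let Z := 'I_n.+2.

Definition upper_unip (a : Z) : mat2 n := ((1, 0), (a, 1)).

Definition lower_unip (b : Z) : mat2 n := ((1, b), (0, 1)).

Lemma act_upper a x : act2 (upper_unip a) x = (x.1 + a * x.2, x.2).
Proof. by rewrite /act2 /=; congr pair; ring. Qed.

Lemma act_lower b x : act2 (lower_unip b) x = (x.1, b * x.1 + x.2).
Proof. by rewrite /act2 /=; congr pair; ring. Qed.

Lemma mul_upper a b : mul2 (upper_unip a) (upper_unip b) = upper_unip (a + b).
Proof. by rewrite /mul2 !act_upper /=; congr (pair (pair _ _) (pair _ _)); ring. Qed.

Lemma mul_lower a b : mul2 (lower_unip a) (lower_unip b) = lower_unip (a + b).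
Proof. by rewrite /mul2 !act_lower /=; congr (pair (pair _ _) (pair _ _)); ring. Qed.

Lemma upper0 M : mul2 (upper_unip 0) M = M.
Proof. by rewrite /mul2 !act_upper !mul0r !addr0; case: M => [[? ?] [? ?]]. Qed.

Lemma lower0 M : mul2 (lower_unip 0) M = M.
Proof. by rewrite /mul2 !act_lower !mul0r !add0r; case: M => [[? ?] [? ?]]. Qed.

Lemma adj_upper a : adj2 (upper_unip a) = upper_unip (- a).
Proof. by rewrite /adj2 /upper_unip /= oppr0. Qed.

Lemma adj_lower a : adj2 (lower_unip a) = lower_unip (- a).
Proof. by rewrite /adj2 /lower_unip /= oppr0. Qed.

Lemma adj2_mul (M N : mat2 n) : adj2 (mul2 M N) = mul2 (adj2 N) (adj2 M).
Proof. by rewrite /adj2 /mul2 /act2 /=; congr (pair (pair _ _) (pair _ _)); ring. Qed.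

Variable H : nat.

Definition shift_mat (i : 'I_H * 'I_H) : mat2 n :=
  mul2 (upper_unip (i.1 : nat)%:R) (lower_unip (- (i.2 : nat)%:R)).

Lemma det2_shift i : det2 (shift_mat i) = 1.
Proof.
by rewrite /shift_mat det2_mul /det2 /wedge /= !mulr0 !subr0 !mulr1 mul0r subr0.
Qed.

Let J := (('I_H * 'I_H) * ('I_H * 'I_H) * ('I_H * 'I_H))%type.
Let wmat (t : J * J) : mat2 n :=
  mul2 (adj2 (word_mat shift_mat t.2)) (word_mat shift_mat t.1).

Lemma det2_wmat t : det2 (wmat t) = 1.
Proof. by rewrite /wmat det2_mul det2_adj !det2_word ?mul1r //; apply: det2_shift. Qed.

Let bv (x y : 'I_H) : int := boxval x y.

Lemma boxval_intr (o x : 'I_H) : (bv o x)%:~R = (x : nat)%:R - (o : nat)%:R :> Z.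
Proof. by rewrite /bv /boxval intrB -!pmulrn. Qed.

Let upperM a b M : mul2 (upper_unip a) (mul2 (upper_unip b) M) = mul2 (upper_unip (a + b)) M.
Proof. by rewrite -mul2A mul_upper. Qed.

Let lowerM a b M : mul2 (lower_unip a) (mul2 (lower_unip b) M) = mul2 (lower_unip (a + b)) M.
Proof. by rewrite -mul2A mul_lower. Qed.

(** Neighbouring letters of the same type merge, so the quotient of two words is a product of seven
    alternating unipotents. The outer two on each side are moved across. Once the quotient is
    scalar, the two lower factors next to it merge as well, and only the six differences of
    [word_sol] remain. *)
Lemma wmat_conj (t : J * J) :
  mul2 (lower_unip (bv t.2.1.2.2 t.2.2.2)%:~R)
    (mul2 (upper_unip (bv t.2.2.1 t.1.2.1)%:~R) (lower_unip (bv t.1.2.2 t.1.1.2.2)%:~R))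
  = mul2 (upper_unip (- (bv t.2.1.1.1 t.2.1.2.1)%:~R)) (mul2 (lower_unip (- (t.2.1.1.2 : nat)%:R))
     (mul2 (wmat t) (mul2 (lower_unip (t.1.1.1.2 : nat)%:R)
        (upper_unip (- (bv t.1.1.2.1 t.1.1.1.1)%:~R))))).
Proof.
case: t => [[[[h1 k1] [h2 k2]] [h3 k3]] [[[h1' k1'] [h2' k2']] [h3' k3']]] /=.
rewrite /wmat /word_mat /shift_mat /= !adj2_mul !adj2K !adj_upper !adj_lower !opprK !mul2A.
rewrite !(upperM, lowerM) !boxval_intr.
rewrite addNr lower0 addNr lower0.
rewrite mul_upper !upperM.
have -> : - ((h2' : nat)%:R - (h1' : nat)%:R) + (- (h1' : nat)%:R + (h2' : nat)%:R) = 0 :> Z by ring.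
have -> : - (h2 : nat)%:R + (h1 : nat)%:R - ((h1 : nat)%:R - (h2 : nat)%:R) = 0 :> Z by ring.
rewrite upper0; congr (mul2 (lower_unip _) (mul2 (upper_unip _) _)); [ring|ring|].
rewrite /mul2 !act_lower /upper_unip /lower_unip /=; congr (pair (pair _ _) (pair _ _)); ring.
Qed.

Definition scaled_sol (k : nat) (l : Z) (a1 b1 a2 b2 a3 b3 : Z) : Prop :=
  [/\ k%:R * (1 + a2 * b2 - l * (1 + a1 * b3)) = 0,
      k%:R * (a2 + l * (a1 + a3 * (1 + a1 * b3))) = 0,
      k%:R * (b2 + b1 * (1 + a2 * b2) + l * b3) = 0 &
      k%:R * (1 + b1 * a2 - l * (1 + a3 * b3)) = 0].

Lemma lower_upper_lower (b1 a2 b2 : Z) :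
  mul2 (lower_unip b1) (mul2 (upper_unip a2) (lower_unip b2))
  = ((1 + a2 * b2, b2 + b1 * (1 + a2 * b2)), (a2, 1 + b1 * a2)).
Proof.
by rewrite /mul2 !act_upper !act_lower /lower_unip /fst /snd; congr (pair (pair _ _) (pair _ _)); ring.
Qed.

(** The entries are arranged as a multiple of m11 plus multiples of m21, m12 and D = m22 - m11, the
    three quantities killed by k when [scalar_mod k M] holds. *)
Lemma conj_entries (a1 a3 k' k1 m11 m12 m21 D : Z) :
  mul2 (upper_unip (- a1)) (mul2 (lower_unip (- k'))
    (mul2 ((m11, m12), (m21, m11 + D)) (mul2 (lower_unip k1) (upper_unip (- a3)))))
  = ((m11 * ((1 + a1 * k') * 1 + (- a1) * k1) + (m21 * ((1 + a1 * k') * k1) + m12 * ((- a1) * 1) + D * ((- a1) * k1)),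
      m11 * ((- k') * 1 + 1 * k1) + (m21 * ((- k') * k1) + m12 * (1 * 1) + D * (1 * k1))),
     (m11 * ((1 + a1 * k') * (- a3) + (- a1) * (1 - k1 * a3)) + (m21 * ((1 + a1 * k') * (1 - k1 * a3)) + m12 * ((- a1) * (- a3)) + D * ((- a1) * (1 - k1 * a3))),
      m11 * ((- k') * (- a3) + 1 * (1 - k1 * a3)) + (m21 * ((- k') * (1 - k1 * a3)) + m12 * (1 * (- a3)) + D * (1 * (1 - k1 * a3))))).
Proof.
rewrite /mul2 !act_upper !act_lower /upper_unip /act2 /fst /snd.
by congr (pair (pair _ _) (pair _ _)); ring.
Qed.

Lemma scaled_sol_conj (k : nat) (M : mat2 n) (a1 b1 a2 b2 a3 k' k1 : Z) : scalar_mod k M ->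
  mul2 (lower_unip b1) (mul2 (upper_unip a2) (lower_unip b2))
  = mul2 (upper_unip (- a1)) (mul2 (lower_unip (- k')) (mul2 M (mul2 (lower_unip k1) (upper_unip (- a3))))) ->
  scaled_sol k M.1.1 a1 b1 a2 b2 a3 (k' - k1).
Proof.
case: M => [[m11 m12] [m21 m22]] /and3P[/= /eqP s12 /eqP s21 /eqP s22].
pose D := m22 - m11.
have M22 : m22 = m11 + D by rewrite /D addrC subrK.
have KD : k%:R * D = 0 by rewrite mulrBr s22 subrr.
rewrite lower_upper_lower {1}M22 conj_entries => E.
have e11 := congr1 (fun M : mat2 n => M.1.1) E; have e12 := congr1 (fun M : mat2 n => M.1.2) E.
have e21 := congr1 (fun M : mat2 n => M.2.1) E; have e22 := congr1 (fun M : mat2 n => M.2.2) E.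
move: e11 e12 e21 e22; rewrite /fst /snd {E} => e11 e12 e21 e22; rewrite /scaled_sol.
move: s12 s21 KD; set K := k%:R; clearbody K D => s12 s21 KD; split.
- rewrite e11; transitivity ((K * m21) * ((1 + a1 * k') * k1) + (K * m12) * ((- a1) * 1) + (K * D) * ((- a1) * k1)); first ring.
  by rewrite s12 s21 KD !mul0r !addr0.
- transitivity (K * a2 - K * (m11 * ((1 + a1 * k') * (- a3) + (- a1) * (1 - k1 * a3)))); first ring.
  rewrite e21; transitivity ((K * m21) * ((1 + a1 * k') * (1 - k1 * a3)) + (K * m12) * ((- a1) * (- a3)) + (K * D) * ((- a1) * (1 - k1 * a3))); first ring.
  by rewrite s12 s21 KD !mul0r !addr0.
- transitivity (K * (b2 + b1 * (1 + a2 * b2)) - K * (m11 * ((- k') * 1 + 1 * k1))); first ring.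
  rewrite e12; transitivity ((K * m21) * ((- k') * k1) + (K * m12) * (1 * 1) + (K * D) * (1 * k1)); first ring.
  by rewrite s12 s21 KD !mul0r !addr0.
- rewrite e22; transitivity ((K * m21) * ((- k') * (1 - k1 * a3)) + (K * m12) * (1 * (- a3)) + (K * D) * (1 * (1 - k1 * a3))); first ring.
  by rewrite s12 s21 KD !mul0r !addr0.
Qed.

Lemma scalar_mod_sol (k : nat) (t : J * J) : scalar_mod k (wmat t) ->
  scaled_sol k (wmat t).1.1 (bv t.2.1.1.1 t.2.1.2.1)%:~R (bv t.2.1.2.2 t.2.2.2)%:~R
   (bv t.2.2.1 t.1.2.1)%:~R (bv t.1.2.2 t.1.1.2.2)%:~R (bv t.1.1.2.1 t.1.1.1.1)%:~R
   (bv t.1.1.1.2 t.2.1.1.2)%:~R.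
Proof.
move=> s; rewrite [(bv t.1.1.1.2 _)%:~R]boxval_intr.
by apply: scaled_sol_conj (wmat_conj t).
Qed.

End UnipotentWords.

Section WordPairs.
Variables (n H D : nat).
Let c := n.+2.
Let Z := 'I_n.+2.
Hypotheses (H0 : (0 < H)%N) (Hc : (H ^ 2 <= c)%N).
Hypothesis hD : forall v, (0 < v <= c)%N -> (ndiv v <= D)%N.

Let J := (('I_H * 'I_H) * ('I_H * 'I_H) * ('I_H * 'I_H))%type.
Let wmat (t : J * J) : mat2 n :=
  mul2 (adj2 (word_mat (@shift_mat n H) t.2)) (word_mat (@shift_mat n H) t.1).

(** Two kinds of data are frozen first: the scalar l modulo p, which satisfies l^2 = 1 because the
    determinant is 1, with at most 2 D^2 values; and one endpoint of each of the six differences,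
    with H^6 values. The other six parameters are counted by [word_count]. *)
Lemma card_scalar_words (p : nat) : (p %| c)%N ->
  (p ^ 3 * #|[set t : J * J | scalar_mod (c %/ p) (wmat t)]|
   <= (D ^ 2 * 2 * H ^ 6) * (16 * D ^ 3 * H ^ 2 * (H + p) ^ 2 * (H ^ 2 * 2 + p)))%N.
Proof.
move=> pc; have p0 : (0 < p)%N by apply: dvdn_gt0 pc.
have Dp : (ndiv p <= D)%N by apply: hD; rewrite p0 dvdn_leq.
have cE : c = (p * (c %/ p))%N by rewrite mulnC divnK.
set K := (c %/ p)%N in cE *.
pose sq := [set s : 'I_p | (p %| (s + (p - 1)) * (s + 1))%N].
have csq : (#|sq| <= D ^ 2 * 2)%N.
  by apply: (leq_trans (card_sqrt1 p0)); rewrite leq_mul2r leq_exp2r.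
have ltl (t : J * J) : ((wmat t).1.1 %% p < p)%N by rewrite ltn_pmod.
pose O := ('I_H * 'I_H * 'I_H * 'I_H * 'I_H * 'I_H)%type.
pose f (t : J * J) : 'I_p * O := (Ordinal (ltl t),
  (t.2.1.1.1, t.2.1.2.2, t.2.2.1, t.1.2.2, t.1.1.2.1, t.1.1.1.2)).
set A := [set t | _].
have Kp : K%:R * p%:R = 0 :> Z.
  by apply/eqP; rewrite -natrM mulnC -cE Znat_eq0.
have mod_l t : K%:R * (wmat t).1.1 = K%:R * ((f t).1 : nat)%:R.
  have -> : (wmat t).1.1 = ((wmat t).1.1 %/ p * p)%N%:R + ((f t).1 : nat)%:R.
    by rewrite -natrD -[LHS]natr_Zp /= -divn_eq.
  by rewrite mulrDr natrM mulrCA Kp mulr0 add0r.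
have fB t : t \in A -> f t \in setX sq [set: O].
  rewrite inE => /and3P[/eqP s12 /eqP s21 /eqP s22]; rewrite !inE andbT.
  rewrite -(ann_nat cE) natrM !natrD natrB //; apply/eqP.
  have := mod_l t; set l := ((f t).1 : nat)%:R => El.
  have dM : (wmat t).1.1 * (wmat t).2.2 - (wmat t).1.2 * (wmat t).2.1 = 1 := @det2_wmat n H t.
  have -> : K%:R * ((l + (p%:R - 1%:R)) * (l + 1%:R)) = l * (K%:R * l) - K%:R + (K%:R * p%:R) * (l + 1) :> Z by ring.
  rewrite Kp mul0r addr0 -El.
  apply/eqP; rewrite subr_eq0; apply/eqP.
  have -> : l * (K%:R * (wmat t).1.1) = (K%:R * l) * (wmat t).1.1 by ring.
  rewrite -El; have -> : K%:R * (wmat t).1.1 * (wmat t).1.1 = (wmat t).1.1 * (K%:R * (wmat t).1.1) by ring.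
  rewrite s22; have -> : (wmat t).1.1 * (K%:R * (wmat t).2.2) = K%:R *
    ((wmat t).1.1 * (wmat t).2.2 - (wmat t).1.2 * (wmat t).2.1) + (K%:R * (wmat t).1.2) * (wmat t).2.1 by ring.
  by rewrite dM s12 mul0r addr0 mulr1.
have cB : (#|setX sq [set: O]| <= D ^ 2 * 2 * H ^ 6)%N.
  rewrite cardsX cardsT !card_prod !card_ord; apply: leq_mul => //.
  by rewrite !expnS expn0 !muln1 !mulnA.
apply: (leq_trans _ (leq_mul cB (leqnn _))).
apply: (@card_fibers_weighted _ _ f) => // -[l [[[[[h1' k2'] h3'] k3] h2] k1]].
rewrite !inE andbT => lsq; set F := [set x in A | _].
have l_sq : (p %| l * l + (p - 1))%N.
  have : (p %| (l + (p - 1)) * (l + 1) - 0)%N by rewrite subn0.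
  rewrite subn0; have -> : ((l + (p - 1)) * (l + 1) = (l * l + (p - 1)) + l * p)%N.
    by clear -p0; nia.
  by rewrite dvdn_addl // dvdn_mull.
have lcop : coprimez (l : nat)%:Z p%:Z.
  rewrite coprimezE /= /coprime -dvdn1; set g := gcdn l p.
  have g1 : (g %| l * l + (p - 1))%N by apply: dvdn_trans l_sq; rewrite dvdn_gcdr.
  have g2 : (g %| p - 1)%N by rewrite -(@dvdn_addr (l * l)) // dvdn_mulr // dvdn_gcdl.
  by rewrite -(@dvdn_addr (p - 1)) // subnK // dvdn_gcdr.
pose W := word_sol H p (l : nat)%:Z h1' k2' h3' k3 h2 k1.
apply: (@leq_trans (p ^ 3 * #|W|)); last first.
  apply: word_count => //; try exact: ltn_ord.
  by move=> v /andP[v0 v1]; apply: hD; rewrite v0 (leq_trans v1).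
rewrite leq_mul2l; apply/orP; right.
pose h (t : J * J) := (((t.2.1.2.1, t.2.1.1.2), (t.1.2.1, t.1.1.2.2)), (t.1.1.1.1, t.2.2.2)).
have hinj : {in F &, injective h}.
  move=> [[[[a1 a2] [a3 a4]] [a5 a6]] [[[b1 b2] [b3 b4]] [b5 b6]]]
    [[[[x1 x2] [x3 x4]] [x5 x6]] [[[y1 y2] [y3 y4]] [y5 y6]]].
  rewrite !inE /f /h => /andP[_ /eqP E1] /andP[_ /eqP E2] E3.
  have := congr1 snd E1; have := congr1 snd E2; move: E3 => /=.
  by do 3 (case; do 6 move=> ->).
rewrite -(card_in_imset hinj); apply/subset_leq_card/subsetP => _ /imsetP[t tF ->].
move: tF; rewrite [_ \in F]inE => /andP[tA /eqP Ef].
have := tA; rewrite inE => /(@scalar_mod_sol n H) [].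
have EO := congr1 snd Ef; have El := congr1 (fun x : 'I_p * O => x.1 : nat) Ef.
have ml := mod_l t; rewrite [nat_of_ord _]El in ml.
move: (wmat t).1.1 ml => m ml.
have sub (x y : Z) : K%:R * (x + m * y) = K%:R * (x + (l : nat)%:R * y).
  by rewrite !mulrDr !mulrA ml.
rewrite {}/W; case: EO => <- <- <- <- <- <-.
rewrite inE => c1 c2 c3 c4; apply/and4P; move: c1 c2 c3 c4.
rewrite /word_eq11 /word_eq21 /word_eq12 /word_eq22 /=.
move: (boxval t.2.1.1.1 t.2.1.2.1) (boxval t.2.1.2.2 t.2.2.2) (boxval t.2.2.1 t.1.2.1)
  (boxval t.1.2.2 t.1.1.2.2) (boxval t.1.1.2.1 t.1.1.1.1) (boxval t.1.1.1.2 t.2.1.1.2).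
move=> a1 b1 a2 b2 a3 b3 c1 c2 c3 c4.
split; rewrite -(ann_int cE) /= !(intrD, intrM, intrN, intrB) -[1%:~R]/1 -[(l : nat)%:~R]pmulrn; apply/eqP.
- transitivity (K%:R * ((1 + a2%:~R * b2%:~R) + (l : nat)%:R * - (1 + a1%:~R * b3%:~R)) : Z); first ring.
  by rewrite -sub mulrN.
- by rewrite -sub.
- by rewrite -sub.
- transitivity (K%:R * ((1 + b1%:~R * a2%:~R) + (l : nat)%:R * - (1 + a3%:~R * b3%:~R)) : Z); first ring.
  by rewrite -sub mulrN.
Qed.

End WordPairs.

Section Amplified.
Variables (n H D r q : nat).
Let c := n.+2.
Let Z := 'I_n.+2.
Hypotheses (Hc : (H ^ 2 <= c)%N) (cH : (c <= 4 * H ^ 2)%N) (cE : c = (r * q)%N).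
Hypothesis hD : forall v, (0 < v <= c)%N -> (ndiv v <= D)%N.

Let H0 : (0 < H)%N.
Proof. by case: (H) cH. Qed.

Let r0 : (0 < r)%N.
Proof. by case: (r) cE. Qed.

Let q0 : (0 < q)%N.
Proof. by case: (q) cE => //; rewrite muln0. Qed.

Let Dc : (ndiv c <= D)%N.
Proof. by apply: hD; rewrite leqnn. Qed.

Let D0 : (0 < D)%N.
Proof. exact: leq_trans (ndiv_gt0 (ltn0Sn n.+1)) Dc. Qed.

Lemma near_pairs_bound :
  (near_pairs (@shift_mat n H) (q%:R : Z) <= 3072 * D ^ 8 * sqrtdiv q * (q * (q + r)) * H ^ 12)%N.
Proof.
pose J := (('I_H * 'I_H) * ('I_H * 'I_H) * ('I_H * 'I_H))%type.
pose wmat (t : J * J) : mat2 n :=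
  mul2 (adj2 (word_mat (@shift_mat n H) t.2)) (word_mat (@shift_mat n H) t.1).
pose N p := #|[set t : J * J | scalar_mod (c %/ p) (wmat t)]|.
have h1 : (near_pairs (@shift_mat n H) (q%:R : Z)
   <= c ^ 2 * (D ^ 2 * sqrtdiv q) * \sum_(p <- divisors c | r %| p) p * N p)%N.
  apply: (@leq_trans (\sum_(t : J * J) c ^ 2 * (D ^ 2 * sqrtdiv q) *
     \sum_(p <- divisors c | (r %| p)%N && scalar_mod (c %/ p) (wmat t)) p)%N).
    rewrite /near_pairs [leqRHS]big_pair; apply: leq_sum => j _; apply: leq_sum => j' _.
    apply: (leq_trans (card_near_unipotent _ cE)).
    by rewrite leq_mul // leq_mul // leq_mul // leq_exp2r.
  rewrite -big_distrr /= leq_mul2l; apply/orP; right; apply: eq_leq.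
  under eq_bigr do rewrite big_mkcondr.
  rewrite exchange_big /=; apply: eq_bigr => p _.
  by rewrite -big_mkcond sum_nat_const mulnC /N; congr (_ * _)%N; apply: eq_card => t; rewrite inE.
apply: (leq_trans h1); set s := sqrtdiv q.
have step p : (p %| c)%N -> (r %| p)%N -> (c ^ 2 * (p * N p) <= 3072 * D ^ 5 * (q * (q + r)) * H ^ 12)%N.
  move=> pc rp; have p0 : (0 < p)%N by apply: dvdn_gt0 pc.
  have p20 : (0 < p ^ 2)%N by rewrite expn_gt0 p0.
  have plec : (p <= c)%N by apply: dvdn_leq.
  have hN := card_scalar_words H0 Hc hD pc; rewrite -/(N p) in hN.
  rewrite -(leq_pmul2l p20).
  have -> : (p ^ 2 * (c ^ 2 * (p * N p)) = c ^ 2 * (p ^ 3 * N p))%N by ring.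
  have c2 : (c ^ 2 <= 16 * H ^ 4)%N.
    have -> : (16 * H ^ 4 = (4 * H ^ 2) ^ 2)%N by ring.
    by rewrite leq_exp2r.
  apply: (leq_trans (leq_mul c2 hN)).
  have hp : ((H + p) ^ 2 <= 2 * (c + p ^ 2))%N.
    apply: (@leq_trans (2 * (H ^ 2 + p ^ 2))%N); last by rewrite leq_mul2l leq_add2r Hc.
    have := (nat_Cauchy H p).1; rewrite sqrnD -!mulnn; clear; lia.
  have h3 : (H ^ 2 * 2 + p <= 3 * c)%N by clear -Hc plec; lia.
  (* This holds for every multiple p of r, with the factor p^2 that turns p^3 N(p) back into p N(p);
     the remaining bound q (q + r) does not depend on p. *)
  have h4 : ((H + p) ^ 2 * (H ^ 2 * 2 + p) <= 6 * (p ^ 2 * (q * (q + r))))%N.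
    apply: (leq_trans (leq_mul hp h3)).
    have -> : (2 * (c + p ^ 2) * (3 * c) = 6 * (c * (c + p ^ 2)))%N by ring.
    rewrite leq_mul2l /=; have [p' Ep] := dvdnP rp.
    have p'0 : (0 < p')%N by case: (p') Ep p0 => // ->.
    rewrite cE Ep.
    have -> : (r * q * (r * q + (p' * r) ^ 2) = r ^ 2 * q * (q + p' ^ 2 * r))%N by ring.
    have -> : ((p' * r) ^ 2 * (q * (q + r)) = r ^ 2 * q * (p' ^ 2 * q + p' ^ 2 * r))%N by ring.
    by rewrite leq_mul2l leq_add2r leq_pmull ?orbT // expn_gt0 p'0.
  (* 512 = 16 * 2 * 16, the first 16 coming from c^2 <= 16 H^4; the factor 6 of [h4] then gives
     3072. *)
  have -> : (16 * H ^ 4 * (D ^ 2 * 2 * H ^ 6 * (16 * D ^ 3 * H ^ 2 * (H + p) ^ 2 * (H ^ 2 * 2 + p)))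
    = 512 * D ^ 5 * H ^ 12 * ((H + p) ^ 2 * (H ^ 2 * 2 + p)))%N by ring.
  by apply: (leq_trans (leq_mul (leqnn _) h4)); apply: eq_leq; ring.
have -> : (c ^ 2 * (D ^ 2 * s) * \sum_(p <- divisors c | r %| p) p * N p
   = D ^ 2 * s * \sum_(p <- divisors c | r %| p) c ^ 2 * (p * N p))%N.
  by rewrite -big_distrr /=; ring.
apply: (@leq_trans (D ^ 2 * s * (ndiv c * (3072 * D ^ 5 * (q * (q + r)) * H ^ 12)))%N).
  rewrite leq_mul2l; apply/orP; right; rewrite big_mkcond.
  apply: leq_sum_dvd_const => // p pc; case: ifP => // rp; exact: step.
apply: (@leq_trans (D ^ 2 * s * (D * (3072 * D ^ 5 * (q * (q + r)) * H ^ 12)))%N).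
  by rewrite leq_mul2l leq_mul2r Dc !orbT.
by apply: eq_leq; ring.
Qed.

Variable C : numClosedFieldType.
Variables (w : 'I_H * 'I_H -> C) (phi : Z * Z -> C) (L : nat).
Hypothesis hw : forall i, `|w i| <= (H ^ 2)%:R^-1.
Hypothesis hphi : forall a x, a \is a GRing.unit -> phi (a * x.1, a * x.2) = phi x.
Hypothesis orth : forall t t' : 'I_L, t != t' -> forall v : Z * Z,
  \sum_(x : Z * Z) phi (v.1 + q%:R * ((t : nat)%:R - (t' : nat)%:R) * x.1,
                        v.2 + q%:R * ((t : nat)%:R - (t' : nat)%:R) * x.2) = 0.

Lemma sl2_norm_le_vec : sl2_norm phi <= c%:R * vec_norm phi.
Proof.
rewrite /sl2_norm (eq_bigl (fun y : mat2 n => (wedge y.1 y.2 == 1))) //.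
rewrite -(pair_big_dep xpredT (fun v w : Z * Z => wedge v w == 1) (fun v _ => `|phi v| ^+ 2)) /=.
rewrite /vec_norm big_distrr /=; apply: ler_sum => v _.
rewrite sumr_const -[leLHS]mulr_natl; apply: ler_wpM2r; first by rewrite exprn_ge0.
rewrite ler_nat; apply: (leq_trans _ (card_SL2_fst v)); apply: eq_leq; apply: eq_card => x.
by rewrite !inE.
Qed.

Lemma amplification :
  L%:R * sl2_norm (avg_op (@shift_mat n H) w phi) ^+ 3
  <= (2 * 3072 * D ^ 12 * (r * (sqrtdiv q * (q + r))) * c ^ 2)%:R * vec_norm phi ^+ 3.
Proof.
have hks (d : Z) : (#|[set s : Z | (s \is a GRing.unit) && (s * s == d)%R]| <= D ^ 2 * 2)%N.
  by apply: (leq_trans (card_Zsqrt d)); rewrite leq_mul2r leq_exp2r.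
have om0 : (0 : C) <= (H ^ 2)%:R^-1 by rewrite invr_ge0 ler0n.
have Hs h : h \in congr_units n q -> [/\ h.1 \is a GRing.unit, q%:R * h.1 = q%:R & q%:R * h.2 = 0].
  by rewrite inE => /and3P[? /eqP ? /eqP ?].
have HS := amplification_HS (@det2_shift n H) om0 hw hphi orth hks Hs.
set T := avg_op (@shift_mat n H) w in HS *; set m3 := sl2_norm _ in HS.
set N := vec_norm phi in HS *.
have N0 : 0 <= N by apply: vec_norm_ge0.
have m30 : 0 <= m3 by apply: sl2_norm_ge0.
(* The exponent 12 of D is 2 + 2 + 8: c <= phi(c) D used twice, the number of square roots, and the
   near pairs. *)
have hm3 : L%:R * m3 <= (2 * 3072 * D ^ 12 * (r * (sqrtdiv q * (q + r))))%:R * N.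
  have chs := card_congr_units cE.
  have ctot := leq_totient_ndiv (ltn0Sn n.+1).
  have ctot' : (c <= totient c * D)%N by apply: leq_trans ctot _; rewrite leq_mul2l Dc orbT.
  have e1 : (c ^ 2 * q <= D ^ 2 * r * (#|congr_units n q| * #|[set s : Z | s \is a GRing.unit]|))%N.
    rewrite card_Zunits; apply: (@leq_trans ((totient c * D) * (totient c * D) * q)%N).
      by rewrite leq_mul2r -mulnn leq_mul ?orbT.
    have -> : (totient c * D * (totient c * D) * q = D ^ 2 * totient c * (totient c * q))%N by ring.
    apply: (leq_trans (leq_mul (leqnn _) chs)); apply: eq_leq; rewrite /c; ring.
  have c2q : (0 : C) < (c ^ 2 * q)%:R by rewrite ltr0n muln_gt0 q0 expn_gt0.
  rewrite -(ler_pM2l c2q).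
  apply: (@le_trans _ _ ((D ^ 2 * r * (#|congr_units n q| * #|[set s : Z | s \is a GRing.unit]|))%:R * (L%:R * m3))).
    by apply: ler_wpM2r; [rewrite mulr_ge0 ?ler0n | rewrite ler_nat].
  have -> : (D ^ 2 * r * (#|congr_units n q| * #|[set s : Z | s \is a GRing.unit]|))%:R * (L%:R * m3)
     = (D ^ 2 * r)%:R * (L%:R * #|congr_units n q|%:R * #|[set s : Z | s \is a GRing.unit]|%:R * m3) :> C.
    by rewrite !natrM; ring.
  apply: (le_trans (ler_wpM2l (ler0n _ _) HS)).
  have np : (H ^ 2)%:R^-1 ^+ 6 * (near_pairs (@shift_mat n H) (q%:R : Z))%:R
     <= (3072 * D ^ 8 * sqrtdiv q * (q * (q + r)))%:R :> C.
    rewrite exprVn -natrX -expnM mulrC ler_pdivrMr ?ltr0n ?expn_gt0 ?H0 //.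
    by rewrite -natrM ler_nat near_pairs_bound.
  have -> : (D ^ 2 * r)%:R * ((D ^ 2 * 2)%:R * ((c ^ 2)%:R * N) * (H ^ 2)%:R^-1 ^+ 6 *
      (near_pairs (@shift_mat n H) (q%:R : Z))%:R)
    = ((D ^ 2 * r)%:R * (D ^ 2 * 2)%:R * (c ^ 2)%:R * N)
      * ((H ^ 2)%:R^-1 ^+ 6 * (near_pairs (@shift_mat n H) (q%:R : Z))%:R) :> C by ring.
  apply: (le_trans (ler_wpM2l _ np)); first by rewrite !mulr_ge0 ?ler0n.
  rewrite [leLHS](_ : _ = (c ^ 2 * q)%:R * ((2 * 3072 * D ^ 12 * (r * (sqrtdiv q * (q + r))))%:R * N)) //.
  ring.
have chain := @sl2_norm_chain C n _ (@shift_mat n H) w (@det2_shift n H) phi; rewrite -/T -/m3 in chain.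
apply: (le_trans (ler_wpM2l (ler0n _ _) chain)).
have N1 := sl2_norm_le_vec.
have -> : (2 * 3072 * D ^ 12 * (r * (sqrtdiv q * (q + r))) * c ^ 2)%:R * N ^+ 3
  = ((2 * 3072 * D ^ 12 * (r * (sqrtdiv q * (q + r))))%:R * N) * (c%:R * N) ^+ 2.
  ring.
rewrite mulrA; apply: ler_pM => //.
- by rewrite mulr_ge0 ?ler0n.
- by rewrite exprn_ge0 // sl2_norm_ge0.
- by rewrite ler_pXn2r ?nnegrE ?mulr_ge0 ?ler0n // sl2_norm_ge0.
Qed.

End Amplified.

(** * The bilinear form with Kloosterman sums *)

Section LatticeAverage.
Variables (C : numClosedFieldType) (n : nat).
Let c := n.+2.
Let Z := 'I_n.+2.
Let V := (Z * Z)%type.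

(** The orthogonal projection onto the functions invariant under translation by z V. *)
Definition lattice_avg (z : Z) (f : V -> C) (v : V) : C :=
  (c ^ 2)%:R^-1 * \sum_(w : V) f (v.1 + z * w.1, v.2 + z * w.2).

Lemma eq_lattice_avg z (f f' : V -> C) : f =1 f' -> lattice_avg z f =1 lattice_avg z f'.
Proof. by move=> e v; congr (_ * _); apply: eq_bigr => w _; rewrite e. Qed.

Lemma lattice_avgB z (f f' : V -> C) v :
  lattice_avg z (fun v => f v - f' v) v = lattice_avg z f v - lattice_avg z f' v.
Proof. by rewrite /lattice_avg sumrB mulrBr. Qed.

Lemma lattice_avgC z z' (f : V -> C) v :
  lattice_avg z (lattice_avg z' f) v = lattice_avg z' (lattice_avg z f) v.
Proof.
rewrite /lattice_avg; congr (_ * _).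
rewrite -!big_distrr /=; congr (_ * _); rewrite exchange_big /=.
by apply: eq_bigr => w _; apply: eq_bigr => w' _; congr (f (_, _)); ring.
Qed.

Lemma lattice_avg_idem z (f : V -> C) v :
  lattice_avg z (lattice_avg z f) v = lattice_avg z f v.
Proof.
rewrite {1}/lattice_avg.
have e (w : V) : lattice_avg z f (v.1 + z * w.1, v.2 + z * w.2) = lattice_avg z f v.
  rewrite /lattice_avg /=; congr (_ * _).
  rewrite [RHS](reindex (fun x : V => (w.1 + x.1, w.2 + x.2))) /=; last first.
    exists (fun x : V => (x.1 - w.1, x.2 - w.2)) => -[x1 x2] _ /=; congr pair; ring.
  by apply: eq_bigr => x _; congr (f (_, _)); ring.
rewrite (eq_bigr _ (fun w _ => e w)) sumr_const card_prod card_ord mulnn -[X in _ * X]mulr_natl.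
by rewrite mulrA mulVf ?mul1r // pnatr_eq0 expn_eq0.
Qed.

Lemma lattice_avg_adj z (f f' : V -> C) :
  \sum_v lattice_avg z f v * f' v = \sum_v f v * lattice_avg z f' v.
Proof.
under eq_bigr do rewrite /lattice_avg -mulrA big_distrl /=.
under [RHS]eq_bigr do rewrite /lattice_avg mulrCA big_distrr /=.
rewrite -!big_distrr /=; congr (_ * _).
rewrite exchange_big [RHS]exchange_big /=.
rewrite [RHS](reindex (fun x : V => (- x.1, - x.2))) /=; last first.
  by exists (fun x : V => (- x.1, - x.2)) => -[x1 x2] _ /=; rewrite !opprK.
apply: eq_bigr => w _.
rewrite [RHS](reindex (fun x : V => (x.1 + z * w.1, x.2 + z * w.2))) /=; last first.
  exists (fun x : V => (x.1 - z * w.1, x.2 - z * w.2)) => -[x1 x2] _ /=; congr pair; ring.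
apply: eq_bigr => x _; congr (_ * f' _).
by rewrite [LHS]surjective_pairing; congr pair; ring.
Qed.

Lemma lattice_avg_conj z (f : V -> C) v :
  lattice_avg z (fun v => (f v)^*) v = (lattice_avg z f v)^*.
Proof. by rewrite /lattice_avg rmorphM /= fmorphV rmorph_nat rmorph_sum. Qed.

Lemma vec_norm_lattice z (f : V -> C) :
  vec_norm (fun v => f v - lattice_avg z f v) <= vec_norm f.
Proof.
set P := lattice_avg z f.
have e1 : \sum_v P v * (P v)^* = \sum_v f v * (P v)^*.
  rewrite -(eq_bigr _ (fun v _ => congr1 (fun x => P v * x) (lattice_avg_conj z f v))).
  rewrite -lattice_avg_adj.
  rewrite (eq_bigr (fun v => P v * (f v)^*)); last by move=> v _; rewrite lattice_avg_idem.
  by rewrite lattice_avg_adj; apply: eq_bigr => v _; rewrite lattice_avg_conj.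
have e2 : \sum_v P v * (f v)^* = \sum_v f v * (P v)^*.
  by rewrite lattice_avg_adj; apply: eq_bigr => v _; rewrite lattice_avg_conj.
have -> : vec_norm f = vec_norm (fun v => f v - P v) + vec_norm P.
  have nE (h : V -> C) : vec_norm h = \sum_v h v * (h v)^*.
    by apply: eq_bigr => v _; rewrite normCK.
  have -> : vec_norm (fun v => f v - P v) = \sum_v f v * (f v)^* - \sum_v f v * (P v)^*
      - \sum_v P v * (f v)^* + \sum_v P v * (P v)^*.
    rewrite nE -!sumrB -big_split /=; apply: eq_bigr => v _; rewrite rmorphB /=; ring.
  rewrite !nE e1 e2; ring.
by rewrite lerDl vec_norm_ge0.
Qed.

(** A matrix of determinant 1 permutes V, so it maps the translations by z V to themselves. *)
Lemma lattice_avg_op (I : finType) (g : I -> mat2 n) (w : I -> C) z (f : V -> C) v :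
  (forall i, det2 (g i) = 1) ->
  avg_op g w (lattice_avg z f) v = lattice_avg z (avg_op g w f) v.
Proof.
move=> dg; rewrite /avg_op /lattice_avg.
rewrite exchange_big /= big_distrr /=; apply: eq_bigr => i _.
rewrite mulrCA -big_distrr /=; congr (_ * (_ * _)).
rewrite (reindex (act2 (g i))) /=; last first.
  by exists (act2 (adj2 (g i))) => x _; rewrite ?act2_adjK ?act2_Kadj.
by apply: eq_bigr => x _; congr f; rewrite /act2 /=; congr pair; ring.
Qed.

(* The averages along z = q (t - t') obstruct the orthogonality of the
   translates.  They vanish for the second factor of the pairing whenever they
   do not for the first, so they can be removed from the first factor. *)
Fixpoint proj_away (zs : seq Z) (f : V -> C) : V -> C :=
  if zs is z :: zs' then fun v => proj_away zs' f v - lattice_avg z (proj_away zs' f) v else f.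

Lemma proj_away_norm zs f : vec_norm (proj_away zs f) <= vec_norm f.
Proof.
elim: zs => //= z zs IH; apply: le_trans IH; exact: vec_norm_lattice.
Qed.

Lemma proj_away_scale zs (f : V -> C) :
  (forall a x, a \is a GRing.unit -> f (a * x.1, a * x.2) = f x) ->
  forall a x, a \is a GRing.unit -> proj_away zs f (a * x.1, a * x.2) = proj_away zs f x.
Proof.
move=> hf; elim: zs => [|z zs IH] a x ua /=; first exact: hf.
rewrite IH //; congr (_ - _ * _).
rewrite (reindex (fun w : V => (a * w.1, a * w.2))) /=; last first.
  by exists (fun w : V => (a^-1 * w.1, a^-1 * w.2)) => -[w1 w2] _ /=; rewrite !mulrA ?mulVr ?mulrV // !mul1r.
apply: eq_bigr => w _; rewrite -[RHS](IH a) //=.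
by congr (proj_away _ _ (_, _)); ring.
Qed.

Lemma proj_away_kernel zs z (f : V -> C) :
  (forall v, lattice_avg z f v = 0) -> forall v, lattice_avg z (proj_away zs f) v = 0.
Proof.
move=> hz; elim: zs => [|z' zs IH] v //=.
rewrite lattice_avgB IH lattice_avgC sub0r.
by rewrite (eq_lattice_avg _ IH) /lattice_avg big1 ?mulr0 ?oppr0.
Qed.

Lemma proj_away_mem zs z f : z \in zs -> forall v, lattice_avg z (proj_away zs f) v = 0.
Proof.
elim: zs => //= z' zs IH; rewrite inE => /orP[/eqP -> | zzs] v.
  by rewrite lattice_avgB lattice_avg_idem subrr.
rewrite lattice_avgB (IH zzs) lattice_avgC sub0r.
by rewrite (eq_lattice_avg _ (IH zzs)) /lattice_avg big1 ?mulr0 ?oppr0.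
Qed.

(** The projections are self-adjoint and commute with T, so each removed component pairs with a
    projection of f', which is 0. *)
Lemma proj_away_pair zs (I : finType) (g : I -> mat2 n) (w : I -> C) (f f' : V -> C) :
  (forall i, det2 (g i) = 1) ->
  (forall z, z \in zs -> forall v, lattice_avg z f' v = 0) ->
  \sum_v avg_op g w (proj_away zs f) v * f' v = \sum_v avg_op g w f v * f' v.
Proof.
move=> dg; elim: zs => //= z zs IH h.
rewrite -IH => [|z' z'zs]; last by apply: h; rewrite inE z'zs orbT.
have -> : \sum_v avg_op g w (fun v => proj_away zs f v - lattice_avg z (proj_away zs f) v) v * f' v
  = \sum_v avg_op g w (proj_away zs f) v * f' v
   - \sum_v avg_op g w (lattice_avg z (proj_away zs f)) v * f' v.
  rewrite -sumrB; apply: eq_bigr => v _; rewrite -mulrBl; congr (_ * _).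
  by rewrite /avg_op -sumrB; apply: eq_bigr => i _; rewrite mulrBr.
rewrite [X in _ - X](eq_bigr (fun v => lattice_avg z (avg_op g w (proj_away zs f)) v * f' v)); last first.
  by move=> v _; rewrite lattice_avg_op.
rewrite lattice_avg_adj [X in _ - X]big1 ?subr0 // => v _.
by rewrite h ?mulr0 // inE eqxx.
Qed.

End LatticeAverage.

Section BilinearForm.
Variables (C : numClosedFieldType) (n : nat).
Let c := n.+2.
Let Z := 'I_n.+2.
Let V := (Z * Z)%type.
Variable psi : Z -> C.
Hypotheses (psiD : forall x y, psi (x + y) = psi x * psi y)
  (psi_norm : forall x, `|psi x| = 1)
  (psi_orth : forall a, a != 0 -> \sum_x psi (a * x) = 0).

Definition kloos (m k : Z) : C := \sum_(x | x \is a GRing.unit) psi (m * x + k * x^-1).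

Let psi0 : psi 0 = 1.
Proof.
have h := psiD 0 0; rewrite addr0 in h.
have n0 : psi 0 != 0 by rewrite -normr_eq0 psi_norm oner_eq0.
by apply: (mulfI n0); rewrite -h mulr1.
Qed.

Let psiN x : psi (- x) = (psi x)^*.
Proof.
have n0 : psi x != 0 by rewrite -normr_eq0 psi_norm oner_eq0.
by apply: (mulfI n0); rewrite -psiD subrr psi0 -normCK psi_norm expr1n.
Qed.

(* The exponential polynomial with frequencies [m0 + i], as a function of the
   affine coordinate x/y, extended by 0 to the points with y not a unit. *)
Definition affine_poly (N m0 : nat) (a : 'I_N -> C) (v : V) : C :=
  if v.2 \is a GRing.unit then \sum_i a i * psi ((m0 + i)%:R * (v.1 * v.2^-1)) else 0.

Lemma affine_polyE N m0 (a : 'I_N -> C) x y : y \is a GRing.unit ->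
  affine_poly m0 a (x, y) = \sum_i a i * psi ((m0 + i)%:R * (x * y^-1)).
Proof. by rewrite /affine_poly /= => ->. Qed.

Lemma affine_poly_nonunit N m0 (a : 'I_N -> C) x y : y \isn't a GRing.unit ->
  affine_poly m0 a (x, y) = 0.
Proof. by rewrite /affine_poly /= => /negPf ->. Qed.

Definition swap (v : V) : V := (v.2, v.1).

Lemma affine_poly_scale N m0 (a : 'I_N -> C) s v : s \is a GRing.unit ->
  affine_poly m0 a (s * v.1, s * v.2) = affine_poly m0 a v.
Proof.
move=> us; rewrite /affine_poly /= unitrMr //; case: ifP => // uv.
apply: eq_bigr => i _; congr (_ * psi (_ * _)).
transitivity ((s * s^-1) * (v.1 * v.2^-1)); first by rewrite invrM //; ring.
by rewrite mulrV // mul1r.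
Qed.

(** Plancherel in x for each unit y; N <= c keeps the frequencies distinct modulo c. *)
Lemma vec_norm_affine N m0 (a : 'I_N -> C) : (N <= c)%N ->
  vec_norm (affine_poly m0 a) = (totient c * c)%:R * \sum_i `|a i| ^+ 2.
Proof.
move=> Nc; rewrite /vec_norm big_pair exchange_big /=.
rewrite (bigID (fun y : Z => y \is a GRing.unit)) /= [X in _ + X]big1 ?addr0; last first.
  by move=> y /negPf uy; rewrite big1 // => x _; rewrite /affine_poly /= uy normr0 expr0n.
rewrite (eq_bigr (fun _ => c%:R * \sum_i `|a i| ^+ 2)); last first.
  move=> y uy.
  rewrite (reindex (fun x => x * y)) /=; last first.
    by exists (fun x => x * y^-1) => x _; rewrite -mulrA ?mulrV ?mulVr // mulr1.
  rewrite (eq_bigr (fun x => \sum_i \sum_j a i * (a j)^* * psi (((m0 + i)%:R - (m0 + j)%:R) * x))).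
    rewrite exchange_big /= big_distrr /=; apply: eq_bigr => i _.
    rewrite exchange_big /= (bigD1 i) //= [X in _ + X]big1 ?addr0.
      under eq_bigr do rewrite subrr mul0r psi0 mulr1.
      by rewrite sumr_const card_ord -normCK mulr_natl.
    move=> j ji; rewrite -big_distrr /= psi_orth ?mulr0 //.
    apply: contra_neq ji => /eqP; rewrite subr_eq0 => /eqP e; apply: val_inj => /=.
    have : ((m0 + i)%:R - (m0 + j)%:R : Z) == 0 by rewrite e subrr.
    rewrite !natrD opprD addrACA subrr add0r subr_eq0 => /eqP/(congr1 val) /=.
    rewrite !Zval_nat !modn_small //; exact: leq_trans (ltn_ord _) Nc.
  move=> x _; rewrite /affine_poly /= uy -mulrA mulrV // mulr1 normCK rmorph_sum big_distrlr /=.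
  apply: eq_bigr => i _; apply: eq_bigr => j _.
  by rewrite rmorphM /= -psiN mulrBl psiD; ring.
rewrite big_const iter_addr addr0.
have -> : #|[pred y : Z | y \is a GRing.unit]| = totient c.
  by rewrite -card_Zunits; apply: eq_card => y; rewrite !inE.
by rewrite natrM -mulrA [RHS]mulr_natl.
Qed.

Lemma vec_norm_swap (f : V -> C) : vec_norm (fun v => f (swap v)) = vec_norm f.
Proof.
rewrite /vec_norm [RHS](reindex swap) //=.
by exists swap => -[].
Qed.

(** For a fixed second coordinate, the first one runs over a coset of z Z, on which the frequency m0
    + i is a nontrivial character unless (m0 + i) z = 0. *)
Lemma avg_affine_eq0 N m0 (a : 'I_N -> C) z v :
  (forall i, a i != 0 -> (m0 + i)%:R * z != 0 :> Z) -> lattice_avg z (affine_poly m0 a) v = 0.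
Proof.
move=> h; rewrite /lattice_avg big_pair exchange_big big1 ?mulr0 //= => w2 _.
case: (boolP (v.2 + z * w2 \is a GRing.unit)) => uy; last first.
  by rewrite big1 // => x _; rewrite affine_poly_nonunit.
under eq_bigr do rewrite affine_polyE //.
rewrite exchange_big /=; apply: big1 => i _; rewrite -big_distrr /=.
case: (eqVneq (a i) 0) => [->|ai]; first by rewrite mul0r.
set y := (_ + _)^-1.
rewrite (eq_bigr (fun x => psi ((m0 + i)%:R * v.1 * y) * psi (((m0 + i)%:R * z * y) * x))); last first.
  by move=> x _; rewrite -psiD; congr psi; ring.
rewrite -big_distrr /= psi_orth ?mulr0 //.
apply: contra (h i ai) => /eqP e; apply/eqP.
have uy' : y \is a GRing.unit by rewrite unitrV.
by apply: (mulIr uy'); rewrite mul0r.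
Qed.

Lemma avg_swap z (f : V -> C) v :
  lattice_avg z (fun v => f (swap v)) v = lattice_avg z f (swap v).
Proof.
rewrite /lattice_avg; congr (_ * _); rewrite [RHS](reindex swap) //=.
by exists swap => -[].
Qed.

Variables (H : nat) (H0 : (0 < H)%N).

(* Averaging over the shifts multiplies the coefficient of frequency m0 + i by
   [kernel_sum i], which stays away from 0 as long as 8 i H <= c. *)
Definition kernel_sum (i : nat) : C := H%:R^-1 * \sum_(h < H) psi ((i * h)%:R).

(** The phases cancel the base frequencies m0 and n0, so that only the small offsets i and j are
    left in [kernel_sum]. *)
Definition shift_weight (m0 n0 : nat) (i : 'I_H * 'I_H) : C :=
  (H%:R^-1 * psi (- (m0 * i.1)%:R)) * (H%:R^-1 * psi (- (n0 * i.2)%:R)).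

Lemma shift_weight_norm m0 n0 i : `|shift_weight m0 n0 i| <= (H ^ 2)%:R^-1.
Proof.
rewrite /shift_weight !normrM !psi_norm !mulr1 normfV normr_nat.
by rewrite -mulnn natrM invfM.
Qed.

Lemma kernel_expand N m0 (a : 'I_N -> C) (x y : Z) :
  \sum_(h < H) H%:R^-1 * psi (- (m0 * h)%:R) * affine_poly m0 a (x + h%:R * y, y)
  = affine_poly m0 (fun i => a i * kernel_sum i) (x, y).
Proof.
case: (boolP (y \is a GRing.unit)) => uy; last first.
  by rewrite affine_poly_nonunit // big1 // => h _; rewrite affine_poly_nonunit ?mulr0.
rewrite affine_polyE //; under eq_bigr do rewrite affine_polyE // big_distrr /=.
rewrite exchange_big /=; apply: eq_bigr => i _.
rewrite /kernel_sum big_distrr /= big_distrr /= big_distrl /=; apply: eq_bigr => h _.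
transitivity (a i * H%:R^-1 * (psi (- (m0 * h)%:R) * psi ((m0 + i)%:R * ((x + h%:R * y) * y^-1)))).
  ring.
rewrite -psiD.
have -> : - (m0 * h)%:R + (m0 + i)%:R * ((x + h%:R * y) * y^-1)
   = (m0 + i)%:R * (x * y^-1) + (i * h)%:R + ((m0 + i)%:R * h%:R) * (y * y^-1 - 1) :> Z.
  by rewrite !natrM !natrD; ring.
by rewrite mulrV // subrr mulr0 addr0 psiD; ring.
Qed.

Lemma pair_expand N1 N2 m0 n0 (a : 'I_N1 -> C) (b : 'I_N2 -> C) :
  \sum_(v : V) avg_op (@shift_mat n H) (shift_weight m0 n0) (affine_poly m0 a) v
     * affine_poly n0 b (swap v)
  = \sum_(v : V) affine_poly m0 (fun i => a i * kernel_sum i) v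
     * affine_poly n0 (fun j => b j * kernel_sum j) (swap v).
Proof.
transitivity (\sum_(h < H) \sum_(k < H) \sum_(v : V) shift_weight m0 n0 (h, k)
   * affine_poly m0 a (v.1 + h%:R * v.2, v.2) * affine_poly n0 b (k%:R * v.1 + v.2, v.1)).
  rewrite /avg_op; under eq_bigr do rewrite big_distrl big_pair /=.
  rewrite exchange_big /=; apply: eq_bigr => h _.
  rewrite exchange_big /=; apply: eq_bigr => k _.
  (* This change of variable moves the lower unipotent to the second factor, where it shifts the
     inverse ratio by k. *)
  rewrite (reindex (act2 (lower_unip k%:R))) /=; last first.
    have d1 : det2 (@lower_unip n k%:R) = 1 by rewrite /det2 /wedge /= mulr1 mulr0 subr0.
    by exists (act2 (adj2 (lower_unip k%:R))) => x _; rewrite ?act2_adjK ?act2_Kadj.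
  apply: eq_bigr => v _; rewrite /shift_mat act2_mul /= act_upper !act_lower /swap /=.
  by congr (_ * affine_poly _ _ (_, _) * _); ring.
rewrite exchange_big /=.
under eq_bigr do rewrite exchange_big /=.
rewrite exchange_big /=; apply: eq_bigr => -[x y] _ /=.
rewrite /swap /= -!kernel_expand big_distrlr [RHS]exchange_big /=.
apply: eq_bigr => k _; apply: eq_bigr => h _.
by rewrite /shift_weight /= [k%:R * x + y]addrC; ring.
Qed.

(** Both factors depend only on the ratio of the coordinates and vanish unless both are units; the
    common scale contributes phi(c). *)
Lemma sum_affine_kloos N1 N2 m0 n0 (a : 'I_N1 -> C) (b : 'I_N2 -> C) :
  \sum_(v : V) affine_poly m0 a v * affine_poly n0 b (swap v)
  = (totient c)%:R * \sum_i \sum_j a i * b j * kloos (m0 + i)%:R (n0 + j)%:R.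
Proof.
rewrite big_pair exchange_big /=.
rewrite (bigID (fun y : Z => y \is a GRing.unit)) /= [X in _ + X]big1 ?addr0; last first.
  by move=> y uy; rewrite big1 // => x _; rewrite affine_poly_nonunit ?mul0r.
rewrite -card_Zunits mulr_natl -sumr_const; apply: eq_big => [y|y uy]; first by rewrite inE.
rewrite (reindex (fun x => x * y)) /=; last first.
  by exists (fun x => x * y^-1) => x _; rewrite -mulrA ?mulrV ?mulVr // mulr1.
rewrite (bigID (fun x : Z => x \is a GRing.unit)) /= [X in _ + X]big1 ?addr0; last first.
  by move=> x ux; rewrite /swap /= (affine_poly_nonunit n0) ?mulr0 // unitrMl.
transitivity (\sum_(x | x \is a GRing.unit) \sum_i \sum_j a i * b j * psi ((m0 + i)%:R * x + (n0 + j)%:R * x^-1)).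
  apply: eq_bigr => x ux; rewrite /swap /= !affine_polyE // ?unitrMl // big_distrlr /=.
  apply: eq_bigr => i _; apply: eq_bigr => j _; rewrite psiD mulrACA.
  congr (_ * (psi (_ * _) * psi (_ * _))).
    by rewrite -mulrA mulrV // mulr1.
  by rewrite invrM // mulrA mulrV // mul1r.
rewrite exchange_big; apply: eq_bigr => i _; rewrite exchange_big; apply: eq_bigr => j _.
by rewrite -big_distrr.
Qed.

End BilinearForm.

Section BilinearBound.
Variables (C : numClosedFieldType) (n : nat).
Let c := n.+2.
Let Z := 'I_n.+2.
Let V := (Z * Z)%type.
Variable psi : Z -> C.
Hypotheses (psiD : forall x y, psi (x + y) = psi x * psi y)
  (psi_norm : forall x, `|psi x| = 1)
  (psi_orth : forall a, a != 0 -> \sum_x psi (a * x) = 0).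
Variables (H D r q k l N1 N2 m0 n0 : nat) (a : 'I_N1 -> C) (b : 'I_N2 -> C).
Hypotheses (Hc : (H ^ 2 <= c)%N) (cH : (c <= 4 * H ^ 2)%N) (cE : c = (r * q)%N).
Hypothesis hD : forall v, (0 < v <= c)%N -> (ndiv v <= D)%N.
Hypotheses (N1c : (N1 <= c)%N) (N2c : (N2 <= c)%N) (kr : (k %| r)%N) (lr : (l %| r)%N).
Hypotheses (hk : forall i, a i != 0 -> gcdn (m0 + i) r = k)
  (hl : forall j, b j != 0 -> gcdn (n0 + j) r = l).
Hypotheses (ker1 : forall i : 'I_N1, 2^-1 <= `|kernel_sum psi H i|)
  (ker2 : forall j : 'I_N2, 2^-1 <= `|kernel_sum psi H j|).

Let H0 : (0 < H)%N.
Proof. by case: (H) cH. Qed.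

Let r0 : (0 < r)%N.
Proof. by case: (r) cE. Qed.

Let g := gcdn k l.
Let L := (r %/ g)%N.

Let k0 : (0 < k)%N. Proof. exact: dvdn_gt0 kr. Qed.
Let g0 : (0 < g)%N. Proof. by rewrite gcdn_gt0 k0. Qed.
Let rE : r = (L * g)%N.
Proof. by rewrite /L divnK // (dvdn_trans (dvdn_gcdl _ _)). Qed.
Let L0 : (0 < L)%N. Proof. by case: (L) rE r0 => // ->. Qed.

Let ann_gcd (x y : nat) (z : Z) : x%:R * z = 0 -> y%:R * z = 0 -> (gcdn x y)%:R * z = 0.
Proof.
have e (u : nat) : (u%:R * z == 0) = (c %| u * z)%N by rewrite -{1}(natr_Zp z) -natrM Znat_eq0.
move=> /eqP; rewrite e => hx /eqP; rewrite e => hy; apply/eqP; rewrite e.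
by rewrite muln_gcdl dvdn_gcd hx.
Qed.

Let zf (p : 'I_L * 'I_L) : Z := q%:R * ((p.1 : nat)%:R - (p.2 : nat)%:R).

(** Outside this list, the averages of Phi_alpha vanish already, its frequencies having gcd k with
    r. Inside it those of Phi_beta vanish: k z = 0 and l z = 0 would give g z = 0, against [gzf]. *)
Let zs : seq Z := [seq z <- [seq zf p | p <- enum [set p : 'I_L * 'I_L | p.1 != p.2]] | k%:R * z == 0].

Let rzf p : r%:R * zf p = 0.
Proof. by rewrite /zf mulrA -natrM -cE (_ : c%:R = 0) ?mul0r //; apply/eqP; rewrite Znat_eq0. Qed.

(** g (t - t') is divisible by r = L g only if L | t - t', which is impossible for distinct t, t' <
    L. *)
Let gzf p : p.1 != p.2 -> g%:R * zf p != 0.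
Proof.
move=> ne; rewrite /zf mulrCA.
have -> : g%:R * ((p.1 : nat)%:R - (p.2 : nat)%:R) = (g%:Z * ((p.1 : nat)%:Z - (p.2 : nat)%:Z))%:~R :> Z.
  by rewrite intrM intrB -!pmulrn.
rewrite (ann_int cE) rE PoszM mulrC dvdz_mul2r; last by rewrite eqz_nat -lt0n.
apply/negP => h; case/negP: ne; apply/eqP/val_inj.
have := ltn_ord p.1; have := ltn_ord p.2; move: h; rewrite -eqz_mod_dvd !modz_nat eqz_nat => /eqP h h1 h2.
by move: h; rewrite !modn_small.
Qed.

(** Divided in advance by the factor that averaging over the shifts introduces, so that the pairing
    returns the original coefficients. *)
Let a' i := a i / kernel_sum psi H i.
Let b' j := b j / kernel_sum psi H j.

Let phi : V -> C := proj_away zs (affine_poly psi m0 a').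

Let kn0 (x : C) : 2^-1 <= `|x| -> x != 0.
Proof.
move=> h; rewrite -normr_gt0; apply: lt_le_trans h; by rewrite invr_gt0 ltr0n.
Qed.

Let a'E i : a' i * kernel_sum psi H i = a i.
Proof. by rewrite /a' divfK // kn0. Qed.

Let b'E j : b' j * kernel_sum psi H j = b j.
Proof. by rewrite /b' divfK // kn0. Qed.

Let scaled_norm (x y : C) : 2^-1 <= `|y| -> `|x / y| ^+ 2 <= 4%:R * `|x| ^+ 2.
Proof.
move=> hy; rewrite normrM normfV exprMn mulrC; apply: ler_wpM2r; first by rewrite exprn_ge0.
rewrite exprVn; have y0 : 0 < `|y| ^+ 2 by rewrite exprn_gt0 // normr_gt0 kn0.
rewrite -[leLHS]mul1r ler_pdivrMr //.
apply: (@le_trans _ _ (4%:R * 2^-1 ^+ 2)); first by rewrite expr2 (_ : 4%:R * _ = 1) //; field.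
by apply: ler_wpM2l; rewrite ?ler0n // ler_pXn2r ?nnegrE // invr_ge0 ler0n.
Qed.

Let orth (t t' : 'I_L) : t != t' -> forall v : V,
  \sum_(x : V) phi (v.1 + q%:R * ((t : nat)%:R - (t' : nat)%:R) * x.1,
                    v.2 + q%:R * ((t : nat)%:R - (t' : nat)%:R) * x.2) = 0.
Proof.
move=> tt' v; suff h : lattice_avg (zf (t, t')) phi v = 0.
  move: h => /eqP; rewrite /lattice_avg mulf_eq0 invr_eq0 pnatr_eq0 expn_eq0 /= => /eqP h.
  exact: h.
rewrite /phi; case: (boolP (zf (t, t') \in zs)) => mz; first exact: proj_away_mem.
apply: proj_away_kernel => {}v; apply: avg_affine_eq0 => // i ai.
apply: contra mz => /eqP mz; rewrite mem_filter map_f ?mem_enum ?inE // andbT.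
have ai' : a i != 0 by apply: contra ai => /eqP h; rewrite /a' h mul0r.
by rewrite -(hk ai') ann_gcd.
Qed.

Let bker z : z \in zs -> forall v, lattice_avg z (fun v => affine_poly psi n0 b' (swap v)) v = 0.
Proof.
rewrite mem_filter => /andP[/eqP kz /mapP[p]]; rewrite mem_enum inE => ne Ez v.
rewrite avg_swap avg_affine_eq0 // => j bj; apply/eqP => nz.
have bj' : b j != 0 by apply: contra bj => /eqP h; rewrite /b' h mul0r.
have lz : l%:R * z = 0 by rewrite -(hl bj') ann_gcd // Ez rzf.
by have := gzf ne; rewrite -Ez (ann_gcd kz lz) eqxx.
Qed.

Lemma bilinear_kloos_bound :
  `|\sum_i \sum_j a i * b j * kloos psi (m0 + i)%:R (n0 + j)%:R| ^+ 6
  <= (4096 * (2 * 3072 * D ^ 12) * (g * (sqrtdiv q * (q + r))) * c ^ 5)%:R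
     * (\sum_i `|a i| ^+ 2) ^+ 3 * (\sum_j `|b j| ^+ 2) ^+ 3.
Proof.
set X := \sum_i \sum_j _; set SA := \sum_i _; set SB := \sum_j _.
set T := avg_op (@shift_mat n H) (@shift_weight C n psi H m0 n0).
pose fB (v : V) := affine_poly psi n0 b' (swap v).
have e1 : (totient c)%:R * X = \sum_v T phi v * fB v.
  rewrite /T /phi proj_away_pair //; last exact: det2_shift.
  rewrite (pair_expand psiD) /X -(sum_affine_kloos psiD).
  apply: eq_bigr => v _; congr (_ * _).
    by rewrite /affine_poly; case: ifP => // _; apply: eq_bigr => i _; rewrite a'E.
  by rewrite /affine_poly; case: ifP => // _; apply: eq_bigr => i _; rewrite b'E.
have NA : vec_norm phi <= (totient c * c)%:R * (4%:R * SA).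
  apply: (le_trans (proj_away_norm _ _)); rewrite vec_norm_affine //.
  apply: ler_wpM2l; first by rewrite ler0n.
  by rewrite /SA big_distrr; apply: ler_sum => i _; apply: scaled_norm.
have NB : vec_norm fB <= (totient c * c)%:R * (4%:R * SB).
  rewrite /fB vec_norm_swap vec_norm_affine //.
  apply: ler_wpM2l; first by rewrite ler0n.
  by rewrite /SB big_distrr; apply: ler_sum => i _; apply: scaled_norm.
pose m1 := sl2_norm (T phi).
have m10 : 0 <= m1 by apply: sl2_norm_ge0.
have amp : L%:R * m1 ^+ 3 <= (2 * 3072 * D ^ 12 * (r * (sqrtdiv q * (q + r))) * c ^ 2)%:R * vec_norm phi ^+ 3.
  apply: amplification => //.
  - by move=> i; apply: shift_weight_norm.
  - by apply: proj_away_scale => s x us; apply: affine_poly_scale.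
(* A vector whose first coordinate is a unit extends to exactly c matrices of SL_2; for the others
   [fB] vanishes. *)
have fiber (F : V -> C) : \sum_(y : mat2 n | det2 y == 1) F y.1 * fB y.1 = c%:R * \sum_v F v * fB v.
  rewrite (eq_bigl (fun y : mat2 n => (wedge y.1 y.2 == 1))) //.
  rewrite -(pair_big_dep xpredT (fun v w : V => wedge v w == 1) (fun v _ => F v * fB v)) /=.
  rewrite big_distrr /=; apply: eq_bigr => v _.
  case: (boolP (v.1 \is a GRing.unit)) => uv; last first.
    have -> : fB v = 0 by rewrite /fB /swap affine_poly_nonunit.
    by rewrite !mulr0 big1.
  rewrite sumr_const mulr_natl; congr (_ *+ _).
  have -> : c = #|[set: Z]| by rewrite cardsT card_ord.
  have inj : injective (fun w1 : Z => (w1, v.1^-1 * (1 + v.2 * w1)) : V) by move=> x y [].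
  rewrite -(card_imset _ inj); apply: eq_card => w; apply/idP/imsetP.
    move=> h; have wE : wedge v w = 1 by apply/eqP; exact: h.
    exists w.1; rewrite ?inE // [LHS]surjective_pairing; congr pair.
    by apply: (mulrI uv); rewrite mulrA mulrV // mul1r -wE /wedge; ring.
  move=> [w1 _ ->]; suff h : wedge v (w1, v.1^-1 * (1 + v.2 * w1)) == 1 by exact: h.
  by rewrite /wedge /= mulrA mulrV // mul1r; apply/eqP; ring.
have slB : sl2_norm fB <= c%:R * vec_norm fB by apply: sl2_norm_le_vec.
have h2 : (c ^ 2 * totient c ^ 2)%:R * `|X| ^+ 2 <= m1 * (c%:R * vec_norm fB).
  apply: le_trans (ler_wpM2l m10 slB).
  apply: le_trans (cauchy_schwarz _ _ _).
  rewrite (fiber (T phi)) -e1 !normrM !normr_nat !exprMn natrM !natrX -!mulrA //.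
set N1' := vec_norm phi in NA amp; set N2' := vec_norm fB in NB h2 slB.
have N10 : 0 <= N1' by apply: vec_norm_ge0.
have N20 : 0 <= N2' by apply: vec_norm_ge0.
have SA0 : 0 <= SA by apply: sumr_ge0 => i _; rewrite exprn_ge0.
have SB0 : 0 <= SB by apply: sumr_ge0 => i _; rewrite exprn_ge0.
pose K := (2 * 3072 * D ^ 12)%N; pose t := totient c.
have t0 : (0 < t)%N by rewrite totient_gt0.
have cube (x y : C) : 0 <= x -> x <= y -> x ^+ 3 <= y ^+ 3.
  by move=> x0 xy; rewrite ler_pXn2r ?nnegrE // (le_trans x0).
have h3 := cube _ _ _ h2.
have {}h3 : ((c ^ 2 * t ^ 2)%:R * `|X| ^+ 2) ^+ 3 <= (m1 * (c%:R * N2')) ^+ 3.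
  by apply: h3; rewrite mulr_ge0 ?ler0n ?exprn_ge0.
have h4 : L%:R * ((c ^ 2 * t ^ 2)%:R * `|X| ^+ 2) ^+ 3 <=
   ((K * (r * (sqrtdiv q * (q + r))) * c ^ 2)%:R * N1' ^+ 3) * (c%:R * N2') ^+ 3.
  apply: (le_trans (ler_wpM2l (ler0n _ _) h3)); rewrite exprMn mulrA.
  by apply: ler_wpM2r => //; rewrite exprn_ge0 // mulr_ge0 ?ler0n.
have N13 := cube _ _ N10 NA; have N23 := cube _ _ N20 NB.
(* The constant 4096 is 4^3 * 4^3: dividing by kernel sums of modulus at least 1/2 costs 4 in each
   squared norm. *)
have h5 : L%:R * ((c ^ 2 * t ^ 2)%:R * `|X| ^+ 2) ^+ 3 <=
   ((K * (r * (sqrtdiv q * (q + r))) * c ^ 2)%:R * ((t * c)%:R * (4%:R * SA)) ^+ 3) *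
     (c%:R ^+ 3 * ((t * c)%:R * (4%:R * SB)) ^+ 3).
  apply: (le_trans h4); rewrite exprMn; apply: ler_pM.
  - by rewrite mulr_ge0 ?ler0n ?exprn_ge0.
  - by rewrite mulr_ge0 ?exprn_ge0 ?ler0n.
  - by apply: ler_wpM2l; rewrite ?ler0n.
  - by apply: ler_wpM2l; rewrite ?exprn_ge0 ?ler0n.
have P0 : (0 : C) < (L * (c ^ 6 * t ^ 6))%:R.
  by rewrite ltr0n muln_gt0 L0 muln_gt0 !expn_gt0 t0.
rewrite -(ler_pM2l P0).
have -> : (L * (c ^ 6 * t ^ 6))%:R * `|X| ^+ 6 = L%:R * ((c ^ 2 * t ^ 2)%:R * `|X| ^+ 2) ^+ 3.
  ring.
apply: (le_trans h5); set lhs := (X in X <= _); set rhs := (X in _ <= X).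
suff -> : lhs = rhs by [].
rewrite /lhs /rhs /K rE -/g; ring.
Qed.

End BilinearBound.

(** * Kloosterman sums over the complex numbers *)

From mathcomp Require Import finmap.
From mathcomp Require Import all_classical all_reals all_analysis.
From mathcomp Require Import complex.
Import numFieldNormedType.Exports.

Section ComplexExponential.
Variable R : realType.

Lemma cmodE (z : R[i]) : `|z| = (cmod z)%:C%C.
Proof. by case: z. Qed.

Lemma e2piD (s t : R) : e2pi (s + t) = e2pi s * e2pi t.
Proof.
rewrite /e2pi mulrDr cosD sinD; apply/eqP; rewrite eq_complex /=.
by apply/andP; split; apply/eqP; ring.
Qed.

Lemma e2pi_nat (k : nat) : e2pi (k%:R : R) = 1.
Proof.
elim: k => [|k IH].
  by rewrite /e2pi mulr0 cos0 sin0; apply/eqP; rewrite eq_complex /= !eqxx.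
rewrite -natr1 e2piD IH mul1r /e2pi mulr1.
have -> : 2 * pi = pi *+ 2 :> R by rewrite mulr_natl.
by rewrite cos2pi sin2pi; apply/eqP; rewrite eq_complex /= !eqxx.
Qed.

Lemma norm_e2pi (t : R) : `|e2pi t| = 1.
Proof. by rewrite normc_def /= cos2Dsin2 sqrtr1. Qed.

Lemma e2pi_neq1 (t : R) : 0 < t < 1 -> e2pi t != 1.
Proof.
move=> /andP[t0 t1]; apply/negP => /eqP e.
have /= h := congr1 (@complex.Re R) e.
have s0 : 0 < sin (pi * t).
  apply: sin_gt0_pi; rewrite mulr_gt0 ?pi_gt0 //=.
  by rewrite -[ltRHS]mulr1 ltr_pM2l // pi_gt0.
move: h; have -> : 2 * pi * t = (pi * t) *+ 2 by rewrite (mulr2n (pi * t)); ring.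
rewrite cos_mulr2n cos2sin2 => h.
have : sin (pi * t) ^+ 2 = 0 by move: h; rewrite (mulr2n (1 - _)); lra.
by move/eqP; rewrite expf_eq0 /= => /eqP s1; rewrite s1 ltxx in s0.
Qed.

(** The angle x is at most pi/4, so cos(2 x) >= 0; since cos(2 x) = 2 cos(x)^2 - 1 and cos(x) >= 0,
    a cosine below 1/2 is excluded. The 1/8 here is the source of the 8 in [piece_len]. *)
Lemma Re_e2pi_ge (t : R) : 0 <= t <= 8^-1 -> 2^-1 <= complex.Re (e2pi t).
Proof.
move=> /andP[t0 t8]; rewrite /e2pi /=; set x := 2 * pi * t.
have p0 := pi_gt0 R.
have x0 : 0 <= x by rewrite /x !mulr_ge0 // ltW.
have x4 : x <= pi / 4.
  have -> : pi / 4 = 2 * pi * 8^-1 :> R by field.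
  by rewrite ler_pM2l // mulr_gt0.
have c1 : 0 <= cos x by apply: cos_ge0_pihalf; apply/andP; split; lra.
have c2 : 0 <= cos (x *+ 2).
  by apply: cos_ge0_pihalf; rewrite (mulr2n x); apply/andP; split; lra.
move: c1 c2; rewrite cos_mulr2n (mulr2n (cos x ^+ 2)); move: (cos x) => z z0 z2.
rewrite leNgt; apply/negP => zh.
have : 0 <= z * (2^-1 - z) by rewrite mulr_ge0 // subr_ge0 ltW.
rewrite mulrBr -expr2; lra.
Qed.

Section Residues.
Variable n : nat.
Let c := n.+2.

Definition zchar (x : 'I_n.+2) : R[i] := e2pi ((x : nat)%:R / c%:R).

Let c0 : (c%:R : R) != 0. Proof. by rewrite pnatr_eq0. Qed.

Lemma e2pi_mod (k : nat) : e2pi (k%:R / c%:R : R) = e2pi ((k %% c)%:R / c%:R).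
Proof.
rewrite {1}(divn_eq k c) natrD mulrDl e2piD natrM mulfK // e2pi_nat mul1r //.
Qed.

Lemma zchar_nat (k : nat) : zchar k%:R = e2pi (k%:R / c%:R).
Proof. by rewrite /zchar Zval_nat -e2pi_mod. Qed.

Lemma zcharD x y : zchar (x + y) = zchar x * zchar y.
Proof.
by rewrite -[x in LHS]natr_Zp -[y in LHS]natr_Zp -natrD zchar_nat natrD mulrDl e2piD.
Qed.

Lemma zchar_norm x : `|zchar x| = 1.
Proof. exact: norm_e2pi. Qed.

Lemma zchar_orth a : a != 0 -> \sum_x zchar (a * x) = 0.
Proof.
move=> a0; set S := \sum_x _.
have e : S = zchar a * S.
  rewrite /S big_distrr /= (reindex (fun x : 'I_n.+2 => 1 + x)) /=; last first.
    exists (fun x => x - 1) => x _; ring.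
  by apply: eq_bigr => x _; rewrite mulrDr mulr1 zcharD.
have n1 : zchar a != 1.
  rewrite /zchar; apply: e2pi_neq1.
  rewrite divr_gt0 ?ltr0n //=; last by rewrite lt0n; apply: contra a0 => /eqP h; apply/eqP/val_inj.
  by rewrite ltr_pdivrMr ?ltr0n // mul1r ltr_nat.
move: e => /eqP; rewrite -subr_eq0 -{1}(mul1r S) -mulrBl mulf_eq0 => /orP[|/eqP //].
by rewrite subr_eq0 eq_sym (negPf n1).
Qed.

Lemma modinv_Z (x : 'I_n.+2) : x \is a GRing.unit -> (modinv c x)%:R = x^-1 :> 'I_n.+2.
Proof.
move=> ux; have cop : coprime x c by move: ux; rewrite Zunit_coprime coprime_sym.
apply: (mulrI ux); rewrite mulrV //.
have -> : x * (modinv c x)%:R = (x * modinv c x)%N%:R by rewrite natrM natr_Zp.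
by apply: ord_inj; rewrite Zval_nat (modinvP cop).
Qed.

Lemma Kloosterman_kloos (m k : nat) :
  Kloosterman R m%:Z k%:Z c = kloos zchar m%:R k%:R.
Proof.
rewrite /Kloosterman /kloos; apply: eq_big => [x|x xc].
  by rewrite Zunit_coprime coprime_sym.
have ux : x \is a GRing.unit by rewrite Zunit_coprime coprime_sym.
rewrite -modinv_Z // -[X in m%:R * X]natr_Zp -!natrM -natrD zchar_nat.
by rewrite -!PoszM -PoszD -pmulrn.
Qed.

Lemma kernel_sum_ge (H i : nat) : (0 < H)%N -> (forall h, (h < H)%N -> (8 * (i * h) <= c)%N) ->
  2^-1 <= `|kernel_sum zchar H i|.
Proof.
move=> H0 hh; apply: le_trans (normc_ge_Re _).
have -> : complex.Re (kernel_sum zchar H i) = H%:R^-1 * \sum_(h < H) complex.Re (zchar (i * h)%:R).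
  rewrite /kernel_sum -(raddf_sum (@complex.Re R)).
  have -> : H%:R^-1 = (H%:R^-1)%:C%C :> R[i] by rewrite fmorphV rmorph_nat.
  by case: (\sum_(_ < _) _) => x y /=; rewrite mul0r subr0.
have e : 2^-1 = (2^-1)%:C%C :> R[i] by rewrite fmorphV rmorph_nat.
rewrite e lecR; apply: le_trans (ler_norm _).
rewrite mulrC ler_pdivlMr ?ltr0n // -{1}(card_ord H) mulr_natr -sumr_const.
apply: ler_sum => h _; rewrite zchar_nat; apply: Re_e2pi_ge.
rewrite divr_ge0 ?ler0n //= ler_pdivrMr ?ltr0n // mulrC ler_pdivlMr // mulrC -natrM ler_nat.
exact: hh.
Qed.

End Residues.
End ComplexExponential.

(** * Short pieces of the intervals and their gluing *)

Definition isqrt (c : nat) : nat := (\max_(k < c.+1 | k ^ 2 <= c) k)%N.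

Lemma isqrt_sqr (c : nat) : (isqrt c ^ 2 <= c)%N.
Proof.
have card0 : (0 < #|[pred k : 'I_c.+1 | (k ^ 2 <= c)%N]|)%N.
  by apply/card_gt0P; exists ord0; rewrite inE.
by rewrite /isqrt; have [k kP ->] := eq_bigmax_cond (fun k : 'I_c.+1 => nat_of_ord k) card0.
Qed.

Lemma leq_isqrt (c k : nat) : (k ^ 2 <= c)%N -> (k <= isqrt c)%N.
Proof.
move=> kc; have kc1 : (k < c.+1)%N.
  by rewrite ltnS (leq_trans _ kc) //; case: (k) => // k'; rewrite -mulnn leq_pmulr.
exact: (@leq_bigmax_cond _ (fun k : 'I_c.+1 => (k ^ 2 <= c)%N) (fun k => nat_of_ord k) (Ordinal kc1)).
Qed.

Lemma isqrt_gt0 (c : nat) : (0 < c)%N -> (0 < isqrt c)%N.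
Proof. by move=> c0; apply: leq_isqrt. Qed.

Lemma leq_isqrt4 (c : nat) : (0 < c)%N -> (c <= 4 * isqrt c ^ 2)%N.
Proof.
move=> c0; have h0 := isqrt_gt0 c0.
have : (c < (isqrt c).+1 ^ 2)%N by rewrite ltnNge; apply/negP => /leq_isqrt; rewrite ltnn.
move: h0; move: (isqrt c) => h; rewrite -!mulnn; clear; nia.
Qed.

(** Chosen so that 8 i h <= c for every offset i in a piece and every shift h < [isqrt c]. The
    successor keeps the length positive when c is small. *)
Definition piece_len (c : nat) : nat := (isqrt c %/ 8).+1.

(* Locked to keep the unary numeral from being expanded. *)
HB.lock Definition bilin_const : nat := (2 ^ 12 * (2 * (3 * 2 ^ 10)))%N.

Lemma bilin_const_gt0 : (0 < bilin_const)%N.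
Proof. by rewrite bilin_const.unlock. Qed.

Section RealBilinear.
Variable R : realType.

Lemma sum_cmod (I : Type) (s : seq I) (P : pred I) (F : I -> R[i]) :
  \sum_(i <- s | P i) `|F i| ^+ 2 = (\sum_(i <- s | P i) cmod (F i) ^+ 2)%:C%C.
Proof. by rewrite rmorph_sum; apply: eq_bigr => i _; rewrite cmodE rmorphXn. Qed.

Lemma cmod_ge0 (z : R[i]) : 0 <= cmod z.
Proof. by case: z => x y; rewrite /cmod /= sqrtr_ge0. Qed.

Lemma cmodM (x y : R[i]) : cmod (x * y) = cmod x * cmod y.
Proof. exact: ComplexField.Normc.normcM. Qed.

Lemma Kloosterman1 (m n : nat) : Kloosterman R m%:Z n%:Z 1 = 1.
Proof.
rewrite /Kloosterman (big_pred1 ord0) => [|x]; last by rewrite ord1 /= coprimen1 eqxx.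
by rewrite mulr0 add0r -PoszM -pmulrn divr1 e2pi_nat.
Qed.

Lemma bilinear_piece (c r q k l m0 n0 D : nat) (alpha beta : nat -> R[i]) :
  (0 < c)%N -> c = (r * q)%N -> (forall v, (0 < v <= c)%N -> (ndiv v <= D)%N) ->
  (k %| r)%N ->
  (forall m, alpha m != 0 -> gcdn m r = k) -> (forall m, beta m != 0 -> gcdn m r = l) ->
  cmod (\sum_(i < piece_len c) \sum_(j < piece_len c) alpha (m0 + i)%N * beta (n0 + j)%N
      * Kloosterman R (m0 + i)%N%:Z (n0 + j)%N%:Z c) ^+ 6
  <= (bilin_const * D ^ 12 * (gcdn k l * (sqrtdiv q * (q + r))) * c ^ 5)%:R
   * (\sum_(i < piece_len c) cmod (alpha (m0 + i)%N) ^+ 2) ^+ 3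
   * (\sum_(j < piece_len c) cmod (beta (n0 + j)%N) ^+ 2) ^+ 3.
Proof.
case: c => [//|[|n]] _ cE hD kr ha hb.
  (* c = 1 is outside the range of the ring 'I_n.+2; here the piece is a single term and the bound
     is trivial. *)
  have -> : piece_len 1 = 1%N.
    rewrite /piece_len; have := isqrt_sqr 1; move: (isqrt 1) => h.
    by case: h => // -[].
  rewrite !big_ord_recl !big_ord0 !addr0 Kloosterman1 mulr1 cmodM exprMn -!exprM.
  have q1 : q = 1%N by move/esym/eqP: cE; rewrite muln_eq1 => /andP[_ /eqP].
  have r1 : r = 1%N by move/esym/eqP: cE; rewrite muln_eq1 => /andP[/eqP].
  have D0 : (0 < D)%N by apply: leq_trans (hD 1%N _).
  rewrite -mulrA ler_peMl ?mulr_ge0 ?exprn_ge0 ?cmod_ge0 // ler1n.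
  have g0 : (0 < gcdn k l)%N by rewrite gcdn_gt0 (dvdn_gt0 _ kr) ?r1.
  rewrite muln_gt0 exp1n andbT muln_gt0; apply/andP; split.
    by rewrite muln_gt0 bilin_const_gt0 expn_gt0 D0.
  by rewrite muln_gt0 g0 muln_gt0 q1 sqrtdiv_gt0.
set c := n.+2 in cE hD *; set N := piece_len c.
have H0 : (0 < isqrt c)%N by apply: isqrt_gt0.
have Hc := isqrt_sqr c; have cH := @leq_isqrt4 c isT.
have Nle : (N <= c)%N.
  rewrite /N /piece_len; apply: (@leq_trans (isqrt c)).
    by apply: ltn_Pdiv.
  by apply: leq_trans Hc; rewrite -mulnn leq_pmulr.
have small (i : 'I_N) h : (h < isqrt c)%N -> (8 * (i * h) <= c)%N.
  move=> hh; apply: leq_trans Hc; rewrite mulnA -mulnn; apply: leq_mul; last exact: ltnW.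
  by apply: (@leq_trans (8 * (isqrt c %/ 8))); [rewrite leq_mul2l -ltnS (ltn_ord i) | rewrite mulnC leq_divM].
have main := @bilinear_kloos_bound R[i] n (@zchar R n) (@zcharD R n) (@zchar_norm R n) (@zchar_orth R n)
  (isqrt c) D r q k l N N m0 n0 (fun i => alpha (m0 + i)%N) (fun j => beta (n0 + j)%N)
  Hc cH cE hD Nle Nle kr (fun i => ha _) (fun j => hb _).
have kge (i : 'I_N) : 2^-1 <= `|kernel_sum (@zchar R n) (isqrt c) i|.
  by apply: kernel_sum_ge => // h; apply: small.
move: (main kge kge); rewrite !sum_cmod.
under eq_bigr do under eq_bigr do rewrite -Kloosterman_kloos.
rewrite cmodE -!rmorphXn /=.
have -> (x y : R) (M : nat) : M%:R * x%:C%C * y%:C%C = (M%:R * x * y)%:C%C :> R[i].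
  by rewrite !rmorphM rmorph_nat.
rewrite lecR; have -> : (bilin_const * D ^ 12 = 4096 * (2 * 3072 * D ^ 12))%N.
  have e1 : (2 ^ 12 = 4096)%N by []. have e2 : (3 * 2 ^ 10 = 3072)%N by [].
  by rewrite bilin_const.unlock e1 e2 -!mulnA.
by [].
Qed.

End RealBilinear.

Lemma sum_interval_split (T : nmodType) (F : nat -> T) (a b P N : nat) : (b <= a + P * N)%N ->
  \sum_(a <= m < b) F m
  = \sum_(u < P) \sum_(i < N) (if (a + u * N + i < b)%N then F (a + u * N + i)%N else 0).
Proof.
move=> bPN; pose G m := if (m < b)%N then F m else 0.
transitivity (\sum_(a <= m < a + P * N) G m).
  case: (leqP a b) => [ab|ba]; last first.
    rewrite big_geq ?(ltnW ba) // big_nat big1 // => m /andP[am _].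
    by rewrite /G ltnNge (leq_trans (ltnW ba) am).
  rewrite [RHS](big_cat_nat (n := b)) //= [X in _ + X]big_nat [X in _ + X]big1 ?addr0.
    by apply: eq_big_nat => m /andP[_ mb]; rewrite /G mb.
  by move=> m /andP[bm _]; rewrite /G ltnNge bm.
rewrite -{1}[a]addn0 addnC [(a + _)%N]addnC big_addn addnK.
elim: P {bPN} => [|P IH]; first by rewrite mul0n big_geq // big_ord0.
rewrite big_ord_recr /= -IH (big_cat_nat (n := (P * N)%N)) //=; last by rewrite leq_mul2r leqnSn orbT.
congr (_ + _); rewrite -{1}[(P * N)%N]add0n big_addn mulSn addnK big_mkord.
by apply: eq_bigr => i _; rewrite /G; have -> : (i + P * N + a = a + P * N + i)%N by lia.
Qed.

Section IntervalNorm.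
Variable R : realType.

Definition interval_norm (a b : nat) (u : nat -> R[i]) : R :=
  Num.sqrt (\sum_(a <= m < b) cmod (u m) ^+ 2).

Lemma interval_norm_ge0 a b u : 0 <= interval_norm a b u.
Proof. exact: sqrtr_ge0. Qed.

Lemma sum_cmod_ge0 a b (u : nat -> R[i]) : 0 <= \sum_(a <= m < b) cmod (u m) ^+ 2.
Proof. by apply: sumr_ge0 => m _; rewrite exprn_ge0 // cmod_ge0. Qed.

Lemma interval_norm_sqr a b u : interval_norm a b u ^+ 2 = \sum_(a <= m < b) cmod (u m) ^+ 2.
Proof. by rewrite sqr_sqrtr // sum_cmod_ge0. Qed.

Definition restrict (P : pred nat) (u : nat -> R[i]) (m : nat) : R[i] := if P m then u m else 0.

Lemma cmod0 : cmod (0 : R[i]) = 0.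
Proof. exact: ComplexField.Normc.normc0. Qed.

Lemma interval_norm_restrict a b (P Q : pred nat) u : (forall m, P m -> Q m) ->
  interval_norm a b (restrict P u) <= interval_norm a b (restrict Q u).
Proof.
move=> PQ; apply: ler_wsqrtr; apply: ler_sum => m _; rewrite /restrict.
case: ifP => [/PQ -> //|_]; rewrite cmod0 expr0n exprn_ge0 ?cmod_ge0 //.
Qed.

Lemma interval_norm_restrict_le a b (P : pred nat) u :
  interval_norm a b (restrict P u) <= interval_norm a b u.
Proof. exact: (@interval_norm_restrict a b P xpredT). Qed.

Lemma le_cmod_sum (I : Type) (s : seq I) (P : pred I) (F : I -> R[i]) :
  cmod (\sum_(i <- s | P i) F i) <= \sum_(i <- s | P i) cmod (F i).
Proof.
elim/big_rec2: _ => [|i y x _ h]; first by rewrite cmod0.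
have := ler_normD (F i) x; rewrite !cmodE -rmorphD lecR => /le_trans; apply.
by rewrite lerD2l.
Qed.

Lemma sixth_rootK (K : R) : 0 <= K -> (K `^ 6^-1) ^+ 6 = K.
Proof.
by move=> K0; rewrite -powR_mulrn ?powR_ge0 // -powRrM mulVf ?powRr1 // pnatr_eq0.
Qed.

Lemma sixth_root_le (x K A B : R) : 0 <= x -> 0 <= K -> 0 <= A -> 0 <= B ->
  x ^+ 6 <= K * A ^+ 3 * B ^+ 3 -> x <= K `^ 6^-1 * (Num.sqrt A * Num.sqrt B).
Proof.
move=> x0 K0 A0 B0 h.
rewrite -(@ler_pXn2r _ 6) // ?nnegrE ?mulr_ge0 ?powR_ge0 ?sqrtr_ge0 //.
apply: (le_trans h); rewrite !exprMn sixth_rootK //.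
have e (y : R) : 0 <= y -> Num.sqrt y ^+ 6 = y ^+ 3.
  by move=> y0; rewrite (exprM _ 2 3) sqr_sqrtr.
by rewrite !e // mulrA.
Qed.

Section Bilinear.
Variables (c r q D P a b a' b' : nat) (alpha beta : nat -> R[i]).
Hypotheses (c0 : (0 < c)%N) (cE : c = (r * q)%N).
Hypothesis hD : forall v, (0 < v <= c)%N -> (ndiv v <= D)%N.
Hypotheses (hP : (b <= a + P * piece_len c)%N) (hP' : (b' <= a' + P * piece_len c)%N).

Definition bilin_sum (u v : nat -> R[i]) : R[i] :=
  \sum_(a <= m < b) \sum_(a' <= n < b') u m * v n * Kloosterman R m%:Z n%:Z c.

Definition bilin_bound (g : nat) : R :=
  (bilin_const * D ^ 12 * (g * (sqrtdiv q * (q + r))) * c ^ 5)%:R `^ 6^-1.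

Lemma bilin_class (k l : nat) (u v : nat -> R[i]) : (k %| r)%N ->
  (forall m, u m != 0 -> gcdn m r = k) -> (forall m, v m != 0 -> gcdn m r = l) ->
  cmod (bilin_sum u v) <= (P ^ 2)%:R * (bilin_bound (gcdn k l) * (interval_norm a b u * interval_norm a' b' v)).
Proof.
move=> kr hu hv; pose N := piece_len c.
(* Cutting the sequences off at the right endpoints lets the last pieces overhang the intervals. *)
pose u' := restrict (fun m => (m < b)%N) u; pose v' := restrict (fun m => (m < b')%N) v.
have hu' m : u' m != 0 -> gcdn m r = k by rewrite /u' /restrict; case: ifP => [_ /hu//|]; rewrite eqxx.
have hv' m : v' m != 0 -> gcdn m r = l by rewrite /v' /restrict; case: ifP => [_ /hv//|]; rewrite eqxx.
have -> : bilin_sum u v = \sum_(s < P) \sum_(t < P) \sum_(i < N) \sum_(j < N)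
   u' (a + s * N + i)%N * v' (a' + t * N + j)%N
     * Kloosterman R (a + s * N + i)%N%:Z (a' + t * N + j)%N%:Z c.
  rewrite /bilin_sum (sum_interval_split _ hP); apply: eq_bigr => s _.
  rewrite exchange_big /=; apply: eq_bigr => i _.
  case: ifP => mb; last first.
    by rewrite big1 // => t _; rewrite big1 // => j _; rewrite /u' /restrict mb !mul0r.
  rewrite (sum_interval_split _ hP'); apply: eq_bigr => t _; apply: eq_bigr => j _.
  by rewrite /u' /v' /restrict mb; case: ifP; rewrite ?mulr0 ?mul0r.
have piece (w : nat -> R[i]) a1 b1 (h : (b1 <= a1 + P * N)%N) (s : 'I_P) :
   Num.sqrt (\sum_(i < N) cmod (restrict (fun m => (m < b1)%N) w (a1 + s * N + i)%N) ^+ 2) <= interval_norm a1 b1 w.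
  apply: ler_wsqrtr; rewrite (sum_interval_split _ h) (bigD1 s) //=.
  rewrite -[leLHS]addr0; apply: lerD.
    by apply: ler_sum => i _; rewrite /restrict; case: ifP; rewrite // cmod0 expr0n.
  by apply: sumr_ge0 => t _; apply: sumr_ge0 => i _; case: ifP => // _; rewrite exprn_ge0 // cmod_ge0.
have -> : (P ^ 2)%:R * (bilin_bound (gcdn k l) * (interval_norm a b u * interval_norm a' b' v))
  = \sum_(s < P) \sum_(t < P) bilin_bound (gcdn k l) * (interval_norm a b u * interval_norm a' b' v).
  by rewrite !sumr_const !card_ord -mulrnA mulnn mulr_natl.
apply: (le_trans (le_cmod_sum _ _ _)); apply: ler_sum => s _.
apply: (le_trans (le_cmod_sum _ _ _)); apply: ler_sum => t _.
have nn (w : nat -> R[i]) m0 : 0 <= \sum_(i < N) cmod (w (m0 + i)%N) ^+ 2.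
  by apply: sumr_ge0 => i _; rewrite exprn_ge0 // cmod_ge0.
apply: le_trans (sixth_root_le (cmod_ge0 _) _ (nn u' (a + s * N)%N) (nn v' (a' + t * N)%N)
  (bilinear_piece (a + s * N) (a' + t * N) c0 cE hD kr hu' hv')) _; first by rewrite ler0n.
apply: ler_wpM2l; first exact: powR_ge0.
by apply: ler_pM; rewrite ?sqrtr_ge0 ?piece.
Qed.

Variable q0 : nat.
Hypothesis q0c : (q0 %| c)%N.

Let has_gcd (x : nat) : pred nat := fun m => gcdn m c == x.

(** Sorting m and n by their gcds x, y with c makes gcd(m, r) and gcd(n, r) constant, as
    [bilin_class] requires. As q0 | c, the condition (m, n, q0) = 1 becomes a condition on (x,
    y). *)
Lemma bilin_sum_classes :
  cmod (\sum_(a <= m < b) \sum_(a' <= n < b' | gcdn (gcdn m n) q0 == 1%N)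
     alpha m * beta n * Kloosterman R m%:Z n%:Z c)
  <= \sum_(x <- divisors c) \sum_(y <- divisors c | gcdn (gcdn x y) q0 == 1%N)
    (P ^ 2)%:R * (bilin_bound (gcdn (gcdn x r) (gcdn y r))
     * (interval_norm a b (restrict (has_gcd x) alpha) * interval_norm a' b' (restrict (has_gcd y) beta))).
Proof.
have -> : \sum_(a <= m < b) \sum_(a' <= n < b' | gcdn (gcdn m n) q0 == 1%N)
     alpha m * beta n * Kloosterman R m%:Z n%:Z c
  = \sum_(x <- divisors c) \sum_(y <- divisors c | gcdn (gcdn x y) q0 == 1%N)
     bilin_sum (restrict (has_gcd x) alpha) (restrict (has_gcd y) beta).
  rewrite /bilin_sum.
  transitivity (\sum_(a <= m < b) \sum_(a' <= n < b')
     \sum_(x <- divisors c) \sum_(y <- divisors c | gcdn (gcdn x y) q0 == 1%N)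
     restrict (has_gcd x) alpha m * restrict (has_gcd y) beta n * Kloosterman R m%:Z n%:Z c); last first.
    under eq_bigr do rewrite exchange_big /=.
    rewrite exchange_big /=; apply: eq_bigr => x _.
    under eq_bigr do rewrite exchange_big /=.
    by rewrite exchange_big.
  apply: eq_bigr => m _; rewrite big_mkcond; apply: eq_bigr => n _.
  have mc : gcdn m c \in divisors c by rewrite -dvdn_divisors // dvdn_gcdr.
  have nc : gcdn n c \in divisors c by rewrite -dvdn_divisors // dvdn_gcdr.
  rewrite (bigD1_seq (gcdn m c)) ?divisors_uniq //= [X in _ + X]big1 ?addr0; last first.
    move=> x /negPf xm; rewrite big1 // => y _.
    by rewrite /restrict /has_gcd eq_sym xm !mul0r.
  rewrite big_mkcond (bigD1_seq (gcdn n c)) ?divisors_uniq //= [X in _ + X]big1 ?addr0; last first.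
    move=> y /negPf yn; case: ifP => // _.
    by rewrite /restrict /has_gcd [gcdn n c == y]eq_sym yn mulr0 mul0r.
  have -> : gcdn (gcdn (gcdn m c) (gcdn n c)) q0 = gcdn (gcdn m n) q0.
    rewrite gcdnACA gcdnn -gcdnA; congr gcdn; exact/gcdn_idPr.
  by rewrite /restrict /has_gcd !eqxx.
apply: (le_trans (le_cmod_sum _ _ _)); apply: ler_sum => x _.
apply: (le_trans (le_cmod_sum _ _ _)); apply: ler_sum => y _.
have gr m : gcdn (gcdn m c) r = gcdn m r.
  rewrite -gcdnA; congr gcdn; apply/gcdn_idPr; by rewrite cE dvdn_mulr.
apply: bilin_class; first exact: dvdn_gcdr.
  by move=> m; rewrite /restrict /has_gcd; case: ifP => [/eqP <- _|]; rewrite ?eqxx.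
by move=> m; rewrite /restrict /has_gcd; case: ifP => [/eqP <- _|]; rewrite ?eqxx.
Qed.

End Bilinear.
End IntervalNorm.

(** * Summation over the moduli *)

Section DivisorAverages.
Local Open Scope nat_scope.
Variables (X D : nat).
Hypothesis hD : forall v, 0 < v <= X -> ndiv v <= D.

Lemma sum_dvd_leq (x N : nat) : 0 < x -> \sum_(1 <= g < N.+1) (g %| x) <= ndiv x.
Proof.
move=> x0; rewrite (eq_bigr (fun g => if g %| x then 1 else 0)) => [|g _]; last by case: ifP.
rewrite -big_mkcond sum1_count -size_filter; apply: uniq_leq_size.
  by rewrite filter_uniq // iota_uniq.
by move=> g; rewrite mem_filter -dvdn_divisors // => /andP[].
Qed.

Lemma sum_ndiv_leq : \sum_(1 <= x < X.+1) ndiv x <= X * D.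
Proof.
apply: (@leq_trans (\sum_(1 <= x < X.+1) D)); last by rewrite sum_nat_const_nat subSS subn0.
by rewrite [leqLHS]big_nat [leqRHS]big_nat; apply: leq_sum => x; rewrite ltnS; apply: hD.
Qed.

Lemma sum_dvd_count (k : nat) : \sum_(1 <= x < X.+1) (k %| x) = X %/ k.
Proof. by rewrite divn_count_dvd. Qed.

(** Bound s(x) by the sum of all k with k^2 | x. The multiples of k^2 up to X contribute k floor(X /
    k^2) <= floor(X / k), so the total is at most the sum of the divisor function. *)
Lemma sum_sqrtdiv_leq : \sum_(1 <= x < X.+1) sqrtdiv x <= X * D.
Proof.
apply: (leq_trans _ sum_ndiv_leq).
apply: (@leq_trans (\sum_(1 <= x < X.+1) \sum_(1 <= k < X.+1) (k ^ 2 %| x) * k)).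
  rewrite [leqLHS]big_nat [leqRHS]big_nat; apply: leq_sum => x /andP[x0 xX].
  have s0 := sqrtdiv_gt0 x0; have sx := dvdn_sqrtdiv x0.
  have sX : sqrtdiv x < X.+1.
    apply: leq_ltn_trans xX; apply: leq_trans (dvdn_leq x0 sx).
    by rewrite -mulnn leq_pmulr.
  rewrite (bigD1_seq (sqrtdiv x)) ?iota_uniq //=; last by rewrite mem_index_iota s0.
  by rewrite sx mul1n leq_addr.
rewrite exchange_big /=.
apply: (@leq_trans (\sum_(1 <= k < X.+1) \sum_(1 <= x < X.+1) (k %| x))).
  rewrite [leqLHS]big_nat [leqRHS]big_nat; apply: leq_sum => k /andP[k0 _].
  rewrite -big_distrl /= !sum_dvd_count leq_divRL // -mulnA mulnn; exact: leq_divM.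
rewrite exchange_big /= [leqLHS]big_nat [leqRHS]big_nat; apply: leq_sum => x /andP[x0 _].
exact: sum_dvd_leq.
Qed.

(** Bound gcd(u, x) by the sum of all g dividing both; each divisor g of u contributes at most X
    over all x. *)
Lemma sum_gcd_leq (u : nat) : 0 < u -> ndiv u <= D -> \sum_(1 <= x < X.+1) gcdn u x <= X * D.
Proof.
move=> u0 uD.
apply: (@leq_trans (\sum_(1 <= x < X.+1) \sum_(g <- divisors u) g * (g %| x))).
  apply: leq_sum => x _.
  rewrite (bigD1_seq (gcdn u x)) ?divisors_uniq //=; last by rewrite -dvdn_divisors // dvdn_gcdl.
  by rewrite dvdn_gcdr muln1 leq_addr.
rewrite exchange_big /=; apply: (@leq_trans (ndiv u * X)); last by rewrite mulnC leq_mul2l uD orbT.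
apply: leq_sum_dvd_const => // g _.
by rewrite -big_distrr /= sum_dvd_count mulnC leq_divM.
Qed.

End DivisorAverages.

Section RestrictedNorms.
Variables (R : realType) (X D a b : nat) (u : nat -> R[i]).
Hypothesis hD : forall m, (a <= m < b)%N -> (0 < m)%N /\ (ndiv m <= D)%N.

Lemma sum_interval_norm_restrict :
  \sum_(1 <= g < X.+1) interval_norm a b (restrict (fun m => g %| m)%N u) ^+ 2
  <= D%:R * interval_norm a b u ^+ 2.
Proof.
under eq_bigr do rewrite interval_norm_sqr.
rewrite interval_norm_sqr exchange_big /= big_distrr /=.
rewrite [leLHS]big_nat [leRHS]big_nat; apply: ler_sum => m /hD[m0 mD].
apply: (@le_trans _ _ (\sum_(1 <= g < X.+1) (g %| m)%N%:R * cmod (u m) ^+ 2)).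
  apply: ler_sum => g _; rewrite /restrict; case: ifP => _; first by rewrite mul1r.
  by rewrite cmod0 expr0n mul0r.
rewrite -big_distrl /= -natr_sum; apply: ler_wpM2r; first by rewrite exprn_ge0 // cmod_ge0.
by rewrite ler_nat; apply: leq_trans mD; apply: sum_dvd_leq.
Qed.

End RestrictedNorms.

(** Cauchy-Schwarz over g, each index m having at most D divisors. This absorbs the gcds that the
    second factorization of c leaves behind. *)
Lemma sum_norm_pairs (R : realType) (X D a b a' b' : nat) (u v : nat -> R[i]) :
  (forall m, (a <= m < b)%N -> (0 < m)%N /\ (ndiv m <= D)%N) ->
  (forall m, (a' <= m < b')%N -> (0 < m)%N /\ (ndiv m <= D)%N) ->
  \sum_(1 <= g < X.+1) interval_norm a b (restrict (fun m => g %| m)%N u)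
     * interval_norm a' b' (restrict (fun m => g %| m)%N v)
  <= D%:R * (interval_norm a b u * interval_norm a' b' v).
Proof.
move=> hu hv; set A := interval_norm a b u; set B := interval_norm a' b' v.
have A0 : 0 <= A by apply: interval_norm_ge0.
have B0 : 0 <= B by apply: interval_norm_ge0.
rewrite -(@ler_pXn2r _ 2) // ?nnegrE ?mulr_ge0 ?ler0n //; last first.
  by apply: sumr_ge0 => g _; rewrite mulr_ge0 ?interval_norm_ge0.
apply: le_trans (sqr_sum_leq _ _ _ _) _; try by move=> g; apply: interval_norm_ge0.
have -> : (D%:R * (A * B)) ^+ 2 = (D%:R * A ^+ 2) * (D%:R * B ^+ 2) by ring.
apply: ler_pM; try (by apply: sumr_ge0 => g _; rewrite exprn_ge0 // interval_norm_ge0).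
  exact: sum_interval_norm_restrict.
exact: sum_interval_norm_restrict.
Qed.

Section RealEstimates.
Variable R : realType.

(** As M is at most both r and q, one has q + r <= 2 c / M. The sixth root is extracted from the
    powers of D, c and w, while the numerical constant is simply enlarged. *)
Lemma bilin_bound_le (c r q D g t w : nat) (M : R) : c = (r * q)%N -> (0 < D)%N -> (0 < c)%N ->
  0 < M -> M <= r%:R -> M <= q%:R -> (g * sqrtdiv q <= t * w ^ 6)%N ->
  bilin_bound R c r q D g <= (2 * bilin_const * D ^ 2 * c * w)%:R * (t%:R / M) `^ 6^-1.
Proof.
move=> cE D0 c0 M0 Mr Mq hg; rewrite /bilin_bound.
have tM0 : 0 <= t%:R / M by rewrite divr_ge0 ?ler0n // ltW.
rewrite -(@ler_pXn2r _ 6) // ?nnegrE ?mulr_ge0 ?powR_ge0 ?ler0n // exprMn !sixth_rootK ?ler0n //.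
have qr : (q + r)%:R <= 2 * c%:R / M.
  rewrite ler_pdivlMr // natrD mulrDl.
  have h1 : q%:R * M <= c%:R by rewrite cE natrM mulrC ler_wpM2r ?ler0n.
  have h2 : r%:R * M <= c%:R by rewrite cE natrM ler_wpM2l ?ler0n.
  by rewrite mulr_natl mulr2n lerD.
rewrite -!natrX.
have -> : (bilin_const * D ^ 12 * (g * (sqrtdiv q * (q + r))) * c ^ 5)%:R
  = (bilin_const * D ^ 12 * c ^ 5)%:R * (g * sqrtdiv q)%:R * (q + r)%:R :> R.
  by rewrite -!natrM; congr (_%:R); ring.
apply: (@le_trans _ _ ((bilin_const * D ^ 12 * c ^ 5)%:R * (t * w ^ 6)%:R * (2 * c%:R / M))).
  apply: ler_pM; rewrite ?mulr_ge0 ?ler0n //.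
  by apply: ler_wpM2l; rewrite ?ler0n // ler_nat.
have -> : (bilin_const * D ^ 12 * c ^ 5)%:R * (t * w ^ 6)%:R * (2 * c%:R / M)
  = (2 * bilin_const * (D ^ 12 * c ^ 6 * w ^ 6))%:R * (t%:R / M) :> R.
  by rewrite !natrM; ring.
apply: ler_wpM2r => //; rewrite ler_nat.
have -> : ((2 * bilin_const * D ^ 2 * c * w) ^ 6 = (2 * bilin_const) ^ 6 * (D ^ 12 * c ^ 6 * w ^ 6))%N.
  rewrite !expnMn; ring.
rewrite leq_mul2r; apply/orP; right.
by rewrite -[leqLHS]expn1 leq_pexp2l // muln_gt0 bilin_const_gt0.
Qed.

Lemma sum_multiples (C : R) (q : nat) (F : nat -> R) : (0 < q)%N -> 0 < C -> (forall c, 0 <= F c) ->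
  \sum_(0 <= c < (Num.truncn (2 * C)).+1 | (C < c%:R <= 2 * C) && (q %| c)%N) F c
  <= \sum_(1 <= x < (Num.truncn (2 * C / q%:R)).+1 | C < (q * x)%N%:R) F (q * x)%N.
Proof.
move=> q0 C0 F0; set T := Num.truncn _; set X := Num.truncn _.
apply: (@le_trans _ _ (\sum_(0 <= c < T.+1) \sum_(1 <= x < X.+1 | C < (q * x)%N%:R) (q * x == c)%N%:R * F c)).
  rewrite big_mkcond; apply: ler_sum => c _; case: ifP => [/andP[/andP[Cc cC] qc]|_]; last first.
    by apply: sumr_ge0 => x _; rewrite mulr_ge0 ?ler0n.
  have [x Ex] := dvdnP qc; rewrite mulnC in Ex.
  have x0 : (0 < x)%N.
    by case: x Ex => // Ex; move: Cc; rewrite Ex muln0 ltNge (ltW C0).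
  have xX : (x < X.+1)%N.
    rewrite ltnS /X truncn_ge_nat ?divr_ge0 ?mulr_ge0 ?ler0n ?(ltW C0) //.
    by rewrite ler_pdivlMr ?ltr0n // -natrM mulnC -Ex.
  rewrite big_mkcond (bigD1_seq x) ?iota_uniq //=; last by rewrite mem_index_iota x0.
  rewrite -Ex eqxx mul1r Cc lerDl; apply: sumr_ge0 => y _; case: ifP => // _.
  by rewrite mulr_ge0 ?ler0n.
rewrite exchange_big /=; apply: ler_sum => x _.
have qx y : (q * x == y)%N%:R * F y = (y == (q * x)%N)%:R * F (q * x)%N.
  by rewrite eq_sym; case: eqP => [->//|_]; rewrite !mul0r.
rewrite (eq_bigr _ (fun y _ => qx y)) -big_distrl /= -natr_sum -[leRHS]mul1r.
apply: ler_wpM2r => //; rewrite -[1]/(1%:R) ler_nat.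
rewrite (eq_bigr (fun y => if y == (q * x)%N then 1%N else 0%N)) => [|y _]; last by case: eqP.
rewrite -big_mkcond sum1_count.
by rewrite (count_uniq_mem _ (iota_uniq _ _)) leq_b1.
Qed.

Section Core.
Variables (C : R) (q0 d d' e f a b a' b' D P : nat) (alpha beta : nat -> R[i]).
Hypotheses (hC : 2^-1 <= C) (d0 : (0 < d)%N) (d'0 : (0 < d')%N) (e0 : (0 < e)%N).
Hypotheses (q0E : q0 = (d * d' * e)%N) (hf : forall g, (g ^ 2 %| q0 * d)%N -> (g <= f)%N).
Hypothesis hD : forall v, (0 < v)%N -> v%:R <= 2 * C -> (ndiv v <= D)%N.
Hypothesis hI : forall m, (a <= m < b)%N -> (0 < m)%N /\ (ndiv m <= D)%N.
Hypothesis hJ : forall m, (a' <= m < b')%N -> (0 < m)%N /\ (ndiv m <= D)%N.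
Hypothesis hP : forall c, C < c%:R -> (b <= a + P * piece_len c)%N.
Hypothesis hP' : forall c, C < c%:R -> (b' <= a' + P * piece_len c)%N.

Let C0 : 0 < C. Proof. by apply: lt_le_trans hC; rewrite invr_gt0. Qed.
Let u := (d' * e)%N.
Let u0 : (0 < u)%N. Proof. by rewrite muln_gt0 d'0. Qed.
Let q0u : q0 = (d * u)%N. Proof. by rewrite q0E mulnA. Qed.
Let q00 : (0 < q0)%N. Proof. by rewrite q0u muln_gt0 d0. Qed.
Let s := sqrtdiv u.

(** The square of d s divides d^2 u = q0 d. *)
Let dsf : (d * s <= f)%N.
Proof.
apply: hf; rewrite expnMn q0u mulnAC mulnn dvdn_mul //; exact: dvdn_sqrtdiv.
Qed.

Definition twisted_sum (c : nat) : R := cmod (\sum_(a <= m < b)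
  \sum_(a' <= n < b' | gcdn (gcdn m n) q0 == 1%N) alpha m * beta n * Kloosterman R m%:Z n%:Z c).

Let NN := interval_norm a b alpha * interval_norm a' b' beta.
Let NN0 : 0 <= NN. Proof. by rewrite mulr_ge0 ?interval_norm_ge0. Qed.
Let X := Num.truncn (2 * C / q0%:R).
Let XC : X%:R <= 2 * C / q0%:R.
Proof. by rewrite truncn_le divr_ge0 ?mulr_ge0 ?ler0n // ltW. Qed.
Let D0 : (0 < D)%N.
Proof.
apply: (leq_trans (ndiv_gt0 (ltn0Sn 0))); apply: hD => //.
by have := hC; lra.
Qed.

Let Xq x : (x <= X)%N -> (q0 * x)%:R <= 2 * C.
Proof.
move=> xX; rewrite natrM mulrC -ler_pdivlMr ?ltr0n //; apply: le_trans XC.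
by rewrite ler_nat.
Qed.

Let hDc c : c%:R <= 2 * C -> forall v, (0 < v <= c)%N -> (ndiv v <= D)%N.
Proof. by move=> cC v /andP[v0 vc]; apply: hD => //; apply: le_trans cC; rewrite ler_nat. Qed.

Let ndiv_le_D c : (0 < c)%N -> c%:R <= 2 * C -> (ndiv c <= D)%N.
Proof. by move=> c0 cC; apply: hD. Qed.

(* Factorization c = d (d' e x). *)
Lemma twisted_sum_a (x : nat) : (0 < x <= X)%N -> C < (q0 * x)%:R ->
  twisted_sum (q0 * x) <= (D ^ 2 * (P ^ 2 * (2 * bilin_const * D ^ 2)))%:R * (2 * C)
    * (f%:R / Num.min C (d%:R ^+ 2)) `^ 6^-1 * (sqrtdiv x + gcdn u x)%:R * NN.
Proof.
move=> /andP[x0 xX] Cx; set c := (q0 * x)%N.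
have c0 : (0 < c)%N by rewrite muln_gt0 q00.
have cC : c%:R <= 2 * C by apply: Xq.
have cE : c = (d * (u * x))%N by rewrite /c q0u mulnA.
have q0c : (q0 %| c)%N by rewrite dvdn_mulr.
set m := Num.min C (d%:R ^+ 2).
have dR : (0 : R) < d%:R by rewrite ltr0n.
have m0 : 0 < m by rewrite lt_min C0 exprn_gt0.
set w := (sqrtdiv x + gcdn u x)%N.
have bb : bilin_bound R c d (u * x) D 1 <= (2 * bilin_const * D ^ 2 * c * w)%:R * (f%:R / m) `^ 6^-1.
  (* M = m / d is admissible: it is at most d because m <= d^2, and at most u x because m <= C < c =
     d u x. Then s / M = d s / m <= f / m. *)
  apply: (@le_trans _ _ ((2 * bilin_const * D ^ 2 * c * w)%:R * (s%:R / (m / d%:R)) `^ 6^-1)).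
    apply: bilin_bound_le => //.
    - by rewrite divr_gt0.
    - by rewrite ler_pdivrMr // -expr2 ge_min lexx orbT.
    - rewrite ler_pdivrMr //; apply: (@le_trans _ _ C); first by rewrite ge_min lexx.
      by rewrite -natrM mulnC -cE ltW.
    - rewrite mul1n; apply: (leq_trans (sqrtdiv_mul u0 x0)); rewrite leq_mul2l; apply/orP; right.
      have s0 := sqrtdiv_gt0 x0; have g0 : (0 < gcdn u x)%N by rewrite gcdn_gt0 u0.
      apply: (@leq_trans (w ^ 2)); last by rewrite leq_pexp2l // addn_gt0 s0.
      by rewrite -mulnn; apply: leq_mul; rewrite ?leq_addr ?leq_addl.
  apply: ler_wpM2l; first by rewrite ler0n.
  apply: ge0_ler_powR; rewrite ?nnegrE ?invr_ge0 ?divr_ge0 ?ler0n ?(ltW m0) //.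
  rewrite invf_div mulrA ler_pM2r ?invr_gt0 //.
  by rewrite -natrM ler_nat mulnC.
apply: (le_trans (bilin_sum_classes _ _ c0 cE (hDc cC) (hP Cx) (hP' Cx) q0c)).
have term y z : gcdn (gcdn y z) q0 == 1%N ->
  (P ^ 2)%:R * (bilin_bound R c d (u * x) D (gcdn (gcdn y d) (gcdn z d)) *
    (interval_norm a b (restrict (fun m => gcdn m c == y) alpha) *
     interval_norm a' b' (restrict (fun m => gcdn m c == z) beta)))
  <= (P ^ 2 * (2 * bilin_const * D ^ 2))%:R * (2 * C) * (f%:R / m) `^ 6^-1 * w%:R * NN.
  move=> /eqP g1.
  have -> : gcdn (gcdn y d) (gcdn z d) = 1%N.
    apply/eqP; rewrite -dvdn1 -g1 gcdnACA gcdnn dvdn_gcd dvdn_gcdl /=.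
    rewrite (dvdn_trans (dvdn_gcdr _ _)) // q0u dvdn_mulr //.
  have -> : (P ^ 2 * (2 * bilin_const * D ^ 2))%:R * (2 * C) * (f%:R / m) `^ 6^-1 * w%:R * NN
    = (P ^ 2)%:R * (((2 * bilin_const * D ^ 2)%:R * (2 * C) * w%:R * (f%:R / m) `^ 6^-1) * NN).
    by rewrite natrM; ring.
  apply: ler_wpM2l; first by rewrite ler0n.
  apply: ler_pM; rewrite ?powR_ge0 ?mulr_ge0 ?interval_norm_ge0 //.
    apply: (le_trans bb); apply: ler_wpM2r; first exact: powR_ge0.
    rewrite natrM; apply: ler_wpM2r; first by rewrite ler0n.
    by rewrite natrM; apply: ler_wpM2l; rewrite ?ler0n.
  by apply: ler_pM; rewrite ?interval_norm_ge0 ?interval_norm_restrict_le.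
set Tm := (P ^ 2 * _)%:R * (2 * C) * _ * _ * NN in term.
have Tm0 : 0 <= Tm by rewrite /Tm !mulr_ge0 ?powR_ge0 ?ler0n ?(ltW C0) ?interval_norm_ge0.
apply: (@le_trans _ _ (\sum_(y <- divisors c) \sum_(z <- divisors c) Tm)).
  apply: ler_sum => y _; rewrite big_mkcond; apply: ler_sum => z _.
  by case: ifP => // /term.
rewrite !big_const_seq !count_predT !iter_addr_0 -mulrnA mulnn.
have -> : (D ^ 2 * (P ^ 2 * (2 * bilin_const * D ^ 2)))%:R * (2 * C) * (f%:R / m) `^ 6^-1 * w%:R * NN
  = Tm *+ (D ^ 2) by rewrite /Tm natrM -[RHS]mulr_natl; ring.
by rewrite -[leLHS]mulr_natl -[leRHS]mulr_natl ler_wpM2r // ler_nat leq_exp2r // ndiv_le_D.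
Qed.

(* Factorization c = (d x) (d' e). *)
Lemma twisted_sum_b (x : nat) : (0 < x <= X)%N -> C < (q0 * x)%:R ->
  twisted_sum (q0 * x) <= (D ^ 2 * (P ^ 2 * (2 * bilin_const * D ^ 2)))%:R * (2 * C)
    * (f%:R / Num.min q0%:R (d%:R ^+ 2 * (C / q0%:R))) `^ 6^-1
    * \sum_(1 <= g < X.+1) (g * (g %| x))%:R *
       (interval_norm a b (restrict (fun m => g %| m)%N alpha)
        * interval_norm a' b' (restrict (fun m => g %| m)%N beta)).
Proof.
move=> /andP[x0 xX] Cx; set c := (q0 * x)%N.
have c0 : (0 < c)%N by rewrite muln_gt0 q00.
have cC : c%:R <= 2 * C by apply: Xq.
have cE : c = (d * x * u)%N by rewrite /c q0u mulnAC.
have q0c : (q0 %| c)%N by rewrite dvdn_mulr.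
set m := Num.min _ _.
have dR : (0 : R) < d%:R by rewrite ltr0n.
have qR : (0 : R) < q0%:R by rewrite ltr0n.
have m0 : 0 < m by rewrite lt_min qR mulr_gt0 ?exprn_gt0 ?divr_gt0.
have bb g : (0 < g)%N -> bilin_bound R c (d * x) u D g <= (2 * bilin_const * D ^ 2 * c * g)%:R * (f%:R / m) `^ 6^-1.
  move=> g0.
  apply: (@le_trans _ _ ((2 * bilin_const * D ^ 2 * c * g)%:R * (s%:R / (m / d%:R)) `^ 6^-1)).
    apply: bilin_bound_le => //.
    - by rewrite divr_gt0.
    - rewrite ler_pdivrMr //; apply: (@le_trans _ _ (d%:R ^+ 2 * (C / q0%:R))); first by rewrite ge_min lexx orbT.
      have -> : (d * x)%:R * d%:R = d%:R ^+ 2 * x%:R :> R by rewrite natrM; ring.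
      apply: ler_wpM2l; first by rewrite exprn_ge0 // ltW.
      by rewrite ler_pdivrMr // -natrM mulnC ltW.
    - rewrite ler_pdivrMr //; apply: (@le_trans _ _ q0%:R); first by rewrite ge_min lexx.
      by rewrite -natrM mulnC q0u.
    - by rewrite mulnC leq_mul2l -{1}[g]expn1 leq_pexp2l ?orbT.
  apply: ler_wpM2l; first by rewrite ler0n.
  apply: ge0_ler_powR; rewrite ?nnegrE ?invr_ge0 ?divr_ge0 ?ler0n ?(ltW m0) //.
  rewrite invf_div mulrA ler_pM2r ?invr_gt0 //.
  by rewrite -natrM ler_nat mulnC.
apply: (le_trans (bilin_sum_classes _ _ c0 cE (hDc cC) (hP Cx) (hP' Cx) q0c)).
pose G g := interval_norm a b (restrict (fun m => g %| m)%N alpha)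
        * interval_norm a' b' (restrict (fun m => g %| m)%N beta).
have G0 g : 0 <= G g by rewrite mulr_ge0 ?interval_norm_ge0.
pose K0 := (P ^ 2 * (2 * bilin_const * D ^ 2))%:R * (2 * C) * (f%:R / m) `^ 6^-1.
have K00 : 0 <= K0 by rewrite /K0 !mulr_ge0 ?powR_ge0 ?ler0n ?(ltW C0) ?interval_norm_ge0.
pose Tm := K0 * \sum_(1 <= g < X.+1) (g * (g %| x))%:R * G g.
have Tm0 : 0 <= Tm by rewrite /Tm mulr_ge0 //; apply: sumr_ge0 => g _; rewrite mulr_ge0 ?ler0n.
have term y z : gcdn (gcdn y z) q0 == 1%N ->
  (P ^ 2)%:R * (bilin_bound R c (d * x) u D (gcdn (gcdn y (d * x)) (gcdn z (d * x))) *
    (interval_norm a b (restrict (fun m => gcdn m c == y) alpha) *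
     interval_norm a' b' (restrict (fun m => gcdn m c == z) beta))) <= Tm.
  move=> /eqP g1; set g := gcdn _ (gcdn z _).
  have gE : g = gcdn (gcdn y z) (d * x) by rewrite /g gcdnACA gcdnn.
  have gd : coprime g d.
    rewrite /coprime -dvdn1 -g1 dvdn_gcd q0u dvdn_mulr ?dvdn_gcdr // andbT.
    by rewrite (dvdn_trans (dvdn_gcdl _ d)) // gE dvdn_gcdl.
  (* g divides d x and is coprime to d, since d | q0 and (y, z, q0) = 1. *)
  have gx : (g %| x)%N by rewrite -(Gauss_dvdr _ gd) gE dvdn_gcdr.
  have g0 : (0 < g)%N by apply: dvdn_gt0 gx.
  have gX : (g < X.+1)%N by rewrite ltnS (leq_trans (dvdn_leq _ gx)).
  apply: (@le_trans _ _ (K0 * ((g * (g %| x))%:R * G g))); last first.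
    apply: ler_wpM2l => //; rewrite (bigD1_seq g) ?iota_uniq //=; last by rewrite mem_index_iota g0.
    by rewrite lerDl; apply: sumr_ge0 => y' _; rewrite mulr_ge0 ?ler0n.
  rewrite gx muln1.
  have -> : K0 * (g%:R * G g)
    = (P ^ 2)%:R * (((2 * bilin_const * D ^ 2)%:R * (2 * C) * g%:R * (f%:R / m) `^ 6^-1) * G g).
    by rewrite /K0 natrM; ring.
  apply: ler_wpM2l; first by rewrite ler0n.
  apply: ler_pM; rewrite ?powR_ge0 ?mulr_ge0 ?interval_norm_ge0 //.
    apply: (le_trans (bb g g0)); apply: ler_wpM2r; first exact: powR_ge0.
    rewrite natrM; apply: ler_wpM2r; first by rewrite ler0n.
    by rewrite natrM; apply: ler_wpM2l; rewrite ?ler0n.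
  have gy : (g %| gcdn y z)%N by rewrite gE dvdn_gcdl.
  apply: ler_pM; rewrite ?interval_norm_ge0 ?interval_norm_restrict // => k /eqP kE.
    by rewrite (dvdn_trans _ (dvdn_gcdl k c)) // kE (dvdn_trans gy) ?dvdn_gcdl.
  by rewrite (dvdn_trans _ (dvdn_gcdl k c)) // kE (dvdn_trans gy) ?dvdn_gcdr.
apply: (@le_trans _ _ (\sum_(y <- divisors c) \sum_(z <- divisors c) Tm)).
  apply: ler_sum => y _; rewrite big_mkcond; apply: ler_sum => z _.
  by case: ifP => // /term.
rewrite !big_const_seq !count_predT !iter_addr_0 -mulrnA mulnn.
have -> : (D ^ 2 * (P ^ 2 * (2 * bilin_const * D ^ 2)))%:R * (2 * C) * (f%:R / m) `^ 6^-1 *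
    (\sum_(1 <= g < X.+1) (g * (g %| x))%:R * G g)
  = Tm *+ (D ^ 2) by rewrite /Tm /K0 natrM -[RHS]mulr_natl; ring.
by rewrite -[leLHS]mulr_natl -[leRHS]mulr_natl ler_wpM2r // ler_nat leq_exp2r // ndiv_le_D.
Qed.

Let dR : (0 : R) < d%:R. Proof. by rewrite ltr0n. Qed.
Let qR : (0 : R) < q0%:R. Proof. by rewrite ltr0n. Qed.
Let ma := Num.min C (d%:R ^+ 2).
Let mb := Num.min q0%:R (d%:R ^+ 2 * (C / q0%:R)).
Let ma0 : 0 < ma. Proof. by rewrite lt_min C0 exprn_gt0. Qed.
Let mb0 : 0 < mb. Proof. by rewrite lt_min qR mulr_gt0 ?exprn_gt0 ?divr_gt0. Qed.
Let W := (D ^ 2 * (P ^ 2 * (2 * bilin_const * D ^ 2)))%N.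

Let hDX v : (0 < v <= X)%N -> (ndiv v <= D)%N.
Proof.
move=> /andP[v0 vX]; apply: hD => //; apply: le_trans (Xq vX).
by rewrite ler_nat leq_pmull.
Qed.

Let sum_ge_C (F G : nat -> R) : (forall c, 0 <= F c) -> (forall x, 0 <= G x) ->
  (forall x, (0 < x <= X)%N -> C < (q0 * x)%:R -> F (q0 * x)%N <= G x) ->
  \sum_(0 <= c < (Num.truncn (2 * C)).+1 | (C < c%:R <= 2 * C) && (q0 %| c)%N) F c
  <= \sum_(1 <= x < X.+1) G x.
Proof.
move=> F0 G0 FG; apply: (le_trans (sum_multiples q00 C0 F0)).
rewrite big_mkcond [leLHS]big_nat [leRHS]big_nat; apply: ler_sum => x xX.
by case: ifP => // Cx; apply: FG.
Qed.

Let twisted_sum_ge0 c : 0 <= twisted_sum c. Proof. exact: cmod_ge0. Qed.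

Lemma sum_twisted_a :
  \sum_(0 <= c < (Num.truncn (2 * C)).+1 | (C < c%:R <= 2 * C) && (q0 %| c)%N) twisted_sum c
  <= (8 * W * D)%:R * (NN * (C ^+ 2 / q0%:R) * (f%:R / ma) `^ 6^-1).
Proof.
(* For X = 0 the sum is empty, and u <= 2 C, used below to bound its number of divisors, may
   fail. *)
have [X0|X0] := posnP X.
  apply: (@le_trans _ _ 0); last first.
    by rewrite !mulr_ge0 ?powR_ge0 ?ler0n ?interval_norm_ge0 ?invr_ge0 ?exprn_ge0 ?(ltW C0).
  have := sum_ge_C twisted_sum_ge0 (fun=> lexx 0) (fun x => _).
  by rewrite X0 big_nil; apply=> -[|x].
have uD : (ndiv u <= D)%N.
  apply: hD => //; have := Xq X0; apply: le_trans.
  by rewrite ler_nat muln1 q0u leq_pmull.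
apply: (le_trans (sum_ge_C twisted_sum_ge0 _ twisted_sum_a)).
  by move=> x; rewrite !mulr_ge0 ?powR_ge0 ?ler0n ?(ltW C0) ?interval_norm_ge0.
rewrite -big_distrl -big_distrr /= -natr_sum -/ma -/NN -/W.
have hs : (\sum_(1 <= x < X.+1) (sqrtdiv x + gcdn u x))%:R <= (2 * D)%:R * (2 * C / q0%:R).
  apply: (@le_trans _ _ (2 * D * X)%:R); last first.
    by rewrite natrM; apply: ler_wpM2l => //; rewrite ler0n.
  rewrite ler_nat big_split /= -mulnA mul2n -addnn mulnC leq_add //.
    exact: sum_sqrtdiv_leq.
  exact: sum_gcd_leq.
set Z := (f%:R / ma) `^ 6^-1; have Z0 : 0 <= Z by apply: powR_ge0.
have -> : (8 * W * D)%:R * (NN * (C ^+ 2 / q0%:R) * Z)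
  = W%:R * (2 * C) * Z * ((2 * D)%:R * (2 * C / q0%:R)) * NN by rewrite !natrM; ring.
by apply: ler_wpM2r => //; apply: ler_wpM2l => //; rewrite !mulr_ge0 ?ler0n ?(ltW C0).
Qed.

(** Exchanging the sums over g and x, the weight g is cancelled by the at most X / g multiples of
    g. *)
Lemma sum_twisted_b :
  \sum_(0 <= c < (Num.truncn (2 * C)).+1 | (C < c%:R <= 2 * C) && (q0 %| c)%N) twisted_sum c
  <= (8 * W * D)%:R * (NN * (C ^+ 2 / q0%:R) * (f%:R / mb) `^ 6^-1).
Proof.
pose G g := interval_norm a b (restrict (fun m => g %| m)%N alpha)
        * interval_norm a' b' (restrict (fun m => g %| m)%N beta).
have G0 g : 0 <= G g by rewrite mulr_ge0 ?interval_norm_ge0.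
apply: (le_trans (sum_ge_C twisted_sum_ge0 _ twisted_sum_b)).
  move=> x; rewrite !mulr_ge0 ?powR_ge0 ?ler0n ?(ltW C0) //.
  by apply: sumr_ge0 => g _; rewrite mulr_ge0 ?ler0n ?G0.
rewrite -big_distrr /= -/mb -/W exchange_big /=.
set Z := (f%:R / mb) `^ 6^-1; have Z0 : 0 <= Z by apply: powR_ge0.
have hs : \sum_(1 <= g < X.+1) \sum_(1 <= x < X.+1) (g * (g %| x))%:R * G g
   <= (2 * C / q0%:R) * (D%:R * NN).
  apply: (@le_trans _ _ (\sum_(1 <= g < X.+1) X%:R * G g)).
    apply: ler_sum => g _; rewrite -big_distrl /=; apply: ler_wpM2r => //.
    rewrite -natr_sum -big_distrr /= sum_dvd_count ler_nat mulnC; exact: leq_divM.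
  rewrite -big_distrr /=; apply: ler_pM => //; first by apply: sumr_ge0.
  exact: sum_norm_pairs.
have -> : (8 * W * D)%:R * (NN * (C ^+ 2 / q0%:R) * Z)
  = W%:R * (2 * C) * Z * (2 * (2 * C / q0%:R * (D%:R * NN))) by rewrite !natrM; ring.
apply: ler_wpM2l; first by rewrite !mulr_ge0 ?ler0n ?(ltW C0).
apply: (le_trans hs); rewrite ler_peMl ?ler1n //.
by rewrite !mulr_ge0 ?ler0n ?invr_ge0 ?interval_norm_ge0 ?(ltW C0).
Qed.

Lemma sum_twisted :
  \sum_(0 <= c < (Num.truncn (2 * C)).+1 | (C < c%:R <= 2 * C) && (q0 %| c)%N) twisted_sum c
  <= (32 * bilin_const * P ^ 2 * D ^ 5)%:R * (NN * (C ^+ 2 / q0%:R) * (f%:R / (ma + mb)) `^ 6^-1).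
Proof.
(* The better of the two bounds has the larger of [ma], [mb], which is at least half their sum; the
   factor 2 under the sixth root is relaxed to a factor 2 outside. *)
have half m : 0 < m -> ma + mb <= 2 * m ->
    (f%:R / m) `^ 6^-1 <= 2 * (f%:R / (ma + mb)) `^ 6^-1.
  move=> m0 hm; have s0 : 0 < ma + mb by rewrite addr_gt0.
  rewrite -(@ler_pXn2r _ 6) // ?nnegrE ?mulr_ge0 ?powR_ge0 // exprMn.
  rewrite !sixth_rootK ?divr_ge0 ?ler0n ?(ltW m0) ?(ltW s0) //.
  apply: (@le_trans _ _ (2 * (f%:R / (ma + mb)))).
    rewrite mulrCA; apply: ler_wpM2l; first by rewrite ler0n.
    by rewrite ler_pdivlMr // ler_pdivrMl // mulrC.
  apply: ler_wpM2r; first by rewrite divr_ge0 ?ler0n ?(ltW s0).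
  by rewrite -natrX ler_nat.
set Z := (f%:R / (ma + mb)) `^ 6^-1 in half *.
have fin m : 0 < m -> ma + mb <= 2 * m -> (8 * W * D)%:R * (NN * (C ^+ 2 / q0%:R) * (f%:R / m) `^ 6^-1)
  <= (32 * bilin_const * P ^ 2 * D ^ 5)%:R * (NN * (C ^+ 2 / q0%:R) * Z).
  move=> m0 hm.
  have -> : (32 * bilin_const * P ^ 2 * D ^ 5)%:R * (NN * (C ^+ 2 / q0%:R) * Z)
    = (8 * W * D)%:R * (NN * (C ^+ 2 / q0%:R) * (2 * Z)).
    by rewrite /W !natrM; ring.
  apply: ler_wpM2l; first by rewrite ler0n.
  apply: ler_wpM2l; last exact: half.
  by rewrite !mulr_ge0 ?interval_norm_ge0 ?exprn_ge0 ?invr_ge0 ?ler0n ?(ltW C0).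
have [ab|/ltW ba] := leP ma mb.
  by apply: (le_trans sum_twisted_b); apply: fin => //; lra.
by apply: (le_trans sum_twisted_a); apply: fin => //; lra.
Qed.

End Core.
End RealEstimates.

(** * Exponents o(1) *)

Section Subpolynomial.
Variable R : realType.
Implicit Types (C : R) (G : R -> R).

Lemma half_gt0 C : 2^-1 <= C -> 0 < C.
Proof. by move=> hC; apply: lt_le_trans hC; rewrite invr_gt0. Qed.

(** C may be smaller than 1, where powers decrease in the exponent; C >= 1/2 limits the loss to 2^(t
    - s). *)
Lemma powR_le_half C (s t : R) : 2^-1 <= C -> s <= t -> C `^ s <= 2 `^ (t - s) * C `^ t.
Proof.
move=> hC st; have C0 := half_gt0 hC.
have -> : C `^ s = C `^ (s - t) * C `^ t.
  by rewrite -powRD ?subrK // (gt_eqF C0) implybT.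
apply: ler_wpM2r; first exact: powR_ge0.
have -> : C `^ (s - t) = C^-1 `^ (t - s) by rewrite -powR_inv1 ?ltW // -powRrM mulN1r opprB.
apply: ge0_ler_powR; rewrite ?nnegrE ?subr_ge0 ?invr_ge0 ?(ltW C0) //.
by rewrite -[2]invrK lef_pV2 // posrE invr_gt0.
Qed.

(** The epsilon form of C^o(1) is stable under sums, products and powers. Exponent functions are
    converted to it and back only at the two ends. *)
Definition subpolynomial G : Prop := forall eps : R, 0 < eps ->
  exists2 K, 0 <= K & forall C, 2^-1 <= C -> 0 <= G C <= K * C `^ eps.

Lemma subpolynomial_cst (k : R) : 0 <= k -> subpolynomial (fun=> k).
Proof.
move=> k0 eps e0; exists (k * 2 `^ eps); first by rewrite mulr_ge0 ?powR_ge0.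
move=> C hC; rewrite k0 /= -mulrA ler_peMr //.
have := powR_le_half hC (ltW e0); by rewrite powRr0 subr0.
Qed.

Lemma subpolynomialD F G : subpolynomial F -> subpolynomial G -> subpolynomial (fun C => F C + G C).
Proof.
move=> hF hG eps e0; have [K K0 hK] := hF _ e0; have [L L0 hL] := hG _ e0.
exists (K + L); first exact: addr_ge0.
move=> C hC; have /andP[F0 FK] := hK C hC; have /andP[G0 GL] := hL C hC.
by rewrite addr_ge0 //= mulrDl lerD.
Qed.

Lemma subpolynomialM F G : subpolynomial F -> subpolynomial G -> subpolynomial (fun C => F C * G C).
Proof.
move=> hF hG eps e0; have e2 : 0 < eps / 2 by rewrite divr_gt0.
have [K K0 hK] := hF _ e2; have [L L0 hL] := hG _ e2.
exists (K * L); first exact: mulr_ge0.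
move=> C hC; have /andP[F0 FK] := hK C hC; have /andP[G0 GL] := hL C hC.
rewrite mulr_ge0 //=; have -> : K * L * C `^ eps = (K * C `^ (eps / 2)) * (L * C `^ (eps / 2)).
  rewrite mulrACA -powRD; first by congr (_ * (_ `^ _)); field.
  by rewrite (gt_eqF (half_gt0 hC)) implybT.
exact: ler_pM.
Qed.

Lemma subpolynomialX F n : subpolynomial F -> subpolynomial (fun C => F C ^+ n).
Proof.
move=> hF; elim: n => [|n IH]; first exact: (subpolynomial_cst ler01).
move=> eps e0; have [K K0 hK] := subpolynomialM hF IH e0; exists K => // C hC.
by rewrite exprS; apply: hK.
Qed.

Lemma subpolynomial_le F G : subpolynomial G -> (forall C, 2^-1 <= C -> 0 <= F C <= G C) ->
  subpolynomial F.
Proof.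
move=> hG FG eps e0; have [K K0 hK] := hG _ e0; exists K => // C hC.
have /andP[F0 FGC] := FG C hC; have /andP[_ GK] := hK C hC.
by rewrite F0 /=; apply: le_trans GK.
Qed.

Lemma subpolynomial_o1 (eta : R -> R) : o1_exponent eta -> subpolynomial (fun C => C `^ eta C).
Proof.
move=> [etaB etaL] eps e0.
have [M M0 hM] : exists2 M, 0 < M & forall C, 2^-1 <= C -> `|eta C| <= M.
  have [M0 [_ hM]] := etaB.
  exists (`|M0| + 1); first by rewrite ltr_pwDr.
  by move=> C hC; apply: hM => //; rewrite ltr_pwDr // ler_norm.
have [C1 hC1] : exists C1, forall C, C1 < C -> `|eta C| < eps.
  move/cvgrPdist_lt: etaL => /(_ eps e0) [C1 [_ hC1]]; exists C1 => C CC1.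
  by have := hC1 C CC1; rewrite sub0r normrN.
(* [ln 2] bounds - ln C for all C >= 1/2, and the other term bounds ln C where C <= C1, so [L]
   controls both ranges. *)
pose L := ln 2 + `|ln C1|.
have L0 : 0 <= L by rewrite addr_ge0 // ln_ge0 // ler1n.
exists (expR ((M + eps) * L)); first exact: expR_ge0.
move=> C hC; have C0 := half_gt0 hC.
rewrite powR_ge0 /= /powR (gt_eqF C0) -expRD ler_expR.
have Clo : - ln 2 <= ln C.
  by rewrite -lnV ?posrE // ler_ln ?posrE ?invr_gt0.
have ln2 : 0 < ln 2 :> R by rewrite ln_gt0 // ltr1n.
have [CC1|CC1] := ltP C1 C; last first.
  have Chi : ln C <= `|ln C1|.
    apply: (@le_trans _ _ (ln C1)); last exact: ler_norm.
    by rewrite ler_ln ?posrE // (lt_le_trans C0).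
  have Cabs : `|ln C| <= L.
    rewrite ler_norml /L; have := normr_ge0 (ln C1); lra.
  have h : (eta C - eps) * ln C <= (M + eps) * L.
    apply: (le_trans (ler_norm _)); rewrite normrM; apply: ler_pM => //.
    apply: (le_trans (ler_normB _ _)); rewrite (gtr0_norm e0); apply: lerD => //.
    exact: hM.
  by move: h; rewrite mulrBl; lra.
have h1 := hC1 C CC1; have h2 := hM C hC.
have h0 : 0 <= eps - eta C by rewrite subr_ge0 (le_trans (ler_norm _)) // ltW.
have h3 : (eps - eta C) * (- ln C) <= (M + eps) * L.
  apply: (@le_trans _ _ ((eps - eta C) * L)).
    by apply: ler_wpM2l => //; rewrite /L; have := normr_ge0 (ln C1); lra.
  apply: ler_wpM2r => //; have := ler_norm (- eta C); rewrite normrN; lra.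
by move: h3; rewrite mulrN mulrBl; lra.
Qed.

(** The exponent is ln(1 + G) / ln C, the added 1 making it nonnegative. It is set to 0 for C < 2,
    which avoids the zero of ln C at 1; there G is bounded and the constant absorbs it. *)
Lemma subpolynomial_o1_bound G : subpolynomial G ->
  exists (K : R) (eta : R -> R), o1_exponent eta /\
    forall C, 2^-1 <= C -> G C <= K * C `^ eta C.
Proof.
move=> hG; pose H C := 1 + G C.
have hH : subpolynomial H by apply: subpolynomialD hG; apply: subpolynomial_cst.
have H1 C : 2^-1 <= C -> 1 <= H C.
  by move=> hC; have [K _ hK] := hG 1 ltr01; have /andP[G0 _] := hK C hC; rewrite lerDl.
pose eta C := if 2 <= C then ln (H C) / ln C else 0.
have le2 C : 2 <= C -> 2^-1 <= C by move=> h; lra.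
have ln2 : 0 < ln 2 :> R by rewrite ln_gt0 // ltr1n.
have lnC C : 2 <= C -> ln 2 <= ln C.
  by move=> h; rewrite ler_ln ?posrE // (lt_le_trans _ h).
have eta_le eps : 0 < eps -> exists2 L, 0 <= L &
    forall C, 2^-1 <= C -> 0 <= eta C /\ (2 <= C -> eta C <= L / ln C + eps).
  move=> e0; have [K K0 hK] := hH _ e0; exists (`|ln K|) => // C hC.
  rewrite /eta; case: ifP => [C2|_]; last by split=> //; rewrite ltxx.
  have l0 : 0 < ln C by apply: lt_le_trans ln2 (lnC _ C2).
  have C0 := half_gt0 hC.
  split=> [|_]; first by rewrite divr_ge0 ?(ltW l0) // ln_ge0 // H1.
  rewrite ler_pdivrMr // mulrDl divfK ?(gt_eqF l0) // -ln_powR.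
  have K1 : 0 < K.
    rewrite lt_neqAle K0 andbT; apply/eqP => K00; have := hK C hC.
    by rewrite -K00 mul0r => /andP[_]; have := H1 C hC; lra.
  apply: (@le_trans _ _ (ln K + ln (C `^ eps))); last by rewrite lerD2r ler_norm.
  rewrite -lnM ?posrE ?powR_gt0 // ler_ln ?posrE ?mulr_gt0 ?powR_gt0 //.
    by have /andP[] := hK C hC.
  by apply: lt_le_trans (H1 C hC).
have [K1 K10 hK1] := hH 1 ltr01.
(* The constant 1 serves C >= 2, where C^eta equals H exactly; below 2, H <= K1 C <= 2 K1. *)
exists (Num.max 1 (K1 * 2)), eta; split; last first.
  move=> C hC; have C0 := half_gt0 hC; apply: (@le_trans _ _ (H C)); first by rewrite lerDr.
  rewrite /eta; case: ifP => C2.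
    have l0 : 0 < ln C by apply: lt_le_trans ln2 (lnC _ C2).
    rewrite /powR (gt_eqF C0) divfK ?(gt_eqF l0) // lnK ?posrE ?(lt_le_trans _ (H1 C hC)) //.
    by rewrite ler_peMl ?(le_trans _ (H1 C hC)) // le_max lexx.
  rewrite powRr0 mulr1; have /andP[_ h] := hK1 C hC; apply: (le_trans h).
  rewrite le_max; apply/orP; right; apply: ler_wpM2l => //; rewrite powRr1 ?(ltW C0) //.
  by move/negbT: C2; rewrite -ltNge => /ltW.
split.
  have [L L0 hL] := eta_le 1 ltr01.
  exists (L / ln 2 + 1); split; first exact: num_real.
  move=> M hM C /= hC; apply: le_trans (ltW hM).
  have [e0 eL] := hL C hC; rewrite ger0_norm //.
  have [C2|C2] := leP 2 C.
    apply: (le_trans (eL C2)); rewrite lerD2r; apply: ler_wpM2l => //.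
    by rewrite lef_pV2 ?posrE ?lnC // (lt_le_trans ln2 (lnC _ C2)).
  by rewrite /eta (lt_geF C2) addr_ge0 // divr_ge0 // ltW.
apply/cvgrPdist_lt => eps e0.
have e2 : 0 < eps / 2 by rewrite divr_gt0.
have [L L0 hL] := eta_le _ e2.
(* Beyond this threshold L / ln C < eps / 2. *)
exists (Num.max 2 (expR (2 * L / eps))); split; first exact: num_real.
move=> C; rewrite gt_max => /andP[C2 CL].
have hC := le2 C (ltW C2); have [e00 eL] := hL C hC.
rewrite sub0r normrN ger0_norm //; apply: (le_lt_trans (eL (ltW C2))).
have C0 := half_gt0 hC.
have lnCL : 2 * L / eps < ln C by rewrite -[X in X < _]expRK ltr_ln ?posrE ?expR_gt0.
have l0 : 0 < ln C by apply: lt_le_trans ln2 (lnC _ (ltW C2)).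
have : L / ln C < eps / 2.
  rewrite ltr_pdivrMr //; move: lnCL; rewrite ltr_pdivrMr // => h.
  by rewrite mulrAC ltr_pdivlMr //; lra.
lra.
Qed.

Lemma subpolynomial_truncn G : subpolynomial G -> subpolynomial (fun C => (Num.truncn (G C)).+1%:R).
Proof.
move=> hG; apply: (subpolynomial_le (subpolynomialD hG (subpolynomial_cst ler01))) => C hC.
have [K _ hK] := hG 1 ltr01; have /andP[G0 _] := hK C hC.
by rewrite ler0n -natr1 lerD2r truncn_le.
Qed.

Definition max_ndiv (n : nat) : nat := (\max_(v < n.+1) ndiv v)%N.

Lemma leq_max_ndiv n v : (v <= n)%N -> (ndiv v <= max_ndiv n)%N.
Proof. by rewrite -ltnS => vn; apply: (leq_bigmax (Ordinal vn)). Qed.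

Lemma max_ndiv_bound (k : nat) : (0 < k)%N ->
  exists K, forall n, (max_ndiv n ^ k <= K * n.+1)%N.
Proof.
move=> k0; have [K hK] := ndiv_bound k0; exists K.+1 => n; rewrite /max_ndiv.
have [|v ->] := @bigop.eq_bigmax 'I_n.+1 (fun v => ndiv v); first by rewrite card_ord.
(* [divisors 0] has one element; K.+1 instead of K covers this case. *)
have [v0|v0] := posnP v; first by rewrite v0 /ndiv /= exp1n.
by apply: (leq_trans (hK v v0)); apply: leq_mul => //; apply: ltnW.
Qed.

(** For n of polynomial size C^b, the j-th power bound on [max_ndiv] gives C^(b / j), and j is taken
    with |b| / j <= eps. *)
Lemma subpolynomial_max_ndiv (n : R -> nat) (b k : R) : 0 <= k ->
  (forall C, 2^-1 <= C -> (n C).+1%:R <= k * C `^ b) ->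
  subpolynomial (fun C => (max_ndiv (n C))%:R).
Proof.
move=> k0 hn eps e0.
pose j := (Num.truncn (`|b| / eps)).+1.
have [K hK] := @max_ndiv_bound j isT.
have j0 : (0 : R) < j%:R by rewrite ltr0n.
have be : b / j%:R <= eps.
  rewrite ler_pdivrMr // mulrC -ler_pdivrMr //.
  apply: (le_trans _ (ltW (truncnS_gt _))).
  by apply: ler_wpM2r; rewrite ?invr_ge0 ?(ltW e0) // ler_norm.
exists ((K%:R * k) `^ j%:R^-1 * 2 `^ (eps - b / j%:R)); first by rewrite mulr_ge0 ?powR_ge0.
move=> C hC; rewrite ler0n /= -mulrA.
apply: (@le_trans _ _ ((K%:R * k) `^ j%:R^-1 * C `^ (b / j%:R))); last first.
  by apply: ler_wpM2l; rewrite ?powR_ge0 // powR_le_half.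
rewrite powRrM -powRM ?mulr_ge0 ?ler0n ?powR_ge0 //.
rewrite -(@ler_pXn2r _ j) // ?nnegrE ?powR_ge0 ?ler0n //.
rewrite -[leRHS]powR_mulrn ?powR_ge0 // -powRrM mulVf ?(gt_eqF j0) // powRr1; last first.
  by rewrite !mulr_ge0 ?ler0n ?powR_ge0.
rewrite -natrX; apply: (@le_trans _ _ (K * (n C).+1)%:R); first by rewrite ler_nat.
by rewrite natrM -mulrA; apply: ler_wpM2l; rewrite ?ler0n // hn.
Qed.

End Subpolynomial.

(** * Intervals, their covering by pieces, and the final assembly *)

Section Intervals.
Variable R : realType.

Lemma nat_interval_perm (I : {fset nat}) a b : (forall m, (m \in I) = (a <= m < b)%N) ->
  perm_eq I (index_iota a b).
Proof.
move=> h; apply: uniq_perm; rewrite ?fset_uniq ?iota_uniq // => m.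
by rewrite mem_index_iota -h.
Qed.

Lemma l2norm_interval (I : {fset nat}) a b (u : nat -> R[i]) :
  (forall m, (m \in I) = (a <= m < b)%N) -> l2norm I u = interval_norm a b u.
Proof. by move=> /nat_interval_perm h; rewrite /l2norm (perm_big _ h). Qed.

Lemma piece_cover (C L : R) (c a b : nat) : 0 <= L -> 0 < C -> C < c%:R ->
  (b - a)%N%:R <= L * C `^ 2^-1 -> (b <= a + (Num.truncn (16 * L)).+1 * piece_len c)%N.
Proof.
move=> L0 C0 Cc h; rewrite -leq_subLR.
have c0 : (0 < c)%N by rewrite -(ltr0n R) (lt_trans C0).
(* 16 = 2 * 8: c <= 4 isqrt(c)^2 and isqrt(c) < 8 [piece_len c]. *)
have c16 : C `^ 2^-1 <= 16 * (piece_len c)%:R.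
  rewrite powR12_sqrt ?(ltW C0) // -(@ler_pXn2r _ 2) // ?nnegrE ?sqrtr_ge0 ?mulr_ge0 ?ler0n //.
  rewrite sqr_sqrtr ?(ltW C0) //; apply: (le_trans (ltW Cc)).
  rewrite -natrM -natrX ler_nat; apply: (leq_trans (leq_isqrt4 c0)).
  rewrite -[16%N]/(2 * 8)%N -mulnA expnMn leq_mul2l /= leq_exp2r // mulnC ltnW //.
  exact: ltn_ceil.
rewrite -(ler_nat R); apply: (le_trans h); rewrite natrM.
apply: (@le_trans _ _ (16 * L * (piece_len c)%:R)).
  by rewrite [16 * L]mulrC -mulrA; apply: ler_wpM2l.
by apply: ler_wpM2r; [rewrite ler0n | apply/ltW/truncnS_gt].
Qed.

End Intervals.

Theorem corollary1p4 (R : realType) (A B : R) (eta0 : R -> R)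
    (heta0 : o1_exponent eta0) :
  exists (K : R) (eta : R -> R), o1_exponent eta /\
  forall (C : R) (q d d' e f : nat) (I J : {fset nat}) (alpha beta : nat -> R[i]),
    2^-1 <= C ->
    (0 < d)%N -> (0 < d')%N -> (0 < e)%N ->
    q = (d * d' * e)%N -> (d' %| d)%N -> coprime d e ->
    is_largest_square_root_divisor (q * d) f ->
    is_nat_interval I -> is_nat_interval J ->
    (forall m, m \in I -> (0 < m)%N) -> (forall n, n \in J -> (0 < n)%N) ->
    #|` I|%:R <= A * C `^ (2^-1 + eta0 C) ->
    #|` J|%:R <= A * C `^ (2^-1 + eta0 C) ->
    (\max_(m <- (I `|` J)%fset) m)%N%:R <= B * C `^ B ->
    \sum_(0 <= c < (Num.truncn (2 * C)).+1 |
          (C < c%:R <= 2 * C) && (q %| c)%N)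
      cmod (\sum_(m <- I) \sum_(n <- J | gcdn (gcdn m n) q == 1%N)
              alpha m * beta n * Kloosterman R m%:Z n%:Z c)
    <= K * (l2norm I alpha * l2norm J beta * (C `^ (2 + eta C) / q%:R) *
            (f%:R / (Num.min C (d%:R ^+ 2)
                     + Num.min q%:R (d%:R ^+ 2 * (C / q%:R)))) `^ (6^-1)).
Proof.
pose L C := `|A| * C `^ eta0 C.
pose P C := (Num.truncn (16 * L C)).+1.
(* Large enough for the moduli c <= 2 C and for all indices m, n at once, so that a single D bounds
   every divisor count. *)
pose Y C := Num.truncn (2 * C + `|B| * C `^ B).
pose G C : R := (32 * bilin_const * P C ^ 2 * max_ndiv (Y C) ^ 5)%:R.
have L0 C : 0 <= L C by rewrite mulr_ge0 ?powR_ge0.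
have hG : subpolynomial G.
  have hP : subpolynomial (fun C => (P C)%:R : R).
    apply: subpolynomial_truncn; apply: (subpolynomialM (subpolynomial_cst (ler0n _ 16))).
    exact: subpolynomialM (subpolynomial_cst (normr_ge0 A)) (subpolynomial_o1 heta0).
  have hD : subpolynomial (fun C => (max_ndiv (Y C))%:R : R).
    have B1 : 0 <= `|B| by [].
    (* The exponent |B| + 1 dominates the three exponents 1, B and 0 that occur in Y + 1. *)
    apply: (@subpolynomial_max_ndiv R Y (`|B| + 1)
      (2 * 2 `^ `|B| + `|B| * 2 `^ (`|B| + 1 - B) + 2 `^ (`|B| + 1))).
      by rewrite !addr_ge0 ?mulr_ge0 ?powR_ge0.
    move=> C hC; have C0 := half_gt0 hC.
    rewrite -natr1 2!mulrDl; apply: lerD.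
      rewrite /Y; apply: (@le_trans _ _ (2 * C + `|B| * C `^ B)).
        by rewrite truncn_le addr_ge0 ?mulr_ge0 ?powR_ge0 ?(ltW C0).
      rewrite -!mulrA; apply: lerD; apply: ler_wpM2l => //.
        have := @powR_le_half _ C 1 (`|B| + 1) hC; rewrite powRr1 ?(ltW C0) // addrK.
        by apply; rewrite lerDr.
      by apply: powR_le_half => //; have := ler_norm B; lra.
    have := @powR_le_half _ C 0 (`|B| + 1) hC; rewrite powRr0 subr0; apply.
    by rewrite addr_ge0.
  apply: (subpolynomial_le (subpolynomialM (subpolynomialM (subpolynomial_cst (ler0n R (32 * bilin_const)))
    (subpolynomialX 2 hP)) (subpolynomialX 5 hD))) => C _.
  by rewrite /G ler0n /= natrM natrM !natrX.
have [K [eta [heta hK]]] := subpolynomial_o1_bound hG.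
exists K, eta; split=> // C q d d' e f I J alpha beta hC d0 d'0 e0 qE _ _ [_ hf] [a [b hI]] [a' [b' hJ]].
move=> I0 J0 cI cJ hmax; have C0 := half_gt0 hC.
have pI := nat_interval_perm hI; have pJ := nat_interval_perm hJ.
have LC : A * C `^ (2^-1 + eta0 C) <= L C * C `^ 2^-1.
  rewrite addrC powRD ?(gt_eqF C0) ?implybT // mulrA; do 2![apply: ler_wpM2r; first exact: powR_ge0].
  exact: ler_norm.
have szI : #|` I| = (b - a)%N by rewrite -(size_iota a (b - a)) -(perm_size pI).
have szJ : #|` J| = (b' - a')%N by rewrite -(size_iota a' (b' - a')) -(perm_size pJ).
have hP c : C < c%:R -> (b <= a + P C * piece_len c)%N.
  move=> Cc; apply: piece_cover C0 Cc _ => //.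
  by rewrite -szI; apply: le_trans LC.
have hP' c : C < c%:R -> (b' <= a' + P C * piece_len c)%N.
  move=> Cc; apply: piece_cover C0 Cc _ => //.
  by rewrite -szJ; apply: le_trans LC.
have Y0 : 0 <= 2 * C + `|B| * C `^ B by rewrite addr_ge0 ?mulr_ge0 ?powR_ge0 ?(ltW C0).
have hY v : v%:R <= 2 * C + `|B| * C `^ B -> (ndiv v <= max_ndiv (Y C))%N.
  by move=> vY; apply: leq_max_ndiv; rewrite truncn_ge_nat.
have hD v : (0 < v)%N -> v%:R <= 2 * C -> (ndiv v <= max_ndiv (Y C))%N.
  by move=> _ vC; apply: hY; apply: (le_trans vC); rewrite lerDl mulr_ge0 ?powR_ge0.
have hm m : m \in (I `|` J)%fset -> (ndiv m <= max_ndiv (Y C))%N.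
  move=> mIJ; apply: hY; apply: (@le_trans _ _ (B * C `^ B)).
    apply: le_trans hmax; rewrite ler_nat.
    exact: (@leq_bigmax_seq _ _ xpredT id m mIJ isT).
  apply: (@le_trans _ _ (`|B| * C `^ B)); first by rewrite ler_wpM2r ?powR_ge0 ?ler_norm.
  by rewrite lerDr mulr_ge0 ?(ltW C0).
have hIm m : (a <= m < b)%N -> (0 < m)%N /\ (ndiv m <= max_ndiv (Y C))%N.
  by rewrite -hI => mI; split; [apply: I0 | apply: hm; rewrite in_fsetU mI].
have hJm m : (a' <= m < b')%N -> (0 < m)%N /\ (ndiv m <= max_ndiv (Y C))%N.
  by rewrite -hJ => mJ; split; [apply: J0 | apply: hm; rewrite in_fsetU mJ orbT].
have main := sum_twisted alpha beta hC d0 d'0 e0 qE hf hD hIm hJm hP hP'.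
rewrite (l2norm_interval _ hI) (l2norm_interval _ hJ).
set Z := _ `^ 6^-1 in main *.
set NN := interval_norm _ _ _ * _ in main *.
have Q0 : 0 <= NN * (C ^+ 2 / q%:R) * Z.
  by rewrite !mulr_ge0 ?powR_ge0 ?interval_norm_ge0 ?exprn_ge0 ?invr_ge0 ?ler0n ?(ltW C0).
have -> : K * (NN * (C `^ (2 + eta C) / q%:R) * Z) = K * C `^ eta C * (NN * (C ^+ 2 / q%:R) * Z).
  rewrite powRD ?(gt_eqF C0) ?implybT // powR_mulrn ?(ltW C0) //; ring.
apply: le_trans (ler_wpM2r Q0 (hK C hC)); apply: le_trans main.
rewrite le_eqVlt; apply/orP; left; apply/eqP; apply: eq_bigr => c _; rewrite /twisted_sum (perm_big _ pI) /=.
by congr cmod; apply: eq_bigr => m _; rewrite (perm_big _ pJ).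
Qed.
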